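(* Let $\tau\in\{1,-1\}$, $q\in\mathcal S(\mathbb R,\mathbb C)$ and $\mathbf f\in\mathcal S(\mathbb R,\mathbb C^2)$. Assume that the spectrum of $\mathcal T$ satisfies $\sigma(\mathcal T)\subset\mathbb R$ (which is automatic when $\tau=1$) and that $a(\lambda)\neq 0$ and $A(\lambda)\neq 0$ for all $\lambda\in\mathbb R$. For $\lambda\in\mathbb R$ define $$c_+(\lambda)=\frac{1}{a(\lambda)}\int_{-\infty}^\infty\begin{bmatrix}-m_{1,-}^{(2)}(s;\lambda) & m_{1,-}^{(1)}(s;\lambda)\end{bmatrix}\mathbf f(s)\,\mathrm ds,\qquad c_-(\lambda)=-\frac{1}{A(\lambda)}\int_{-\infty}^\infty\begin{bmatrix}m_{1,+}^{(2)}(s;\lambda) & -m_{1,+}^{(1)}(s;\lambda)\end{bmatrix}\mathbf f(s)\,\mathrm ds .$$ Then for every $x\in\mathbb R$ $$\mathbf f(x)=-\frac{\sigma_3}{2\pi}\int_{-\infty}^\infty\left(c_+(\lambda)\,\mathbf m_{2,+}(x;\lambda)+c_-(\lambda)\,\mathbf m_{2,-}(x;\lambda)\right)\mathrm d\lambda .$$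
   Context: $\mathbb C^\pm$ are the open upper/lower half-planes and $\overline{\mathbb C^\pm}$ their closures. $\mathcal S(\mathbb R,\cdot)$ denotes Schwartz-class functions. Let $\sigma_3=\mathrm{diag}(1,-1)$, $\mathbf e_1=[1,0]^T$, $\mathbf e_2=[0,1]^T$, and $\mathbf Q(x)=\begin{bmatrix}0&q(x)\\ \tau\overline{q(x)}&0\end{bmatrix}$. The operator $\mathcal T=i\sigma_3\frac{\mathrm d}{\mathrm dx}-i\sigma_3\mathbf Q(x)$ acts on $L^2(\mathbb R,\mathbb C^2)$ with domain $H^1(\mathbb R,\mathbb C^2)$. Jost-like functions: for $\lambda\in\overline{\mathbb C^+}$, $\mathbf r_{1,-}(\cdot;\lambda)$ and $\mathbf r_{2,+}(\cdot;\lambda)$ are the unique bounded solutions $\mathbb R\to\mathbb C^2$ of $$\mathbf r_{1,-}(x;\lambda)=\mathbf e_1+\int_{-\infty}^x\mathrm{diag}(1,e^{2i\lambda(x-s)})\mathbf Q(s)\mathbf r_{1,-}(s;\lambda)\,\mathrm ds,\qquad \mathbf r_{2,+}(x;\lambda)=\mathbf e_2-\int_x^{\infty}\mathrm{diag}(e^{-2i\lambda(x-s)},1)\mathbf Q(s)\mathbf r_{2,+}(s;\lambda)\,\mathrm ds,$$ and for $\lambda\in\overline{\mathbb C^-}$, $\mathbf r_{2,-}(\cdot;\lambda)$ and $\mathbf r_{1,+}(\cdot;\lambda)$ are the unique bounded solutions of $$\mathbf r_{2,-}(x;\lambda)=\mathbf e_1-\int_x^{\infty}\mathrm{diag}(1,e^{2i\lambda(x-s)})\mathbf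 Q(s)\mathbf r_{2,-}(s;\lambda)\,\mathrm ds,\qquad \mathbf r_{1,+}(x;\lambda)=\mathbf e_2+\int_{-\infty}^x\mathrm{diag}(e^{-2i\lambda(x-s)},1)\mathbf Q(s)\mathbf r_{1,+}(s;\lambda)\,\mathrm ds.$$ Set $\mathbf m_{\ell,\pm}(x;\lambda)=e^{\pm i\lambda x}\mathbf r_{\ell,\pm}(x;\lambda)$ for $\ell\in\{1,2\}$; these solve $\mathbf m'=(-i\lambda\sigma_3+\mathbf Q)\mathbf m$. Superscripts $(1),(2)$ denote the two entries of a vector. The scattering coefficients are the ($x$-independent) determinants $a(\lambda)=\det[\mathbf m_{1,-}(x;\lambda)\ \ \mathbf m_{2,+}(x;\lambda)]$ for $\lambda\in\overline{\mathbb C^+}$ and $A(\lambda)=\det[\mathbf m_{2,-}(x;\lambda)\ \ \mathbf m_{1,+}(x;\lambda)]$ for $\lambda\in\overline{\mathbb C^-}$. *)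

(* Defs.v *)
From HB Require Import structures.
From mathcomp Require Import all_boot all_order all_algebra.
From mathcomp Require Import complex.
From mathcomp Require Import all_classical all_reals all_analysis.

Set Implicit Arguments.
Unset Strict Implicit.
Unset Printing Implicit Defensive.

Import Order.TTheory GRing.Theory Num.Theory.
Import numFieldNormedType.Exports.

Local Open Scope classical_set_scope.
Local Open Scope ring_scope.
Local Open Scope complex_scope.

Section Defs.
Context {R : realType}.

Local Notation C := R[i].
Local Notation C2 := 'cV[R[i]]_2.
Local Notation mu := (@lebesgue_measure R).
Local Notation Re := (@complex.Re R).
Local Notation Im := (@complex.Im R).

Definition cexp (z : C) : C :=
  (expR (Re z))%:C * (cos (Im z) +i* sin (Im z)).

(* Entries are indexed by 'I_2, so the superscripts (1) and (2) of a vector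
   are the indices 0 and 1. *)
Definition diag2 (a b : C) : 'M[C]_2 :=
  \matrix_(i, j) (if i == j then (if i == 0 then a else b) else 0).

Definition sigma3 : 'M[C]_2 := diag2 1 (-1).

Definition e1 : C2 := delta_mx 0 0.
Definition e2 : C2 := delta_mx 1 0.

Definition Qmx (tau : C) (q : R -> C) (x : R) : 'M[C]_2 :=
  q x *: delta_mx 0 1 + (tau * (q x)^*) *: delta_mx 1 0.

(* Lebesgue integrability and integrals of complex- and C^2-valued functions,
   through real and imaginary parts of the entries. *)
Definition cintegrable (D : set R) (h : R -> C) : Prop :=
  mu.-integrable D (EFin \o (Re \o h)) /\
  mu.-integrable D (EFin \o (Im \o h)).

Definition cintegral (D : set R) (h : R -> C) : C :=
  (\int[mu]_(x in D) Re (h x)) +i* (\int[mu]_(x in D) Im (h x)).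

Definition vintegrable (D : set R) (F : R -> C2) : Prop :=
  forall i, cintegrable D (fun x => F x i 0).

Definition vintegral (D : set R) (F : R -> C2) : C2 :=
  \col_i cintegral D (fun x => F x i 0).

Definition schwartz (g : R -> R) : Prop :=
  (forall n x, derivable (g^`(n))%classic x 1) /\
  (forall k n, exists M : R, forall x, `|x ^+ k * (g^`(n))%classic x| <= M).

Definition cschwartz (h : R -> C) : Prop :=
  schwartz (Re \o h) /\ schwartz (Im \o h).

Definition vschwartz (F : R -> C2) : Prop :=
  forall i, cschwartz (fun x => F x i 0).

(* Elements of L^2(R, C^2) are represented by functions, considered up to
   equality almost everywhere. *)
Definition norm2 (v : C2) : R := Num.sqrt (\sum_i Normc.normc (v i 0) ^+ 2).

Definition L2norm (u : R -> C2) : \bar R :=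
  ('N[mu]_2 [EFin \o (norm2 \o u)])%E.

Definition L2 (u : R -> C2) : Prop :=
  (forall i, measurable_fun setT (fun x => Re (u x i 0)) /\
             measurable_fun setT (fun x => Im (u x i 0))) /\
  (L2norm u < +oo)%E.

Definition test_function (phi : R -> R) : Prop :=
  (forall n x, derivable (phi^`(n))%classic x 1) /\
  (exists M : R, forall x, M < `|x| -> phi x = 0).

Definition weak_derivative (u v : R -> C2) : Prop :=
  forall phi, test_function phi ->
    vintegral setT (fun x => ((phi^`())%classic x)%:C *: u x) =
    - vintegral setT (fun x => (phi x)%:C *: v x).

(* Unbounded operators on L^2(R, C^2) are given by their graphs:
   [calT tau q u w] means that u is in the domain H^1(R, C^2), with weak
   derivative u', and that w = i sigma3 u' - i sigma3 Q u. *)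
Definition calT (tau : C) (q : R -> C) (u w : R -> C2) : Prop :=
  exists u' : R -> C2,
    [/\ L2 u, L2 u', weak_derivative u u', L2 w &
        {ae mu, forall x, w x = 'i *: (sigma3 *m u' x)
                                - 'i *: (sigma3 *m Qmx tau q x *m u x)}].

Definition solves (T : (R -> C2) -> (R -> C2) -> Prop) (lam : C)
    (u g : R -> C2) : Prop :=
  exists2 w, T u w & {ae mu, forall x, w x - lam *: u x = g x}.

(* T - lam is a bijection from the domain of T onto L^2, with a bounded
   inverse. *)
Definition resolvent_set (T : (R -> C2) -> (R -> C2) -> Prop) : set C :=
  [set lam |
    (forall g u1 u2, L2 g -> solves T lam u1 g -> solves T lam u2 g ->
       {ae mu, forall x, u1 x = u2 x}) /\
    (exists K : R, forall g, L2 g ->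
       exists2 u, solves T lam u g & (L2norm u <= K%:E * L2norm g)%E)].

Definition spectrum (T : (R -> C2) -> (R -> C2) -> Prop) : set C :=
  ~` resolvent_set T.

(* Bounded solutions of
     r(x) = e + eps * int_(D x) K(x - s) Q(s) r(s) ds;
   integrability is the requirement that the integral makes sense. *)
Definition bounded_solution (tau : C) (q : R -> C) (e : C2) (eps : C)
    (D : R -> set R) (K : R -> 'M[C]_2) : set (R -> C2) :=
  [set r : R -> C2 |
    (exists M : R, forall x i, Normc.normc (r x i 0) <= M) /\
    (forall x,
       vintegrable (D x) (fun s => K (x - s) *m Qmx tau q s *m r s) /\
       r x = e + eps *:
         vintegral (D x) (fun s => K (x - s) *m Qmx tau q s *m r s))].

Definition unique_bounded_solution (tau : C) (q : R -> C) (e : C2) (eps : C)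
    (D : R -> set R) (K : R -> 'M[C]_2) : R -> C2 :=
  xget (fun=> 0) (bounded_solution tau q e eps D K).

Section Jost.
Variables (tau : C) (q : R -> C).

(* The suffixes m and p stand for the subscripts - and +. The functions r1m
   and r2p are meaningful for 0 <= Im lam, and r2m and r1p for Im lam <= 0. *)
Definition r1m (x : R) (lam : C) : C2 :=
  unique_bounded_solution tau q e1 1 (fun x => `]-oo, x]%classic)
    (fun t => diag2 1 (cexp (2 * 'i * lam * t%:C))) x.

Definition r2p (x : R) (lam : C) : C2 :=
  unique_bounded_solution tau q e2 (-1) (fun x => `[x, +oo[%classic)
    (fun t => diag2 (cexp (- (2 * 'i * lam * t%:C))) 1) x.

Definition r2m (x : R) (lam : C) : C2 :=
  unique_bounded_solution tau q e1 (-1) (fun x => `[x, +oo[%classic)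
    (fun t => diag2 1 (cexp (2 * 'i * lam * t%:C))) x.

Definition r1p (x : R) (lam : C) : C2 :=
  unique_bounded_solution tau q e2 1 (fun x => `]-oo, x]%classic)
    (fun t => diag2 (cexp (- (2 * 'i * lam * t%:C))) 1) x.

Definition m1m (x : R) (lam : C) : C2 := cexp (- ('i * lam * x%:C)) *: r1m x lam.
Definition m2p (x : R) (lam : C) : C2 := cexp ('i * lam * x%:C) *: r2p x lam.
Definition m2m (x : R) (lam : C) : C2 := cexp (- ('i * lam * x%:C)) *: r2m x lam.
Definition m1p (x : R) (lam : C) : C2 := cexp ('i * lam * x%:C) *: r1p x lam.

(* The determinants do not depend on x, since both columns solve
   m' = (- i lam sigma3 + Q) m, whose matrix has trace 0; they are evaluated
   at x = 0. *)
Definition scat_a (lam : C) : C := \det (row_mx (m1m 0 lam) (m2p 0 lam)).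
Definition scat_A (lam : C) : C := \det (row_mx (m2m 0 lam) (m1p 0 lam)).

Definition c_plus (f : R -> C2) (lam : R) : C :=
  (scat_a lam%:C)^-1 *
  cintegral setT (fun s => - m1m s lam%:C 1 0 * f s 0 0
                           + m1m s lam%:C 0 0 * f s 1 0).

Definition c_minus (f : R -> C2) (lam : R) : C :=
  - (scat_A lam%:C)^-1 *
  cintegral setT (fun s => m1p s lam%:C 1 0 * f s 0 0
                           - m1p s lam%:C 0 0 * f s 1 0).

End Jost.
End Defs.

(* Main.v *)
Require Import Defs.
From mathcomp Require Import all_boot all_order all_algebra.
From mathcomp Require Import complex.
From mathcomp Require Import all_classical all_reals all_analysis measurable_realfun.
From mathcomp Require Import ring lra.

Set Implicit Arguments.
Unset Strict Implicit.

Import Order.TTheory GRing.Theory Num.Theory.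
Import numFieldNormedType.Exports.

Local Open Scope classical_set_scope.
Local Open Scope ring_scope.
Local Open Scope complex_scope.

(** Write $p = \tau \bar q$. For $\mathrm{Im}\, z \ge 0$ the two Jost solutions
   $\mathbf m_{1,-}$ and $\mathbf m_{2,+}$ and their determinant $a(z)$ yield, by
   variation of constants, the solution $S(z)$ of
   $y' = (-iz\sigma_3 + Q) y + f$, that is $S(z) = (T - z)^{-1} i \sigma_3 f$ in
   the open half-plane. The lower half-plane is not treated separately: exchanging
   the two components of a vector turns $(q, p, z)$ into $(p, q, -z)$, and carries
   $\mathbf m_{1,+}, \mathbf m_{2,-}, A$ to the former objects.

   On the real line the two boundary values of the resolvent solve the same
   equation, and their difference is exactly
   $c_+ \mathbf m_{2,+} + c_- \mathbf m_{2,-}$ ([S_jump]). So the integral in the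
   theorem is that of the jump of the resolvent. Two integrations by parts give
   $S(z) = \mp i f / (z + i) + G(z) / (z+i)^2$ with $G$ bounded and holomorphic on
   the closed upper half-plane ([S_expand]). The remainders integrate to zero along
   the real line ([contour]), and the two leading terms add up to
   $\mp 2 f / (1 + \lambda^2)$, with integral $\mp 2 \pi f$; the signs are those of
   $-\sigma_3$.

   Boundedness of $G$ requires a positive lower bound for $|a|$ and $|A|$
   ([aco_lower]). Both tend to 1 at infinity; real zeros are excluded by hypothesis,
   and a zero off the real line would produce an eigenfunction of the operator, hence
   a nonreal point of the spectrum ([eigen_exists], [spectrum_eigen]).

   Holomorphy is used in a discrete form ([hol]): $g$ is bounded and Lipschitz, and
   $g(z + iw) - g(z) - i (g(z + w) - g(z))$ is at most $B w^2$. For Jost solutions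
   this follows from a Gronwall estimate for first and second differences
   ([gronwall], [jsol_hol3]), and it passes through algebraic operations and
   integrals. It makes the integral over the line of height $e$ change by
   $O(w^2)$ when $e$ increases by $w$; hence that integral does not depend on $e$,
   and letting $e$ tend to infinity shows that it is zero. *)

Local Notation cn := (@Normc.normc _).
Local Notation cRe := (@complex.Re _).
Local Notation cIm := (@complex.Im _).

(** * Complex numbers and the exponential *)

Section ComplexNumbers.
Context {R : realType}.
Local Notation C := R[i].
Implicit Types (z w : C) (x y : R).

Lemma complexP z w : cRe z = cRe w -> cIm z = cIm w -> z = w.
Proof. by case: z => a b; case: w => c d /= -> ->. Qed.

Lemma ReD z w : cRe (z + w) = cRe z + cRe w.
Proof. by case: z; case: w. Qed.
Lemma ImD z w : cIm (z + w) = cIm z + cIm w.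
Proof. by case: z; case: w. Qed.
Lemma ReN z : cRe (- z) = - cRe z. Proof. by case: z. Qed.
Lemma ImN z : cIm (- z) = - cIm z. Proof. by case: z. Qed.
Lemma ReB z w : cRe (z - w) = cRe z - cRe w.
Proof. by rewrite ReD ReN. Qed.
Lemma ImB z w : cIm (z - w) = cIm z - cIm w.
Proof. by rewrite ImD ImN. Qed.
Lemma ReM z w : cRe (z * w) = cRe z * cRe w - cIm z * cIm w.
Proof. by case: z; case: w. Qed.
Lemma ImM z w : cIm (z * w) = cRe z * cIm w + cIm z * cRe w.
Proof. by case: z => a b; case: w => c d. Qed.
Lemma ReR x : cRe (x%:C) = x. Proof. by []. Qed.
Lemma ImR x : cIm (x%:C) = 0. Proof. by []. Qed.
Lemma Rei : cRe ('i : C) = 0. Proof. by []. Qed.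
Lemma Imi : cIm ('i : C) = 1. Proof. by []. Qed.
Lemma Re1 : cRe (1 : C) = 1. Proof. by []. Qed.
Lemma Im1 : cIm (1 : C) = 0. Proof. by []. Qed.
Lemma Re0 : cRe (0 : C) = 0. Proof. by []. Qed.
Lemma Im0 : cIm (0 : C) = 0. Proof. by []. Qed.
Lemma Re_nat n : cRe (n%:R : C) = n%:R.
Proof. by elim: n => // n IH; rewrite -addn1 !natrD ReD IH. Qed.
Lemma Im_nat n : cIm (n%:R : C) = 0.
Proof. by elim: n => // n IH; rewrite -addn1 !natrD ImD IH addr0. Qed.

Definition ReImE := (ReD, ImD, ReN, ImN, ReM, ImM, ReR, ImR, Rei, Imi,
  Re1, Im1, Re0, Im0, Re_nat, Im_nat).

Lemma ii : 'i * 'i = -1 :> C.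
Proof. by rewrite -expr2 sqr_i. Qed.

Lemma cnE z : cn z = Num.sqrt (cRe z ^+ 2 + cIm z ^+ 2).
Proof. by case: z. Qed.

Lemma cn_ge0 z : 0 <= cn z.
Proof. by rewrite cnE sqrtr_ge0. Qed.

Lemma cn0 : cn (0 : C) = 0. Proof. exact: Normc.normc0. Qed.
Lemma cn1 : cn (1 : C) = 1. Proof. exact: Normc.normc1. Qed.
Lemma cnM z w : cn (z * w) = cn z * cn w. Proof. exact: Normc.normcM. Qed.
Lemma cnV z : cn z^-1 = (cn z)^-1. Proof. exact: Normc.normcV. Qed.
Lemma cnN z : cn (- z) = cn z. Proof. exact: normcN. Qed.
Lemma cnD z w : cn (z + w) <= cn z + cn w. Proof. exact: le_normcD. Qed.
Lemma cnB z w : cn (z - w) <= cn z + cn w.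
Proof. by rewrite -(cnN w); exact: cnD. Qed.
Lemma cnBC z w : cn (z - w) = cn (w - z).
Proof. by rewrite -cnN opprB. Qed.
Lemma cn_eq0 z : cn z = 0 -> z = 0. Proof. exact: Normc.eq0_normc. Qed.
Lemma cn_gt0 z : z != 0 -> 0 < cn z.
Proof.
move=> z0; rewrite lt_neqAle cn_ge0 andbT eq_sym.
by apply: contra z0 => /eqP/cn_eq0 ->.
Qed.
Lemma cnR x : cn (x%:C) = `|x|.
Proof. by rewrite cnE /= expr0n addr0 sqrtr_sqr. Qed.
Lemma cni : cn ('i : C) = 1.
Proof. by rewrite cnE /= expr0n add0r expr1n sqrtr1. Qed.
Lemma cn_sqr z : cn z ^+ 2 = cRe z ^+ 2 + cIm z ^+ 2.
Proof. by rewrite cnE sqr_sqrtr// addr_ge0// sqr_ge0. Qed.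

Lemma Re_le z : `|cRe z| <= cn z.
Proof. by rewrite cnE -sqrtr_sqr ler_wsqrtr// lerDl sqr_ge0. Qed.
Lemma Im_le z : `|cIm z| <= cn z.
Proof. by rewrite cnE -sqrtr_sqr ler_wsqrtr// lerDr sqr_ge0. Qed.
Lemma cn_le z : cn z <= `|cRe z| + `|cIm z|.
Proof.
rewrite [X in cn X]complexE; apply: le_trans (cnD _ _) _.
by rewrite cnM cni mul1r !cnR.
Qed.

Lemma cn_exp z n : cn (z ^+ n) = cn z ^+ n.
Proof. by elim: n => [|n IH]; rewrite ?expr0 ?cn1// !exprS cnM IH. Qed.

Lemma cn_nat n : cn (n%:R : C) = n%:R.
Proof. by rewrite cnE Re_nat Im_nat expr0n addr0 sqrtr_sqr normr_nat. Qed.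

Lemma cexpE z : cexp z =
  (expR (cRe z) * cos (cIm z)) +i* (expR (cRe z) * sin (cIm z)).
Proof. by apply: complexP; rewrite /cexp ReImE /= ?mul0r ?subr0 ?addr0. Qed.

Lemma Re_cexp z : cRe (cexp z) = expR (cRe z) * cos (cIm z).
Proof. by rewrite cexpE. Qed.
Lemma Im_cexp z : cIm (cexp z) = expR (cRe z) * sin (cIm z).
Proof. by rewrite cexpE. Qed.

Lemma cexpD z w : cexp (z + w) = cexp z * cexp w.
Proof.
apply: complexP.
  by rewrite [in RHS]ReM !Re_cexp !Im_cexp ReD ImD expRD cosD; ring.
by rewrite [in RHS]ImM !Re_cexp !Im_cexp ReD ImD expRD sinD; ring.
Qed.

Lemma cexp0 : cexp 0 = 1 :> C.
Proof.
by apply: complexP; rewrite ?Re_cexp ?Im_cexp /= expR0 mul1r ?cos0 ?sin0.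
Qed.

Lemma cn_cexp z : cn (cexp z) = expR (cRe z).
Proof.
rewrite cnE Re_cexp Im_cexp !exprMn -mulrDr cos2Dsin2 mulr1 sqrtr_sqr.
by rewrite ger0_norm// expR_ge0.
Qed.

Lemma cexp_neq0 z : cexp z != 0.
Proof.
apply/eqP => /(congr1 cn); rewrite cn_cexp cn0 => /eqP.
by rewrite gt_eqF// expR_gt0.
Qed.

Lemma cn_cexp_le1 z : cRe z <= 0 -> cn (cexp z) <= 1.
Proof. by rewrite cn_cexp => h; rewrite -(@expR0 R) ler_expR. Qed.

End ComplexNumbers.

Arguments cexp : simpl never.
Arguments Normc.normc : simpl never.

(** * Derivatives and continuity of complex-valued functions *)

Section Calculus.
Context {R : realType}.
Local Notation C := R[i].

Definition ccont (F : R -> C) : Prop :=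
  continuous (cRe \o F) /\ continuous (cIm \o F).

Definition cder (F : R -> C) (x : R) (d : C) : Prop :=
  is_derive x (1 : R) (cRe \o F) (cRe d) /\ is_derive x (1 : R) (cIm \o F) (cIm d).

Lemma is_derive_rM (f g : R -> R) (x df dg : R) :
  is_derive x (1 : R) f df -> is_derive x (1 : R) g dg ->
  is_derive x (1 : R) (fun t => f t * g t) (df * g x + f x * dg).
Proof.
move=> hf hg; have := @is_deriveM _ _ f g x 1 df dg hf hg.
rewrite (_ : f * g = fun t => f t * g t)//.
by rewrite /GRing.scale/= => h; refine (is_derive_eq h _); ring.
Qed.

Lemma is_derive_rD (f g : R -> R) (x df dg : R) :
  is_derive x (1 : R) f df -> is_derive x (1 : R) g dg ->
  is_derive x (1 : R) (fun t => f t + g t) (df + dg).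
Proof. exact: is_deriveD. Qed.

Lemma is_derive_rB (f g : R -> R) (x df dg : R) :
  is_derive x (1 : R) f df -> is_derive x (1 : R) g dg ->
  is_derive x (1 : R) (fun t => f t - g t) (df - dg).
Proof. exact: is_deriveB. Qed.

Lemma is_derive_cont (f : R -> R) (x df : R) :
  is_derive x (1 : R) f df -> {for x, continuous f}.
Proof.
by move=> [df1 _]; apply/differentiable_continuous/derivable1_diffP.
Qed.

Lemma cder_cont F (d : R -> C) : (forall x, cder F x (d x)) -> ccont F.
Proof.
move=> h; split => x.
  exact: is_derive_cont (h x).1.
exact: is_derive_cont (h x).2.
Qed.

Lemma cder_ext F G x d : (forall t, F t = G t) -> cder F x d -> cder G x d.
Proof. by move=> /funext ->. Qed.

Lemma cder_eq F x d d' : cder F x d -> d = d' -> cder F x d'.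
Proof. by move=> h <-. Qed.

Lemma cder_cst (c : C) x : cder (fun=> c) x 0.
Proof. by split; apply: is_derive_cst. Qed.

Lemma cderD F G x d e : cder F x d -> cder G x e ->
  cder (fun t => F t + G t) x (d + e).
Proof.
move=> [h1 h2] [k1 k2]; split.
- rewrite ReD (_ : _ \o _ = fun t => cRe (F t) + cRe (G t)).
    exact: is_derive_rD.
  by apply/funext => t; rewrite /= ReD.
- rewrite ImD (_ : _ \o _ = fun t => cIm (F t) + cIm (G t)).
    exact: is_derive_rD.
  by apply/funext => t; rewrite /= ImD.
Qed.

Lemma cderM F G x d e : cder F x d -> cder G x e ->
  cder (fun t => F t * G t) x (d * G x + F x * e).
Proof.
move=> [h1 h2] [k1 k2]; split.
- rewrite (_ : _ \o _ = fun t => cRe (F t) * cRe (G t) -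
      cIm (F t) * cIm (G t)); last first.
    by apply/funext => t; rewrite /= ReM.
  refine (is_derive_eq (is_derive_rB (is_derive_rM h1 k1)
    (is_derive_rM h2 k2)) _).
  by rewrite !ReImE /=; ring.
- rewrite (_ : _ \o _ = fun t => cRe (F t) * cIm (G t) +
      cIm (F t) * cRe (G t)); last first.
    by apply/funext => t; rewrite /= ImM.
  refine (is_derive_eq (is_derive_rD (is_derive_rM h1 k2)
    (is_derive_rM h2 k1)) _).
  by rewrite !ReImE /=; ring.
Qed.

Lemma cderZ (c : C) F x d : cder F x d -> cder (fun t => c * F t) x (c * d).
Proof.
by move=> h; apply: cder_eq (cderM (cder_cst c x) h) _; rewrite mul0r add0r.
Qed.

Lemma cderN F x d : cder F x d -> cder (fun t => - F t) x (- d).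
Proof.
move=> /(cderZ (-1)); rewrite mulN1r.
by apply: cder_ext => t; rewrite mulN1r.
Qed.

Lemma cderB F G x d e : cder F x d -> cder G x e ->
  cder (fun t => F t - G t) x (d - e).
Proof. by move=> h k; apply: cderD => //; apply: cderN. Qed.

Lemma is_derive_comp_aff (f : R -> R) (a b x d : R) :
  is_derive (a * x + b) (1 : R) f d ->
  is_derive x (1 : R) (fun t => f (a * t + b)) (a * d).
Proof.
move=> h.
have h2 : is_derive x (1 : R) (fun t : R => a * t + b) a.
  have h3 := is_derive_rD (is_derive_rM (is_derive_cst a x 1)
    (is_derive_id x 1)) (is_derive_cst b x 1).
  by refine (is_derive_eq h3 _); rewrite mul0r add0r addr0 mulr1.
refine (is_derive_eq (@is_derive1_comp _ f (fun t : R => a * t + b) x _ _ h h2) _).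
by rewrite mulrC.
Qed.

Lemma cder_aff F (a b x : R) d : cder F (a * x + b) d ->
  cder (fun t => F (a * t + b)) x (a%:C * d).
Proof.
move=> [h k]; split.
- refine (is_derive_eq (is_derive_comp_aff h) _).
  by rewrite !ReImE; ring.
- refine (is_derive_eq (is_derive_comp_aff k) _).
  by rewrite !ReImE; ring.
Qed.

Lemma cder_opp F (x : R) d : cder F (- x) d ->
  cder (fun t => F (- t)) x (- d).
Proof.
move=> h; have h' : cder F (-1 * x + 0) d by rewrite mulN1r addr0.
have := cder_aff h'; rewrite rmorphN rmorph1 mulN1r.
by apply: cder_ext => t; rewrite mulN1r addr0.
Qed.

Lemma cder_shift F (b x : R) d : cder F (x + b) d ->
  cder (fun t => F (t + b)) x d.
Proof.
move=> h; have h' : cder F (1 * x + b) d by rewrite mul1r.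
have := cder_aff h'; rewrite rmorph1 mul1r.
by apply: cder_ext => t; rewrite mul1r.
Qed.

Lemma cder_cexp (c : C) x :
  cder (fun t => cexp (c * t%:C)) x (c * cexp (c * x%:C)).
Proof.
have hE : is_derive x (1 : R) (fun t => expR (cRe c * t + 0))
    (cRe c * expR (cRe c * x + 0)).
  exact: is_derive_comp_aff.
have hC : is_derive x (1 : R) (fun t => cos (cIm c * t + 0))
    (cIm c * - sin (cIm c * x + 0)).
  exact: is_derive_comp_aff.
have hS : is_derive x (1 : R) (fun t => sin (cIm c * t + 0))
    (cIm c * cos (cIm c * x + 0)).
  exact: is_derive_comp_aff.
have eR t : cRe (c * t%:C) = cRe c * t + 0 by rewrite !ReImE; ring.
have eI t : cIm (c * t%:C) = cIm c * t + 0 by rewrite !ReImE; ring.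
split.
- rewrite (_ : _ \o _ = fun t => expR (cRe c * t + 0) * cos (cIm c * t + 0)).
    refine (is_derive_eq (is_derive_rM hE hC) _).
    by rewrite (ReM c) Re_cexp Im_cexp eR eI; ring.
  by apply/funext => t; rewrite [LHS](Re_cexp (c * t%:C)) eR eI.
- rewrite (_ : _ \o _ = fun t => expR (cRe c * t + 0) * sin (cIm c * t + 0)).
    refine (is_derive_eq (is_derive_rM hE hS) _).
    by rewrite (ImM c) Re_cexp Im_cexp eR eI; ring.
  by apply/funext => t; rewrite [LHS](Im_cexp (c * t%:C)) eR eI.
Qed.

Lemma ccont_cst (c : C) : ccont (fun=> c).
Proof. exact: (cder_cont (cder_cst c)). Qed.

Lemma ccontD F G : ccont F -> ccont G -> ccont (fun t => F t + G t).
Proof.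
move=> [h1 h2] [k1 k2]; split => x.
- rewrite (_ : _ \o _ = fun t => cRe (F t) + cRe (G t)).
    by apply: cvgD; [exact: h1|exact: k1].
  by apply/funext => t; rewrite /= ReD.
- rewrite (_ : _ \o _ = fun t => cIm (F t) + cIm (G t)).
    by apply: cvgD; [exact: h2|exact: k2].
  by apply/funext => t; rewrite /= ImD.
Qed.

Lemma ccontM F G : ccont F -> ccont G -> ccont (fun t => F t * G t).
Proof.
move=> [h1 h2] [k1 k2]; split => x.
- rewrite (_ : _ \o _ = fun t => cRe (F t) * cRe (G t) - cIm (F t) * cIm (G t)).
    by apply: cvgB; apply: cvgM; [exact: h1|exact: k1|exact: h2|exact: k2].
  by apply/funext => t; rewrite /= ReM.
- rewrite (_ : _ \o _ = fun t => cRe (F t) * cIm (G t) + cIm (F t) * cRe (G t)).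
    by apply: cvgD; apply: cvgM; [exact: h1|exact: k2|exact: h2|exact: k1].
  by apply/funext => t; rewrite /= ImM.
Qed.

Lemma ccontZ c F : ccont F -> ccont (fun t => c * F t).
Proof. by apply: ccontM; exact: ccont_cst. Qed.

Lemma ccont_ext F G : (forall t, F t = G t) -> ccont F -> ccont G.
Proof. by move=> /funext ->. Qed.

Lemma ccontN F : ccont F -> ccont (fun t => - F t).
Proof.
by move=> /(ccontZ (-1)); apply: ccont_ext => t; rewrite mulN1r.
Qed.

Lemma ccontB F G : ccont F -> ccont G -> ccont (fun t => F t - G t).
Proof. by move=> h k; apply: ccontD => //; exact: ccontN. Qed.

Lemma ccont_comp F (g : R -> R) : ccont F -> continuous g ->
  ccont (fun t => F (g t)).
Proof.
move=> [h1 h2] hg; split => x.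
- exact: (continuous_comp (hg x) (h1 (g x))).
- exact: (continuous_comp (hg x) (h2 (g x))).
Qed.

Lemma ccont_opp F : ccont F -> ccont (fun t => F (- t)).
Proof. by move=> h; apply: (ccont_comp h) => x; exact: opp_continuous. Qed.

Lemma ccont_cexp (c : C) : ccont (fun t => cexp (c * t%:C)).
Proof. exact: cder_cont (cder_cexp c). Qed.

Lemma is_derive0_cst (f : R -> R) : (forall x, is_derive x (1 : R) f 0) ->
  forall x y, f x = f y.
Proof. by move=> h x y; exact: is_derive_0_is_cst. Qed.

Lemma cder0_cst F : (forall x, cder F x 0) -> forall x y, F x = F y.
Proof.
move=> h x y; apply: complexP.
- exact: (is_derive0_cst (fun t => (h t).1) x y).
- exact: (is_derive0_cst (fun t => (h t).2) x y).
Qed.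

(** Continuity along horizontal lines comes out of the finite-difference bounds
   of holomorphic functions in this form. *)
Lemma ccont_lip F (B : R) :
  (forall x w, 0 < w -> w <= 1 -> cn (F (x + w) - F x) <= B * w) -> ccont F.
Proof.
move=> h.
have hh x y : `|x - y| <= 1 -> cn (F y - F x) <= B * `|x - y|.
  case: (ltgtP x y) => [xy|xy|-> _]; last first.
  - by rewrite subrr cn0 subrr normr0 mulr0.
  - rewrite gtr0_norm ?subr_gt0// cnBC => h1.
    rewrite (_ : F x = F (y + (x - y))); last by congr F; ring.
    by apply: h => //; rewrite subr_gt0.
  - rewrite distrC gtr0_norm ?subr_gt0// => h1.
    rewrite (_ : F y = F (x + (y - x))); last by congr F; ring.
    by apply: h => //; rewrite subr_gt0.
have B0 : 0 <= B.
  by have := h 0 1 ltr01 (lexx _); rewrite mulr1; apply: le_trans; exact: cn_ge0.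
have key (g : C -> R) : (forall z w, `|g z - g w| <= cn (z - w)) ->
    continuous (g \o F).
  move=> hg x; apply/cvgrPdist_lt => e e0.
  have d0 : 0 < Num.min 1 (e / (B + 1)) :> R.
    by rewrite lt_min ltr01 divr_gt0// ltr_pwDr.
  near=> t.
  have : `|x - t| < Num.min 1 (e / (B + 1)) by near: t; exact: cvgr_dist_lt.
  rewrite lt_min => /andP[/ltW h1 h2].
  rewrite /=; apply: le_lt_trans (hg _ _) _; rewrite cnBC.
  apply: le_lt_trans (hh _ _ h1) _.
  move: h2; rewrite ltr_pdivlMr ?ltr_pwDr// => h2.
  by apply: le_lt_trans h2; rewrite mulrC ler_wpM2l// lerDl.
split; apply: key => z w.
- by rewrite -ReB Re_le.
- by rewrite -ImB Im_le.
Unshelve. all: by end_near. Qed.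

End Calculus.

(** * Lebesgue integrals under reflection *)

Section Reflection.
Context {R : realType}.
Local Notation mu := (@lebesgue_measure R).

Lemma mopp : measurable_fun [set: R] (-%R : R -> R).
Proof. by apply: continuous_measurable_fun; exact: opp_continuous. Qed.

Lemma preimage_opp_itv (a b : R) :
  (-%R : R -> R) @^-1` `]a, b] = `[(- b), (- a)[%classic.
Proof.
apply/seteqP; split => x /=; rewrite !in_itv/=; move=> /andP[h1 h2];
  apply/andP; split; lra.
Qed.

(** Reflected Lebesgue measure agrees with Lebesgue measure on half-open
   intervals, which determine it. *)
Lemma lebesgue_measure_opp (A : set R) : measurable A ->
  mu ((-%R : R -> R) @^-1` A) = mu A.
Proof.
move=> mA.
have mf : measurable_fun [set: measurableTypeR R]
  (-%R : measurableTypeR R -> measurableTypeR R) by exact: mopp.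
pose nu : measure (measurableTypeR R) R :=
  [the measure (measurableTypeR R) R of
    @pushforward _ _ (measurableTypeR R) (measurableTypeR R) _ mu -%R].
have -> : mu A = nu mf A.
  refine (@lebesgue_measure_unique R (nu mf) _ A mA) => X [[a b] _ <-].
  rewrite /nu /= /pushforward preimage_opp_itv !lebesgue_measure_itv/= !lte_fin.
  rewrite ltrN2; case: ifPn => // _.
  by rewrite -!EFinD/= opprK addrC.
by [].
Qed.

Local Open Scope ereal_scope.

Lemma integral_opp (D : set R) (f : R -> \bar R) : measurable D ->
  measurable_fun setT f -> mu.-integrable D f ->
  mu.-integrable ((-%R : R -> R) @^-1` D) (f \o -%R) /\
  \int[mu]_(x in ((-%R : R -> R) @^-1` D)) (f \o -%R) x =
    \int[mu]_(x in D) f x.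
Proof.
move=> mD mf hf.
have mo : measurable_fun [set: measurableTypeR R]
  (-%R : measurableTypeR R -> measurableTypeR R) by exact: mopp.
pose nu : measure (measurableTypeR R) R :=
  [the measure (measurableTypeR R) R of
    @pushforward _ _ (measurableTypeR R) (measurableTypeR R) _ mu -%R].
have E A : measurable A -> nu mo A = mu A by exact: lebesgue_measure_opp.
have i1 : mu.-integrable ((-%R : R -> R) @^-1` D) (f \o -%R).
  apply/integrableP; split.
    by apply: measurable_funTS; exact: measurableT_comp.
  have := @ge0_integral_pushforward _ _ _ _ _ _ mo mu D (fun x => `|f x|%E) mD.
  rewrite /comp => <-; last 2 first.
  - by apply: measurable_funTS; exact: measurableT_comp.
  - by move=> y _; exact: abse_ge0.
  have -> : \int[nu mo]_(y in D) `|f y|%E = \int[mu]_(y in D) `|f y|%E.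
    by apply: eq_measure_integral => A mA _; exact: E.
  by move/integrableP : hf => [].
split => //.
rewrite -(@integral_pushforward _ _ _ _ _ _ mo mu D f mf i1 mD).
transitivity (\int[nu mo]_(x in D) f x) => //.
by apply: eq_measure_integral => A mA _; exact: E.
Qed.

Lemma Rintegral_opp (D : set R) (f : R -> R) : measurable D ->
  mu.-integrable D (EFin \o f) ->
  mu.-integrable ((-%R : R -> R) @^-1` D) (EFin \o (f \o -%R)) /\
  (\int[mu]_(x in ((-%R : R -> R) @^-1` D)) f (- x) = \int[mu]_(x in D) f x)%R.
Proof.
move=> mD hf.
have mf : measurable_fun setT ((EFin \o f) \_ D).
  by apply/(measurable_restrictT _ mD); move/integrableP : hf => [].
have hf2 : mu.-integrable D ((EFin \o f) \_ D).
  apply: eq_integrable hf => // x xD.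
  by rewrite patchE xD.
have mDo : @measurable _ (measurableTypeR R) ((-%R : R -> R) @^-1` D).
  by rewrite -[X in measurable X]setTI; exact: mopp.
have ext : {in ((-%R : R -> R) @^-1` D),
    ((EFin \o f) \_ D) \o -%R =1 EFin \o (f \o -%R)}.
  move=> x; rewrite inE/= => xD.
  by rewrite patchE mem_set.
have [i1 e1] := integral_opp mD mf hf2.
split; first by refine (eq_integrable mDo _ _ ext i1).
rewrite /Rintegral; congr fine.
transitivity (\int[mu]_(x in D) ((EFin \o f) \_ D) x).
  rewrite -e1; apply: eq_integral => x xD.
  by rewrite (ext x xD).
by apply: eq_integral => x xD; rewrite patchE xD.
Qed.

End Reflection.

(** * The weight $1/(1+x^2)$ and its primitive *)

Section Weights.
Context {R : realType}.
Local Notation mu := (@lebesgue_measure R).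

(** The decay of every integrand is measured against this weight, whose primitive
   [phi] is bounded by $\pi$. *)
Definition om (x : R) : R := (oneDsqr x)^-1.
Definition phi (x : R) : R := atan x + pi / 2.

Lemma W_ge1 (x : R) : 1 <= oneDsqr x. Proof. exact: oneDsqr_ge1. Qed.
Lemma W_gt0 (x : R) : 0 < oneDsqr x.
Proof. exact: lt_le_trans ltr01 (W_ge1 x). Qed.
Lemma WE (x : R) : oneDsqr x = 1 + x ^+ 2. Proof. by []. Qed.
Lemma om_gt0 x : 0 < om x. Proof. by rewrite invr_gt0 W_gt0. Qed.
Lemma om_ge0 x : 0 <= om x. Proof. exact/ltW/om_gt0. Qed.
Lemma om_le1 x : om x <= 1.
Proof. by rewrite /om invf_le1 ?W_ge1// W_gt0. Qed.
Lemma Wom x : oneDsqr x * om x = 1.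
Proof. by rewrite mulfV// gt_eqF// W_gt0. Qed.
Lemma om_opp x : om (- x) = om x.
Proof. by rewrite /om /oneDsqr sqrrN. Qed.
Lemma om_cont : continuous om. Proof. exact: continuous_oneDsqrV. Qed.

Lemma phi_gt0 x : 0 < phi x.
Proof. by rewrite /phi -ltrBlDr sub0r atan_gtNpi2. Qed.
Lemma phi_ge0 x : 0 <= phi x. Proof. exact/ltW/phi_gt0. Qed.
Lemma phi_lepi x : phi x <= pi.
Proof. by have := atan_ltpi2 x; rewrite /phi => h; lra. Qed.

Lemma phi_der x : is_derive x (1 : R) phi (om x).
Proof.
refine (is_derive_eq (is_derive_rD (is_derive1_atan x)
  (is_derive_cst (pi / 2) x 1)) _).
by rewrite addr0.
Qed.

Lemma phi_van (e : R) : 0 < e -> exists A, forall x, x <= A -> phi x < e.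
Proof.
move=> e0.
have /cvgrPdist_lt/(_ e e0) := @cvgy_atan R.
move=> [B [_ h]]; exists (- B - 1) => x xA.
have /h : B < - x by lra.
rewrite atanN opprK gtr0_norm; first by rewrite /phi addrC.
by rewrite addrC; exact: phi_gt0.
Qed.

Lemma om_int : mu.-integrable setT (EFin \o om).
Proof.
have mom : measurable_fun setT om by apply: continuous_measurable_fun; exact: om_cont.
apply/integrableP; split; first exact/measurable_EFinP.
under eq_integral do rewrite /= ger0_norm ?om_ge0//.
rewrite ge0_symfun_integralT; last 3 first.
- exact: om_ge0.
- exact: om_cont.
- by move=> x; rewrite /= om_opp.
by rewrite -set_itvcy integral0y_oneDsqr// -EFinM ltry.
Qed.

Lemma om_prim x : \int[mu]_(s in `]-oo, x]) om s = phi x.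
Proof.
have h1 : mu.-integrable `[- x, +oo[ (EFin \o om).
  by apply: integrableS om_int.
have [_ h2] := Rintegral_opp (measurable_itv `[- x, +oo[) h1.
have e1 : \int[mu]_(s in `[- x, +oo[) om s = phi x.
  rewrite /Rintegral (@ge0_continuous_FTC2y _ om atan (- x) (pi / 2)).
  - by rewrite /phi atanN EFinN oppeK -EFinD /= addrC.
  - by move=> y _; exact: om_ge0.
  - by apply: continuous_subspaceT => y; exact: om_cont.
  - exact: cvgy_atan.
  - by move=> y _; exact: derivable_atan.
  - by apply: cvg_at_right_filter; exact: continuous_atan.
  - by move=> y _; rewrite derive1_atan.
rewrite -e1 -h2.
rewrite (_ : -%R @^-1` _ = `]-oo, x]%classic); last first.
  apply/seteqP; split => y /=; rewrite !in_itv/= andbT; lra.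
by apply: eq_Rintegral => y _; rewrite om_opp.
Qed.

End Weights.

(** * Integrals of complex-valued functions *)

Section ComplexIntegrals.
Context {R : realType}.
Local Notation mu := (@lebesgue_measure R).
Local Notation C := R[i].
Local Notation mble D := (@measurable _ (measurableTypeR R) D).
Implicit Types (D : set R) (h k : R -> C).

Lemma eq_cintegral D h k : (forall x, D x -> h x = k x) ->
  cintegral D h = cintegral D k.
Proof.
move=> e; rewrite /cintegral; congr (_ +i* _);
  by apply: eq_Rintegral => x; rewrite inE => /e ->.
Qed.

Lemma eq_cintegrable D h k : mble D -> (forall x, D x -> h x = k x) ->
  cintegrable D h -> cintegrable D k.
Proof.
move=> mD e [h1 h2]; split.
- by refine (eq_integrable mD _ _ _ h1) => x; rewrite inE => /e /= ->.
- by refine (eq_integrable mD _ _ _ h2) => x; rewrite inE => /e /= ->.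
Qed.

Lemma cintegrableD D h k : mble D -> cintegrable D h -> cintegrable D k ->
  cintegrable D (fun x => h x + k x).
Proof.
move=> mD [h1 h2] [k1 k2]; split.
- by refine (eq_integrable mD _ _ _ (integrableD mD h1 k1)) => x _; rewrite /= ReD.
- by refine (eq_integrable mD _ _ _ (integrableD mD h2 k2)) => x _; rewrite /= ImD.
Qed.

Lemma cintegralD D h k : mble D -> cintegrable D h -> cintegrable D k ->
  cintegral D (fun x => h x + k x) = cintegral D h + cintegral D k.
Proof.
move=> mD [h1 h2] [k1 k2]; apply: complexP; rewrite ?ReD ?ImD /=.
- by rewrite -RintegralD//; apply: eq_Rintegral => x _; rewrite ReD.
- by rewrite -RintegralD//; apply: eq_Rintegral => x _; rewrite ImD.
Qed.

Lemma integrable_rZ D (f : R -> R) (c : R) : mble D ->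
  mu.-integrable D (EFin \o f) -> mu.-integrable D (EFin \o (fun x => c * f x)).
Proof.
move=> mD hf; refine (eq_integrable mD _ _ _ (integrableZl mD c hf)) => x _.
by rewrite /= EFinM.
Qed.

Lemma integrable_rB D (f g : R -> R) : mble D ->
  mu.-integrable D (EFin \o f) -> mu.-integrable D (EFin \o g) ->
  mu.-integrable D (EFin \o (fun x => f x - g x)).
Proof.
by move=> mD hf hg; refine (eq_integrable mD _ _ _ (integrableB mD hf hg)) => x _.
Qed.

Lemma integrable_rD D (f g : R -> R) : mble D ->
  mu.-integrable D (EFin \o f) -> mu.-integrable D (EFin \o g) ->
  mu.-integrable D (EFin \o (fun x => f x + g x)).
Proof.
by move=> mD hf hg; refine (eq_integrable mD _ _ _ (integrableD mD hf hg)) => x _.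
Qed.

Lemma cintegrableZ D (c : C) h : mble D -> cintegrable D h ->
  cintegrable D (fun x => c * h x).
Proof.
move=> mD [h1 h2]; split.
- refine (eq_integrable mD _ _ _ (integrable_rB mD (integrable_rZ (cRe c) mD h1)
    (integrable_rZ (cIm c) mD h2))) => x _.
  by rewrite /= ReM.
- refine (eq_integrable mD _ _ _ (integrable_rD mD (integrable_rZ (cRe c) mD h2)
    (integrable_rZ (cIm c) mD h1))) => x _.
  by rewrite /= ImM.
Qed.

Lemma cintegralZ D (c : C) h : mble D -> cintegrable D h ->
  cintegral D (fun x => c * h x) = c * cintegral D h.
Proof.
move=> mD [h1 h2]; apply: complexP.
- rewrite ReM /= -!RintegralZl// -RintegralB//; last 2 first.
  + exact: integrable_rZ.
  + exact: integrable_rZ.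
  by apply: eq_Rintegral => x _; rewrite ReM.
- rewrite ImM /= -!RintegralZl// -RintegralD//; last 2 first.
  + exact: integrable_rZ.
  + exact: integrable_rZ.
  by apply: eq_Rintegral => x _; rewrite ImM.
Qed.

Lemma cintegrableN D h : mble D -> cintegrable D h ->
  cintegrable D (fun x => - h x).
Proof.
move=> mD /(cintegrableZ (-1) mD); apply: eq_cintegrable => // x _.
by rewrite mulN1r.
Qed.

Lemma cintegralN D h : mble D -> cintegrable D h ->
  cintegral D (fun x => - h x) = - cintegral D h.
Proof.
move=> mD /(cintegralZ (-1) mD); rewrite mulN1r => <-.
by apply: eq_cintegral => x _; rewrite mulN1r.
Qed.

Lemma cintegrableB D h k : mble D -> cintegrable D h -> cintegrable D k ->
  cintegrable D (fun x => h x - k x).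
Proof. by move=> mD hh hk; apply: cintegrableD => //; exact: cintegrableN. Qed.

Lemma cintegralB D h k : mble D -> cintegrable D h -> cintegrable D k ->
  cintegral D (fun x => h x - k x) = cintegral D h - cintegral D k.
Proof.
move=> mD hh hk; rewrite cintegralD//; last exact: cintegrableN.
by rewrite cintegralN.
Qed.

Lemma cintegrable_dom D h (K : R) : mble D -> ccont h ->
  (forall x, D x -> cn (h x) <= K * om x) -> cintegrable D h.
Proof.
move=> mD [h1 h2] hh.
have io : mu.-integrable D (EFin \o (fun x => K * om x)).
  by apply: integrable_rZ => //; apply: integrableS (om_int) => //.
split; apply: le_integrable io => //.
- by apply/measurable_EFinP; apply: measurable_funTS; exact: continuous_measurable_fun.
- move=> x Dx; rewrite /= lee_fin; apply: le_trans (Re_le _) _.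
  by apply: le_trans (hh _ Dx) _; exact: ler_norm.
- by apply/measurable_EFinP; apply: measurable_funTS; exact: continuous_measurable_fun.
- move=> x Dx; rewrite /= lee_fin; apply: le_trans (Im_le _) _.
  by apply: le_trans (hh _ Dx) _; exact: ler_norm.
Qed.

(** Real and imaginary parts are bounded separately, whence the factor 2. *)
Lemma cintegral_norm D h (g : R -> R) : mble D -> cintegrable D h ->
  mu.-integrable D (EFin \o g) -> (forall x, D x -> cn (h x) <= g x) ->
  cn (cintegral D h) <= 2 * \int[mu]_(x in D) g x.
Proof.
move=> mD [h1 h2] hg hh.
have aux (f : R -> R) : mu.-integrable D (EFin \o f) ->
    (forall x, D x -> `|f x| <= g x) ->
    `|\int[mu]_(x in D) f x| <= \int[mu]_(x in D) g x.
  move=> hf fg; apply: le_trans (le_normr_Rintegral mD hf) _.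
  by apply: le_Rintegral => //; exact: integrable_norm.
apply: le_trans (cn_le _) _; rewrite mulr_natl mulr2n.
apply: lerD; apply: aux => // x Dx.
- exact: le_trans (Re_le _) (hh _ Dx).
- exact: le_trans (Im_le _) (hh _ Dx).
Qed.

Lemma cintegral_opp D h : mble D -> cintegrable D h ->
  cintegrable ((-%R : R -> R) @^-1` D) (fun x => h (- x)) /\
  cintegral ((-%R : R -> R) @^-1` D) (fun x => h (- x)) = cintegral D h.
Proof.
move=> mD [h1 h2].
have [a1 b1] := Rintegral_opp mD h1; have [a2 b2] := Rintegral_opp mD h2.
by split => //; rewrite /cintegral -b1 -b2.
Qed.

End ComplexIntegrals.

(** * Primitives vanishing at $-\infty$ *)

Section Primitives.
Context {R : realType}.
Local Notation mu := (@lebesgue_measure R).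
Local Notation C := R[i].
Local Notation mble D := (@measurable _ (measurableTypeR R) D).
Implicit Types (D : set R) (h k F : R -> C).

Definition prim h (x : R) : C := cintegral `]-oo, x] h.

(** The prefix l restricts a bound to left half-lines, uniformly on each of them;
   exponentials that grow at $+\infty$ satisfy only such bounds. [van] is
   convergence to 0 at $-\infty$. *)
Definition lbounded h := forall X, exists K : R, forall s, s <= X -> cn (h s) <= K.
Definition ltame h :=
  ccont h /\ forall X, exists K : R, forall s, s <= X -> cn (h s) <= K * om s.
Definition tame h := ccont h /\ exists K : R, forall s, cn (h s) <= K * om s.
Definition van F := forall e : R, 0 < e -> exists A, forall x, x <= A -> cn (F x) < e.

Lemma mray x : mble (`]-oo, x]%classic : set R).
Proof. exact: measurable_itv. Qed.

Lemma mrray x : mble (`[x, +oo[%classic : set R).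
Proof. exact: measurable_itv. Qed.

Lemma tame_ltame h : tame h -> ltame h.
Proof. by move=> [c [K hK]]; split => // X; exists K => s _. Qed.

Lemma ltame_int h x : ltame h -> cintegrable `]-oo, x] h.
Proof.
move=> [c /(_ x)[K hK]]; exact: (cintegrable_dom (K := K)).
Qed.

Lemma tame_int D h : mble D -> tame h -> cintegrable D h.
Proof. by move=> mD [c [K hK]]; apply: (cintegrable_dom (K := K)). Qed.

Lemma prim_le h (K x : R) : cintegrable `]-oo, x] h ->
  (forall s, s <= x -> cn (h s) <= K * om s) ->
  cn (prim h x) <= 2 * (K * phi x).
Proof.
move=> hi hK.
have io : mu.-integrable `]-oo, x] (EFin \o om).
  exact: (integrableS measurableT (mray x) (@subsetT _ _) om_int).
have := @cintegral_norm R _ h (fun s => K * om s) (mray x) hi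
  (integrable_rZ K (mray x) io).
rewrite (RintegralZl _ (mray x) io).
have h1 : forall s, `]-oo, x]%classic s -> cn (h s) <= K * om s.
  by move=> s; rewrite /= in_itv/=; exact: hK.
by rewrite om_prim => /(_ h1).
Qed.

Lemma prim_der h x : ltame h -> cder (prim h) x (h x).
Proof.
move=> hh; have xu : x < x + 1 by rewrite ltrDl.
have [i1 i2] := ltame_int (x + 1) hh; have [[c1 c2] _] := hh.
split.
- have [d1 e1] := continuous_FTC1 xu i1 (ltNyr x) (c1 x).
  by move/derivableP : d1; rewrite -derive1E => d1; refine (is_derive_eq d1 e1).
- have [d1 e1] := continuous_FTC1 xu i2 (ltNyr x) (c2 x).
  by move/derivableP : d1; rewrite -derive1E => d1; refine (is_derive_eq d1 e1).
Qed.

Lemma prim_van h : ltame h -> van (prim h).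
Proof.
move=> hh e e0; have [_ /(_ 0)[K hK]] := hh.
have K0 : 0 <= K.
  have := hK 0 (lexx _); rewrite -(pmulr_lge0 _ (om_gt0 0)).
  by apply: le_trans; exact: cn_ge0.
have e1 : 0 < e / (2 * (K + 1)) by rewrite divr_gt0// mulr_gt0// ltr_pwDr.
have [A hA] := phi_van e1; exists (Num.min A 0) => x.
rewrite le_min => /andP[xA x0].
have := hA _ xA; rewrite ltr_pdivlMr ?mulr_gt0 ?ltr_pwDr// => h1.
apply: le_lt_trans (prim_le (K := K) (ltame_int x hh) _) _.
  by move=> s sx; apply: hK; exact: le_trans sx x0.
apply: le_lt_trans h1.
rewrite mulrC -mulrA [X in X <= _]mulrCA ler_wpM2l ?phi_ge0//.
by rewrite mulrC ler_wpM2l// lerDl.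
Qed.

Lemma vanB F G : van F -> van G -> van (fun x => F x - G x).
Proof.
move=> hF hG e e0; have e2 : 0 < e / 2 by rewrite divr_gt0.
have [A hA] := hF _ e2; have [B hB] := hG _ e2.
exists (Num.min A B) => x; rewrite le_min => /andP[/hA h1 /hB h2].
by apply: le_lt_trans (cnB _ _) _; lra.
Qed.

Lemma vanD F G : van F -> van G -> van (fun x => F x + G x).
Proof.
move=> hF hG e e0; have e2 : 0 < e / 2 by rewrite divr_gt0.
have [A hA] := hF _ e2; have [B hB] := hG _ e2.
exists (Num.min A B) => x; rewrite le_min => /andP[/hA h1 /hB h2].
by apply: le_lt_trans (cnD _ _) _; lra.
Qed.

Lemma vanM g F : lbounded g -> van F -> van (fun x => g x * F x).
Proof.
move=> /(_ 0)[K hK] hF e e0.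
have K0 : 0 <= K by apply: le_trans (hK 0 (lexx _)); exact: cn_ge0.
have e1 : 0 < e / (K + 1) by rewrite divr_gt0// ltr_pwDr.
have [A hA] := hF _ e1; exists (Num.min A 0) => x.
rewrite le_min => /andP[/hA + x0]; rewrite ltr_pdivlMr ?ltr_pwDr// => h1.
rewrite cnM; apply: le_lt_trans h1; rewrite mulrC ler_wpM2l ?cn_ge0//.
by apply: le_trans (hK _ x0) _; rewrite lerDl.
Qed.

Lemma van_cst (c : C) : van (fun=> c) -> c = 0.
Proof.
move=> h; have [//|c0] := eqVneq c 0.
by have [A /(_ A (lexx _))] := h _ (cn_gt0 c0); rewrite ltxx.
Qed.

Lemma ltame_van h : ltame h -> van h.
Proof.
move=> hh e e0; have [_ /(_ 0)[K hK]] := hh.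
have K0 : 0 <= K.
  have := hK 0 (lexx _); rewrite -(pmulr_lge0 _ (om_gt0 0)).
  by apply: le_trans; exact: cn_ge0.
exists (Num.min 0 (- ((K + 1) / e) - 1)) => x; rewrite le_min => /andP[x0 xe].
apply: le_lt_trans (hK _ x0) _.
rewrite /om ltr_pdivrMr ?W_gt0//.
have h1 : K + 1 < e * - x.
  by rewrite mulrC -ltr_pdivrMr//; lra.
apply: (@lt_le_trans _ _ (e * - x)); first lra.
rewrite ler_pM2l// WE.
have := sqr_ge0 (x + 1); nra.
Qed.

(** The difference of the two primitives is constant and vanishes at $-\infty$. *)
Lemma prim_uniq F h : (forall x, cder F x (h x)) -> ltame h -> van F ->
  forall x, F x = prim h x.
Proof.
move=> hF hh vF x; apply/eqP; rewrite -subr_eq0; apply/eqP.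
have H y : cder (fun t => F t - prim h t) y 0.
  by rewrite -(subrr (h y)); apply: cderB => //; exact: prim_der.
apply: van_cst => e e0.
have [A hA] := vanB vF (prim_van hh) e0.
by exists A => y /hA; rewrite (cder0_cst H y x).
Qed.

Lemma ccontR (f : R -> R) : continuous f -> ccont (fun s => (f s)%:C).
Proof. by move=> cf; split => //= x; exact: cst_continuous. Qed.

Lemma expphi_le (s : R) (k : R) : 0 < k -> expR (k * phi s) <= expR (k * pi).
Proof. by move=> k0; rewrite ler_expR ler_pM2l// phi_lepi. Qed.

Lemma expphi_der (k x : R) :
  is_derive x (1 : R) (fun s => expR (k * phi s)) (k * (om x * expR (k * phi x))).
Proof.
have h1 := is_derive_rM (is_derive_cst k x 1) (phi_der x).
refine (is_derive_eq (@is_derive1_comp _ (@expR R) (fun s => k * phi s) x _ _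
  (is_derive_expR _) h1) _).
by rewrite mul0r add0r /cst mulrC mulrA.
Qed.

Lemma expphi_cont (k : R) : continuous (fun s : R => expR (k * phi s)).
Proof. by move=> x; exact: is_derive_cont (expphi_der k x). Qed.

Lemma expphi_ltame (k : R) : 0 < k ->
  tame (fun s : R => (om s * expR (k * phi s))%:C).
Proof.
move=> k0; split.
  apply: ccontR => x; apply: cvgM; [exact: om_cont|exact: expphi_cont].
exists (expR (k * pi)) => s; rewrite cnR ger0_norm ?mulr_ge0 ?om_ge0 ?expR_ge0//.
by rewrite mulrC ler_wpM2r ?om_ge0// expphi_le.
Qed.

(** The right-hand side minus the integral is constant, with a nonnegative limit
   at $-\infty$. *)
Lemma Rprim_le (g G : R -> R) (x : R) : (forall y, is_derive y (1 : R) G (g y)) ->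
  (forall y, 0 <= G y) -> tame (fun s => (g s)%:C) ->
  \int[mu]_(s in `]-oo, x]) g s <= G x.
Proof.
move=> dG G0 /tame_ltame ht; set h := fun s : R => (g s)%:C.
have dE y : cder (fun s => (G s)%:C) y (h y).
  by split; [exact: dG|exact: is_derive_cst].
have dP y : cder (fun t => (G t)%:C - prim h t) y 0.
  by rewrite -(subrr (h y)); apply: cderB => //; exact: prim_der.
rewrite leNgt; apply/negP => lt0.
pose d := \int[mu]_(s in `]-oo, x]) g s - G x.
have d0 : 0 < d by rewrite subr_gt0.
have [A /(_ A (lexx _))] := prim_van ht d0.
apply/negP; rewrite -leNgt; apply: le_trans (Re_le _).
have := cder0_cst dP A x; move/(congr1 (@complex.Re R)); rewrite !ReB /=.
move=> e1; apply: le_trans (ler_norm _).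
rewrite /d; have := G0 A; move: e1; rewrite /prim /=; lra.
Qed.

(** The gain $1/k$ under integration is what makes Volterra operators contractions
   in the norm weighted by $e^{k\phi}$. *)
Lemma Rprim_exp (k x : R) : 0 < k ->
  \int[mu]_(s in `]-oo, x]) (om s * expR (k * phi s)) <= k^-1 * expR (k * phi x).
Proof.
move=> k0; apply: (@Rprim_le _ (fun s => k^-1 * expR (k * phi s))).
- move=> y; refine (is_derive_eq (is_derive_rM (is_derive_cst k^-1 y 1)
    (expphi_der k y)) _).
  by rewrite mul0r add0r /cst mulrA mulVf ?mul1r// gt_eqF.
- by move=> y; rewrite mulr_ge0 ?expR_ge0// invr_ge0 ltW.
- exact: expphi_ltame.
Qed.

Lemma prim_exp_le h (K k x : R) : 0 < k -> 0 <= K -> cintegrable `]-oo, x] h ->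
  (forall s, s <= x -> cn (h s) <= K * (om s * expR (k * phi s))) ->
  cn (prim h x) <= 2 * (K * (k^-1 * expR (k * phi x))).
Proof.
move=> k0 K0 hi hK.
have [io _] := tame_int (mray x) (expphi_ltame k0).
have := @cintegral_norm R _ h (fun s => K * (om s * expR (k * phi s))) (mray x) hi
  (integrable_rZ K (mray x) io).
rewrite (RintegralZl _ (mray x) io).
have h1 : forall s, `]-oo, x]%classic s ->
    cn (h s) <= K * (om s * expR (k * phi s)).
  by move=> s; rewrite /= in_itv/=; exact: hK.
move=> /(_ h1) h2; apply: le_trans h2 _.
by rewrite ler_pM2l// ler_wpM2l// Rprim_exp.
Qed.

Lemma ltameM g h : ccont g -> lbounded g -> ltame h -> ltame (fun s => g s * h s).
Proof.
move=> cg bg [ch hh]; split; first exact: ccontM.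
move=> X; have [K hK] := bg X; have [L hL] := hh X.
exists (K * L) => s sX; rewrite cnM -mulrA.
by apply: ler_pM; rewrite ?cn_ge0 ?hK ?hL.
Qed.

Lemma tame_bound h K : (forall s, cn (h s) <= K * om s) -> forall s, cn (h s) <= K.
Proof.
move=> hK s; apply: le_trans (hK s) _.
have K0 : 0 <= K.
  have := hK 0; rewrite -(pmulr_lge0 _ (om_gt0 0)).
  by apply: le_trans; exact: cn_ge0.
by rewrite ler_piMr// om_le1.
Qed.

Lemma tameM g h (B : R) : ccont g -> (forall s, cn (g s) <= B) -> tame h ->
  tame (fun s => g s * h s).
Proof.
move=> cg bg [ch [L hL]]; split; first exact: ccontM.
exists (B * L) => s; rewrite cnM -mulrA.
by apply: ler_pM; rewrite ?cn_ge0.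
Qed.

Lemma tame_mul g h : tame g -> tame h -> tame (fun s => g s * h s).
Proof. by move=> [cg [K /tame_bound hK]]; exact: tameM. Qed.

Lemma tameD g h : tame g -> tame h -> tame (fun s => g s + h s).
Proof.
move=> [cg [K hK]] [ch [L hL]]; split; first exact: ccontD.
exists (K + L) => s; apply: le_trans (cnD _ _) _.
by rewrite mulrDl lerD.
Qed.

Lemma tameZ (c : C) h : tame h -> tame (fun s => c * h s).
Proof. by apply: (tameM (B := cn c)); [exact: ccont_cst|]. Qed.

Lemma tameN h : tame h -> tame (fun s => - h s).
Proof.
move=> /(tameZ (-1)); rewrite (_ : (fun s => -1 * h s) = fun s => - h s)//.
by apply/funext => s; rewrite mulN1r.
Qed.

Lemma tameB g h : tame g -> tame h -> tame (fun s => g s - h s).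
Proof. by move=> hg hh; apply: tameD => //; exact: tameN. Qed.

Lemma tame_opp h : tame h -> tame (fun s => h (- s)).
Proof.
move=> [c [K hK]]; split; first exact: ccont_opp.
by exists K => s; rewrite -om_opp.
Qed.

Lemma rray_opp x : (-%R : R -> R) @^-1` `[x, +oo[ = `]-oo, (- x)]%classic.
Proof. by apply/seteqP; split => y /=; rewrite !in_itv/= andbT; lra. Qed.

Lemma ray_opp x : (-%R : R -> R) @^-1` `]-oo, x] = `[(- x), +oo[%classic.
Proof. by apply/seteqP; split => y /=; rewrite !in_itv/= andbT; lra. Qed.

Lemma cintegral_rray h x : cintegrable `[x, +oo[ h ->
  cintegrable `]-oo, (- x)] (fun s => h (- s)) /\
  cintegral `[x, +oo[ h = prim (fun s => h (- s)) (- x).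
Proof.
move=> hi; have [h1 h2] := cintegral_opp (mrray x) hi.
by rewrite /prim -rray_opp; split.
Qed.

Lemma cintegrable_rray h x : cintegrable `]-oo, (- x)] (fun s => h (- s)) ->
  cintegrable `[x, +oo[ h.
Proof.
move=> hi; have [h1 _] := cintegral_opp (mray (- x)) hi.
move: h1; rewrite ray_opp opprK; apply: eq_cintegrable; first exact: mrray.
by move=> s _; rewrite opprK.
Qed.

Lemma cintegral_split h x : tame h ->
  cintegral setT h = prim h x + cintegral `[x, +oo[ h.
Proof.
move=> ht; have [i1 i2] := tame_int measurableT ht.
have aux (f : R -> R) : mu.-integrable setT (EFin \o f) ->
    \int[mu]_(s in setT) f s =
    \int[mu]_(s in `]-oo, x]) f s + \int[mu]_(s in `[x, +oo[) f s.
  move=> hf; have hf' : mu.-integrable [set` `]-oo, +oo[] (EFin \o f).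
    by rewrite set_itvE.
  have := @Rintegral_itvB R f -oo%O +oo%O x hf' isT isT.
  rewrite Rintegral_itv_obnd_cbnd; last by apply: integrableS hf.
  by rewrite (set_itvE _).1 => <-; rewrite addrC subrK.
by apply: complexP; rewrite ?ReD ?ImD /=; exact: aux.
Qed.

Lemma cintegralT h : tame h ->
  cintegral setT h = prim h 0 + prim (fun s => h (- s)) 0.
Proof.
move=> ht; rewrite (cintegral_split 0)//.
have hi := tame_int (mrray 0) ht.
by have [_ ->] := cintegral_rray hi; rewrite oppr0.
Qed.

Lemma cintegralT_opp h : tame h ->
  cintegral setT (fun s => h (- s)) = cintegral setT h.
Proof.
move=> ht; rewrite !cintegralT//; last exact: tame_opp.
by rewrite addrC; congr (prim _ _ + _); apply/funext => s; rewrite opprK.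
Qed.

Lemma cintegralT_prim h x : tame h ->
  cintegral setT h = prim h x + prim (fun s => h (- s)) (- x).
Proof.
move=> ht; rewrite (cintegral_split x)//.
have hi := tame_int (mrray x) ht.
by have [_ ->] := cintegral_rray hi.
Qed.

(** Translation invariance comes from uniqueness of primitives on the two
   half-lines. *)
Lemma cintegralT_shift h w : tame h -> tame (fun s => h (s + w)) ->
  cintegral setT (fun s => h (s + w)) = cintegral setT h.
Proof.
move=> ht hwt.
have e1 x : prim h (x + w) = prim (fun s => h (s + w)) x.
  apply: (prim_uniq (F := fun x => prim h (x + w))).
  - by move=> y; apply: cder_shift; apply: prim_der; exact: tame_ltame.
  - exact: tame_ltame.
  - move=> e e0; have [A hA] := prim_van (tame_ltame ht) e0.
    by exists (A - w) => y yA; apply: hA; lra.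
have e2 x : prim (fun s => h (- s)) (x - w) = prim (fun s => h (- s + w)) x.
  apply: (prim_uniq (F := fun x => prim (fun s => h (- s)) (x - w))).
  - move=> y; apply: cder_shift.
    have -> : h (- y + w) = h (- (y - w)) by congr h; ring.
    by apply: prim_der; apply: tame_ltame; exact: tame_opp.
  - by apply: tame_ltame; exact: (tame_opp hwt).
  - move=> e e0; have [A hA] := prim_van (tame_ltame (tame_opp ht)) e0.
    by exists (A + w) => y yA; apply: hA; lra.
rewrite (cintegralT_prim 0 hwt) (cintegralT_prim w ht) -e1 -e2 add0r.
by rewrite oppr0 sub0r.
Qed.

Lemma prim_tail_le h (K : R) : tame h -> (forall s, cn (h s) <= K * om s) ->
  cn (cintegral setT h) <= 4 * (K * pi).
Proof.
move=> ht hK; rewrite cintegralT//; apply: le_trans (cnD _ _) _.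
have K0 : 0 <= K.
  have := hK 0; rewrite -(pmulr_lge0 _ (om_gt0 0)).
  by apply: le_trans; exact: cn_ge0.
have aux k : tame k -> (forall s, cn (k s) <= K * om s) ->
    cn (prim k 0) <= 2 * (K * pi).
  move=> kt kK; apply: le_trans (prim_le (K := K) _ _) _ => //.
    by apply: ltame_int; exact: tame_ltame.
  by rewrite ler_pM2l// ler_wpM2l// phi_lepi.
have h1 := aux _ ht hK.
have h2 : cn (prim (fun s => h (- s)) 0) <= 2 * (K * pi).
  by apply: aux; [exact: tame_opp|move=> s; rewrite -om_opp].
lra.
Qed.

End Primitives.

Arguments prim : simpl never.

(** * Taylor bounds for sine, cosine and exponential *)

Section RealBounds.
Context {R : realType}.
Implicit Types y : R.

Lemma der_ge0 (f df : R -> R) : (forall x, is_derive x (1 : R) f (df x)) ->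
  (forall x, 0 <= x -> 0 <= df x) -> 0 <= f 0 -> forall y, 0 <= y -> 0 <= f y.
Proof.
move=> hf hd f0 y; rewrite le_eqVlt => /predU1P[<- //|y0].
have [] := @MVT R f df 0 y y0 (fun x _ => hf x).
  by apply: continuous_subspaceT => x; exact: is_derive_cont (hf x).
move=> c; rewrite in_itv/= => /andP[c0 _] /eqP; rewrite subr0 subr_eq => /eqP ->.
by rewrite addr_ge0// mulr_ge0// ?hd// ltW.
Qed.

Let idd x : is_derive x (1 : R) (fun t : R => t) 1.
Proof. exact: is_derive_id. Qed.

Let sqd x : is_derive x (1 : R) (fun t : R => t * t) (2 * x).
Proof. by refine (is_derive_eq (is_derive_rM (idd x) (idd x)) _); ring. Qed.

Let cstd (c x : R) : is_derive x (1 : R) (fun=> c) (0 : R).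
Proof. exact: is_derive_cst. Qed.

Lemma sin_le y : 0 <= y -> sin y <= y.
Proof.
move=> y0; rewrite -subr_ge0.
have hd x : is_derive x (1 : R) (fun t => t - sin t) ((fun t => 1 - cos t) x).
  exact: (is_derive_rB (idd x) (is_derive_sin x)).
refine (@der_ge0 (fun t => t - sin t)
  (fun t => 1 - cos t) hd _ _ y y0).
- by move=> x _; rewrite subr_ge0 cos_le1.
- by rewrite sin0 subrr.
Qed.

Lemma sin_geN y : 0 <= y -> - y <= sin y.
Proof.
move=> y0; rewrite -subr_ge0 opprK.
have hd x : is_derive x (1 : R) (fun t => sin t + t) ((fun t => cos t + 1) x).
  exact: (is_derive_rD (is_derive_sin x) (idd x)).
refine (@der_ge0 (fun t => sin t + t)
  (fun t => cos t + 1) hd _ _ y y0).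
- by move=> x _; rewrite -lerBlDr sub0r cos_geN1.
- by rewrite sin0 addr0.
Qed.

Lemma cos_ge_lin y : 0 <= y -> 1 - cos y <= y.
Proof.
move=> y0; rewrite -subr_ge0.
rewrite (_ : y - (1 - cos y) = y + cos y - 1); last by ring.
have hd x : is_derive x (1 : R) (fun t => t + cos t - 1) ((fun t => 1 + - sin t - 0) x).
  exact: (is_derive_rB (is_derive_rD (idd x) (is_derive_cos x)) (cstd 1 x)).
refine (@der_ge0 (fun t => t + cos t - 1)
  (fun t => 1 + - sin t - 0) hd _ _ y y0).
- by move=> x _; rewrite subr0 subr_ge0 sin_le1.
- by rewrite cos0 add0r subrr.
Qed.

Lemma cos_ge_sqr y : 0 <= y -> 1 - cos y <= y * y.
Proof.
move=> y0; rewrite -subr_ge0.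
rewrite (_ : y * y - (1 - cos y) = y * y + cos y - 1); last by ring.
have hd x : is_derive x (1 : R) (fun t => t * t + cos t - 1) ((fun t => 2 * t + - sin t - 0) x).
  exact: (is_derive_rB (is_derive_rD (sqd x) (is_derive_cos x)) (cstd 1 x)).
refine (@der_ge0 (fun t => t * t + cos t - 1)
  (fun t => 2 * t + - sin t - 0) hd _ _ y y0).
- by move=> x x0; have := sin_le x0; lra.
- by rewrite cos0 mul0r add0r subrr.
Qed.

Lemma sin_ge_sqr y : 0 <= y -> y - sin y <= y * y.
Proof.
move=> y0; rewrite -subr_ge0.
rewrite (_ : y * y - (y - sin y) = y * y + sin y - y); last by ring.
have hd x : is_derive x (1 : R) (fun t => t * t + sin t - t) ((fun t => 2 * t + cos t - 1) x).
  exact: (is_derive_rB (is_derive_rD (sqd x) (is_derive_sin x)) (idd x)).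
refine (@der_ge0 (fun t => t * t + sin t - t)
  (fun t => 2 * t + cos t - 1) hd _ _ y y0).
- by move=> x x0; have := cos_ge_lin x0; lra.
- by rewrite sin0 mul0r add0r subrr.
Qed.

Lemma expN_ge y : 1 - y <= expR (- y).
Proof. exact: expR_ge1Dx. Qed.

Lemma expN_le_sqr y : 0 <= y -> expR (- y) - 1 + y <= y * y.
Proof.
move=> y0; rewrite -subr_ge0.
rewrite (_ : y * y - (expR (- y) - 1 + y) = y * y - y - expR (- 1 * y + 0) + 1);
  last by rewrite mulN1r addr0; ring.
have hd x : is_derive x (1 : R) (fun t => t * t - t - expR (-1 * t + 0) + 1) ((fun t => 2 * t - 1 - -1 * expR (-1 * t + 0) + 0) x).
  exact: (is_derive_rD (is_derive_rB (is_derive_rB (sqd x) (idd x)) (is_derive_comp_aff (is_derive_expR _))) (cstd 1 x)).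
refine (@der_ge0 (fun t => t * t - t - expR (-1 * t + 0) + 1)
  (fun t => 2 * t - 1 - -1 * expR (-1 * t + 0) + 0) hd _ _ y y0).
- move=> x x0 /=; have := expN_ge x.
  by rewrite (_ : -1 * x + 0 = - x); [lra|ring].
- by rewrite !mulr0 addr0 expR0 subrr sub0r addNr.
Qed.

End RealBounds.

(** * Cauchy-Riemann equations in finite differences *)

Section DiscreteHolomorphy.
Context {R : realType}.
Local Notation C := R[i].
Implicit Types (a b c z : C) (B w x : R).

(** The three numbers stand for the values of a function $g$ at $z$, $z + w$ and
   $z + iw$. The last inequality is the Cauchy-Riemann equation with an error of
   second order. It replaces complex differentiability: it is stable under sums,
   products, inverses and integration, and it suffices to shift a line of
   integration. *)
Definition hol3 B w a b c :=
  [/\ cn a <= B, cn b <= B, cn c <= B &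
   [/\ cn (b - a) <= B * w, cn (c - a) <= B * w &
       cn (c - a - 'i * (b - a)) <= B * w ^+ 2]].

Lemma hol3_ge0 B w a b c : hol3 B w a b c -> 0 <= B.
Proof. by case=> h _ _ _; apply: le_trans h; exact: cn_ge0. Qed.

Lemma hol3_mono B B' w a b c : 0 <= w -> B <= B' ->
  hol3 B w a b c -> hol3 B' w a b c.
Proof.
move=> w0 BB [h1 h2 h3 [h4 h5 h6]]; split; [| | |split].
- exact: le_trans BB.
- exact: le_trans BB.
- exact: le_trans BB.
- by apply: le_trans h4 _; rewrite ler_wpM2r.
- by apply: le_trans h5 _; rewrite ler_wpM2r.
- by apply: le_trans h6 _; rewrite ler_wpM2r// exprn_ge0.
Qed.

Lemma hol3_cst w (d : C) : 0 <= w -> hol3 (cn d) w d d d.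
Proof.
by move=> w0; split => //; split; rewrite ?subrr ?mulr0 ?subrr ?cn0 ?mulr_ge0
  ?cn_ge0// exprn_ge0.
Qed.

Lemma hol3D B1 B2 w a1 b1 c1 a2 b2 c2 : hol3 B1 w a1 b1 c1 ->
  hol3 B2 w a2 b2 c2 -> hol3 (B1 + B2) w (a1 + a2) (b1 + b2) (c1 + c2).
Proof.
move=> [h1 h2 h3 [h4 h5 h6]] [k1 k2 k3 [k4 k5 k6]].
have aux (u v : C) (p q r : R) : cn u <= p * r -> cn v <= q * r ->
    cn (u + v) <= (p + q) * r.
  by move=> hu hv; rewrite mulrDl; apply: le_trans (cnD _ _) (lerD hu hv).
split; [| | |split].
- exact: le_trans (cnD _ _) (lerD h1 k1).
- exact: le_trans (cnD _ _) (lerD h2 k2).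
- exact: le_trans (cnD _ _) (lerD h3 k3).
- by have := aux _ _ _ _ _ h4 k4; congr (cn _ <= _); ring.
- by have := aux _ _ _ _ _ h5 k5; congr (cn _ <= _); ring.
- by have := aux _ _ _ _ _ h6 k6; congr (cn _ <= _); ring.
Qed.

Lemma hol3M B1 B2 w a1 b1 c1 a2 b2 c2 : 0 <= w -> hol3 B1 w a1 b1 c1 ->
  hol3 B2 w a2 b2 c2 -> hol3 (4 * (B1 * B2)) w (a1 * a2) (b1 * b2) (c1 * c2).
Proof.
move=> w0 H1 H2; have B10 := hol3_ge0 H1; have B20 := hol3_ge0 H2.
move: H1 H2 => [h1 h2 h3 [h4 h5 h6]] [k1 k2 k3 [k4 k5 k6]].
have P0 : 0 <= B1 * B2 by rewrite mulr_ge0.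
have aux (u v : C) (p q : R) : cn u <= p -> cn v <= q -> cn (u * v) <= p * q.
  by move=> hu hv; rewrite cnM ler_pM ?cn_ge0.
have t3 (u v t : C) (p : R) : cn u <= p -> cn v <= p -> cn t <= p ->
    cn (u + v + t) <= 4 * p.
  move=> hu hv ht; apply: le_trans (cnD _ _) _.
  have := cnD u v; have := cn_ge0 u; lra.
have le4 (u : C) : cn u <= B1 * B2 -> cn u <= 4 * (B1 * B2) by lra.
split; [| | |split].
- exact/le4/aux.
- exact/le4/aux.
- exact/le4/aux.
- rewrite (_ : b1 * b2 - a1 * a2 = b1 * (b2 - a2) + (b1 - a1) * a2 + 0); last by ring.
  rewrite -mulrA; apply: t3.
  + by apply: le_trans (aux _ _ _ _ h2 k4) _; rewrite mulrA.
  + by apply: le_trans (aux _ _ _ _ h4 k1) _; rewrite mulrAC.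
  + by rewrite cn0 mulr_ge0.
- rewrite (_ : c1 * c2 - a1 * a2 = c1 * (c2 - a2) + (c1 - a1) * a2 + 0); last by ring.
  rewrite -mulrA; apply: t3.
  + by apply: le_trans (aux _ _ _ _ h3 k5) _; rewrite mulrA.
  + by apply: le_trans (aux _ _ _ _ h5 k1) _; rewrite mulrAC.
  + by rewrite cn0 mulr_ge0.
(* The Cauchy-Riemann defect is a derivation up to products of differences. *)
- rewrite (_ : _ - _ - _ = a1 * (c2 - a2 - 'i * (b2 - a2))
     + (c1 - a1 - 'i * (b1 - a1)) * a2
     + ((c1 - a1) * (c2 - a2) + (- 'i) * ((b1 - a1) * (b2 - a2)))); last by ring.
  have q1 := aux _ _ _ _ h1 k6; have q2 := aux _ _ _ _ h6 k1.
  have q3 := aux _ _ _ _ h5 k5; have q4 := aux _ _ _ _ h4 k4.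
  have q5 : cn (- 'i * ((b1 - a1) * (b2 - a2))) <= B1 * w * (B2 * w).
    by rewrite cnM cnN cni mul1r.
  apply: le_trans (cnD _ _) _; apply: le_trans (lerD (cnD _ _) (cnD _ _)) _.
  rewrite (_ : 4 * (B1 * B2) * w ^+ 2 = (B1 * (B2 * w ^+ 2) + B1 * w ^+ 2 * B2) +
    (B1 * w * (B2 * w) + B1 * w * (B2 * w))); last by ring.
  by apply: lerD; apply: lerD.
Qed.

Lemma hol3Z B w d a b c : 0 <= w -> hol3 B w a b c ->
  hol3 (4 * (cn d * B)) w (d * a) (d * b) (d * c).
Proof. by move=> w0; apply: hol3M => //; exact: hol3_cst. Qed.

(** The second-order term of an inverse is that of the function divided by its
   square, plus products of two first-order differences. *)
Lemma hol3V B (d : R) w a b c : 0 <= w -> 0 < d -> d <= cn a -> d <= cn b ->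
  d <= cn c -> hol3 B w a b c ->
  hol3 (d^-1 + B * d^-1 ^+ 2 + 2 * (B ^+ 2 * d^-1 ^+ 3)) w a^-1 b^-1 c^-1.
Proof.
move=> w0 d0 da db dc H; have B0 := hol3_ge0 H.
move: H => [h1 h2 h3 [h4 h5 h6]].
set e := d^-1; have e0 : 0 <= e by rewrite invr_ge0 ltW.
have nz (u : C) : d <= cn u -> u != 0.
  by apply: contraTneq => ->; rewrite cn0 -ltNge.
have inv (u : C) : d <= cn u -> cn u^-1 <= e.
  by move=> du; rewrite cnV lef_pV2// posrE// (lt_le_trans d0 du).
have a0 := nz _ da; have b0 := nz _ db; have c0 := nz _ dc.
have ia := inv _ da; have ib := inv _ db; have ic := inv _ dc.
have aux (u v : C) (p q : R) : cn u <= p -> cn v <= q -> cn (u * v) <= p * q.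
  by move=> hu hv; rewrite cnM ler_pM ?cn_ge0.
have Be : 0 <= B * e ^+ 2 by rewrite mulr_ge0 ?exprn_ge0.
have Be3 : 0 <= B ^+ 2 * e ^+ 3 by rewrite mulr_ge0 ?exprn_ge0.
have W1 (u : C) : cn u <= e -> cn u <= e + B * e ^+ 2 + 2 * (B ^+ 2 * e ^+ 3).
  by lra.
have W2 (u : C) : cn u <= B * w * (e * e) ->
    cn u <= (e + B * e ^+ 2 + 2 * (B ^+ 2 * e ^+ 3)) * w.
  move=> h; apply: le_trans h _.
  rewrite (_ : B * w * (e * e) = B * e ^+ 2 * w); last by ring.
  by rewrite ler_wpM2r//; lra.
split; [exact: W1|exact: W1|exact: W1|split].
- apply: W2; rewrite (_ : b^-1 - a^-1 = - (b - a) * (a^-1 * b^-1)).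
    by apply: (aux _ _ _ _); [rewrite cnN|apply: (aux _ _ _ _)].
  by field; rewrite ?a0 ?b0 ?c0.
- apply: W2; rewrite (_ : c^-1 - a^-1 = - (c - a) * (a^-1 * c^-1)).
    by apply: (aux _ _ _ _); [rewrite cnN|apply: (aux _ _ _ _)].
  by field; rewrite ?a0 ?b0 ?c0.
- rewrite (_ : _ - _ - _ = - (c - a - 'i * (b - a)) * (a^-1 * a^-1) +
    ((c - a) * (c - a) * (a^-1 * a^-1 * c^-1) +
     - 'i * ((b - a) * (b - a) * (a^-1 * a^-1 * b^-1)))); last first.
    by field; rewrite ?a0 ?b0 ?c0.
  have q1 : cn (- (c - a - 'i * (b - a)) * (a^-1 * a^-1)) <= B * w ^+ 2 * (e * e).
    by apply: (aux _ _ _ _); [rewrite cnN|apply: (aux _ _ _ _)].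
  have q2 : cn ((c - a) * (c - a) * (a^-1 * a^-1 * c^-1)) <=
      B * w * (B * w) * (e * e * e).
    by apply: (aux _ _ _ _); apply: (aux _ _ _ _) => //; apply: (aux _ _ _ _).
  have q3 : cn (- 'i * ((b - a) * (b - a) * (a^-1 * a^-1 * b^-1))) <=
      B * w * (B * w) * (e * e * e).
    rewrite cnM cnN cni mul1r.
    by apply: (aux _ _ _ _); apply: (aux _ _ _ _) => //; apply: (aux _ _ _ _).
  apply: le_trans (cnD _ _) _; apply: le_trans (lerD q1 (le_trans (cnD _ _) (lerD q2 q3))) _.
  have : 0 <= e * w ^+ 2 by rewrite mulr_ge0// exprn_ge0.
  move=> X0; rewrite (_ : (e + B * e ^+ 2 + 2 * (B ^+ 2 * e ^+ 3)) * w ^+ 2 =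
    e * w ^+ 2 + B * e ^+ 2 * w ^+ 2 + 2 * (B ^+ 2 * e ^+ 3 * w ^+ 2)); last by ring.
  rewrite (_ : B * w ^+ 2 * (e * e) = B * e ^+ 2 * w ^+ 2); last by ring.
  rewrite (_ : B * w * (B * w) * (e * e * e) = B ^+ 2 * e ^+ 3 * w ^+ 2); last by ring.
  lra.
Qed.

Lemma hol3_prim K w x (h0 h1 h2 : R -> C) : 0 <= w -> 
  cintegrable `]-oo, x] h0 -> cintegrable `]-oo, x] h1 ->
  cintegrable `]-oo, x] h2 ->
  (forall s, s <= x -> hol3 (K * om s) w (h0 s) (h1 s) (h2 s)) ->
  hol3 (2 * (K * pi)) w (prim h0 x) (prim h1 x) (prim h2 x).
Proof.
move=> w0 i0 i1 i2 H.
have K0 : 0 <= K.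
  by rewrite -(pmulr_lge0 _ (om_gt0 x)); apply: hol3_ge0 (H x (lexx _)).
have mR := mray x.
have aux (k : R -> C) r : 0 <= r -> cintegrable `]-oo, x] k ->
    (forall s, s <= x -> cn (k s) <= K * om s * r) ->
    cn (prim k x) <= 2 * (K * pi) * r.
  move=> r0 ki hk; apply: le_trans (prim_le (K := K * r) ki _) _.
    by move=> s sx; apply: le_trans (hk _ sx) _; rewrite mulrAC.
  rewrite (_ : 2 * (K * pi) * r = 2 * (K * r * pi)); last by ring.
  by rewrite ler_pM2l// ler_wpM2l// ?phi_lepi// mulr_ge0.
have aux1 (k : R -> C) : cintegrable `]-oo, x] k ->
    (forall s, s <= x -> cn (k s) <= K * om s) -> cn (prim k x) <= 2 * (K * pi).
  move=> ki hk; rewrite -[X in _ <= X]mulr1; apply: (aux) => // s sx.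
  by rewrite mulr1 hk.
split; [| | |split].
- by apply: aux1 => // s /H[].
- by apply: aux1 => // s /H[].
- by apply: aux1 => // s /H[].
- rewrite /prim -cintegralB//; apply: (aux) => //; first exact: cintegrableB.
  by move=> s /H[_ _ _ []].
- rewrite /prim -cintegralB//; apply: (aux) => //; first exact: cintegrableB.
  by move=> s /H[_ _ _ []].
- have i10 : cintegrable `]-oo, x] (fun s => h1 s - h0 s) by exact: cintegrableB.
  have i20 : cintegrable `]-oo, x] (fun s => h2 s - h0 s) by exact: cintegrableB.
  have iZ : cintegrable `]-oo, x] (fun s => 'i * (h1 s - h0 s)).
    exact: cintegrableZ.
  rewrite /prim -!cintegralB// -cintegralZ// -cintegralB//.
  apply: (aux); [exact: exprn_ge0|exact: cintegrableB|].
  by move=> s /H[_ _ _ []].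
Qed.

(** With $y = tw$, the triple is $a(1, e^{iy}, e^{-y})$, the form taken by
   $e^{itz}$; all estimates are Taylor bounds for $\cos y$, $\sin y$ and
   $e^{-y}$. *)
Lemma hol3_exp (a : C) (t w : R) : 0 <= t -> 0 <= w -> cn a <= 1 ->
  hol3 (3 * (1 + t) ^+ 2) w a (a * cexp ('i * (t * w)%:C)) (a * cexp (- (t * w)%:C)).
Proof.
move=> t0 w0 a1; set y := t * w; have y0 : 0 <= y by rewrite mulr_ge0.
have B1 : 1 <= 3 * (1 + t) ^+ 2.
  have : 0 <= t ^+ 2 by rewrite exprn_ge0.
  by rewrite sqrrD expr1n mul1r mulr2n; lra.
have e1 : cn (cexp ('i * y%:C) : C) <= 1.
  by apply: cn_cexp_le1; rewrite !ReImE mul0r mulr0 subrr.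
have e2 : cn (cexp (- y%:C) : C) <= 1.
  by apply: cn_cexp_le1; rewrite ReN /= oppr_le0.
have p1 (u v : C) : cn u <= 1 -> cn v <= 1 -> cn (u * v) <= 3 * (1 + t) ^+ 2.
  move=> hu hv; apply: le_trans B1.
  by rewrite cnM -[X in _ <= X]mulr1 ler_pM ?cn_ge0.
have p2 (u : C) (r : R) : cn u <= r -> cn (a * u) <= r.
  by move=> hu; rewrite cnM -[X in _ <= X]mul1r ler_pM ?cn_ge0.
have R1 : cRe (cexp ('i * y%:C) : C) = cos y.
  by rewrite Re_cexp !ReImE mul0r mulr0 subrr expR0 mul1r; congr cos; ring.
have I1 : cIm (cexp ('i * y%:C) : C) = sin y.
  by rewrite Im_cexp !ReImE mul0r mulr0 subrr expR0 mul1r; congr sin; ring.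
have R2 : cRe (cexp (- y%:C) : C) = expR (- y).
  by rewrite Re_cexp ReN ImN /= oppr0 cos0 mulr1.
have I2 : cIm (cexp (- y%:C) : C) = 0.
  by rewrite Im_cexp ReN ImN /= oppr0 sin0 mulr0.
have c1 := cos_ge_lin y0; have c2 := cos_ge_sqr y0; have c3 : cos y <= 1 by exact: cos_le1.
have s1 := sin_le y0; have s2 := sin_geN y0; have s3 := sin_ge_sqr y0.
have x1 := expN_ge y; have x2 := expN_le_sqr y0.
have x3 : expR (- y) <= 1 by rewrite -(@expR0 R) ler_expR oppr_le0.
have W2 (u : C) : cn u <= 2 * y -> cn u <= 3 * (1 + t) ^+ 2 * w.
  move=> h; apply: le_trans h _; rewrite /y mulrA ler_wpM2r//.
  have : 0 <= t ^+ 2 by rewrite exprn_ge0.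
  by rewrite sqrrD expr1n mul1r mulr2n; lra.
split; [|exact: p1|exact: p1|split].
- exact: le_trans B1.
- apply: W2; rewrite -[X in _ - X]mulr1 -mulrBr; apply: p2.
  apply: le_trans (cn_le _) _; rewrite ReB ImB R1 I1 /= subr0.
  rewrite mulr_natl mulr2n; apply: lerD.
    by rewrite ler_norml; apply/andP; split; lra.
  by rewrite ler_norml; apply/andP; split; lra.
- apply: W2; rewrite -[X in _ - X]mulr1 -mulrBr; apply: p2.
  apply: le_trans (cn_le _) _; rewrite ReB ImB R2 I2 /= subr0 normr0 addr0.
  by rewrite ler_norml; apply/andP; split; lra.
- rewrite (_ : _ - _ - _ = a * (cexp (- y%:C) - 1 - 'i * (cexp ('i * y%:C) - 1)));
    last by ring.
  apply: p2; apply: le_trans (_ : 3 * (y * y) <= _); last first.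
    rewrite /y (_ : t * w * (t * w) = t ^+ 2 * w ^+ 2); last by ring.
    rewrite -[X in _ <= X]mulrA ler_pM2l//; apply: ler_wpM2r.
      exact: exprn_ge0.
    by rewrite ler_pXn2r ?nnegrE//; lra.
  have er : cRe (cexp (- y%:C) - 1 - 'i * (cexp ('i * y%:C) - 1) : C) =
      (expR (- y) - 1 + y) + (sin y - y).
    by rewrite 2!ReB (ReM 'i) ReB ImB R1 I1 R2 !ReImE; ring.
  have ei : cIm (cexp (- y%:C) - 1 - 'i * (cexp ('i * y%:C) - 1) : C) = 1 - cos y.
    by rewrite 2!ImB (ImM 'i) ReB ImB R1 I1 I2 !ReImE; ring.
  apply: le_trans (cn_le _) _; rewrite er ei.
  rewrite (_ : 3 * (y * y) = 2 * (y * y) + y * y); last by ring.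
  apply: lerD; rewrite ler_norml; apply/andP; split; lra.
Qed.

End DiscreteHolomorphy.

(** * Volterra systems and geometric convergence *)

Section Volterra.
Context {R : realType}.
Local Notation C := R[i].
Implicit Types (q p u v : R -> C) (z : C) (M N A x w : R).

Lemma geo_small (d e : R) : 0 < e -> exists n, d / 2 ^+ n <= e.
Proof.
move=> e0; pose n := Num.trunc (d / e).
have [d0|d0] := leP d 0.
  by exists 0%N; rewrite expr0 divr1 (le_trans d0)// ltW.
exists n.+1; rewrite ler_pdivrMr ?exprn_gt0// -ler_pdivrMl// mulrC.
apply: le_trans (ltW (truncnS_gt _)) _.
by rewrite -natrX ler_nat ltnW// ltn_expl.
Qed.

Lemma le_geo (y c d : R) : (forall n, y <= c + d / 2 ^+ n) -> y <= c.
Proof.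
move=> h; apply/ler_addgt0Pr => e e0.
by have [n hn] := geo_small d e0; apply: le_trans (h n) _; rewrite lerD2l.
Qed.

(** Three powers of the weight leave an integrable bound after multiplication by
   two factors $1 + x^2$, one from a Jost solution and one from its kernel. *)
Definition pot M q := ccont q /\ forall s, cn (q s) <= M * om s ^+ 3.

Lemma om3_le (s : R) : om s ^+ 3 <= om s.
Proof.
by rewrite -[X in _ <= X]expr1 ler_wiXn2l// ?om_ge0 ?om_le1.
Qed.

Lemma pot_ge0 M q : pot M q -> 0 <= M.
Proof.
move=> [_ h]; have o3 : 0 < om (0 : R) ^+ 3 by rewrite exprn_gt0// om_gt0.
by rewrite -(pmulr_lge0 _ o3); apply: le_trans (h 0); exact: cn_ge0.
Qed.

Lemma pot_tame M q : pot M q -> tame q.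
Proof.
move=> hq; have M0 := pot_ge0 hq; case: hq => c h; split => //.
by exists M => s; apply: le_trans (h s) _; rewrite ler_wpM2l// om3_le.
Qed.

Lemma expphi_ge1 (k x : R) : 0 < k -> 1 <= expR (k * phi x).
Proof.
by move=> k0; rewrite -(@expR0 R) ler_expR mulr_ge0 ?phi_ge0// ltW.
Qed.

(** Iterating the two equations from the a priori bound with constant $A$
   improves the constant to $2N + A/2^n$ in the norm weighted by
   $(1 + x^2) e^{k\phi}$. The kernel $E$ has modulus at most 1, so the bound is
   uniform in the spectral parameter. The a priori bound enters only
   qualitatively. *)
Lemma gronwall q p (E : R -> R -> C) M N A u v F G : 0 < M ->
  (forall s, cn (q s) <= M * om s ^+ 3) ->
  (forall s, cn (p s) <= M * om s ^+ 3) ->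
  (forall x s, s <= x -> cn (E x s) <= 1) ->
  (forall x, cintegrable `]-oo, x] (fun s => q s * v s)) ->
  (forall x, cintegrable `]-oo, x] (fun s => E x s * (p s * u s))) ->
  (forall x, u x = F x + prim (fun s => q s * v s) x) ->
  (forall x, v x = G x + prim (fun s => E x s * (p s * u s)) x) ->
  0 <= N ->
  (forall x, cn (F x) <= N * oneDsqr x) ->
  (forall x, cn (G x) <= N * oneDsqr x) ->
  (forall x, cn (u x) <= A * oneDsqr x) ->
  (forall x, cn (v x) <= A * oneDsqr x) ->
  forall x, cn (u x) <= 2 * N * expR (4 * M * pi) * oneDsqr x /\
            cn (v x) <= 2 * N * expR (4 * M * pi) * oneDsqr x.
Proof.
move=> M0 hq hp hE iq ip eu ev N0 hF hG hu hv.
(* At this rate one application of the Volterra operator halves the constant. *)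
pose k := 4 * M; have k0 : 0 < k by rewrite mulr_gt0.
have A0 : 0 <= A.
  by rewrite -(pmulr_lge0 _ (W_gt0 0)); apply: le_trans (hu 0); exact: cn_ge0.
pose a n := 2 * N + A / 2 ^+ n.
have a0 n : 0 <= a n.
  by rewrite addr_ge0 ?mulr_ge0// invr_ge0 exprn_ge0.
have e1 x : 1 <= expR (k * phi x) by exact: expphi_ge1.
have Wom3 (s : R) : om s ^+ 3 * oneDsqr s <= om s.
  rewrite exprSr -mulrA [om s * _]mulrC Wom mulr1.
  by rewrite -[X in _ <= X]expr1 ler_wiXn2l// ?om_ge0 ?om_le1.
have step (q' u' F' : R -> C) (y : C) n x :
    cintegrable `]-oo, x] (fun s => q' s * u' s) ->
    (forall s, s <= x -> cn (q' s) <= M * om s ^+ 3) ->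
    (forall s, cn (u' s) <= a n * (oneDsqr s * expR (k * phi s))) ->
    cn y <= N * oneDsqr x ->
    cn (y + prim (fun s => q' s * u' s) x) <=
      a n.+1 * (oneDsqr x * expR (k * phi x)).
  move=> i hq' hu' hy.
  have h1 : cn (prim (fun s => q' s * u' s) x) <=
      2 * (M * a n * (k^-1 * expR (k * phi x))).
    apply: prim_exp_le => //; first by rewrite mulr_ge0// ltW.
    move=> s sx; rewrite cnM.
    apply: le_trans (ler_pM (cn_ge0 _) (cn_ge0 _) (hq' _ sx) (hu' s)) _.
    rewrite (_ : M * om s ^+ 3 * _ =
      M * a n * (om s ^+ 3 * oneDsqr s * expR (k * phi s))); last by ring.
    apply: ler_wpM2l; first by rewrite mulr_ge0// ltW.
    by apply: ler_wpM2r; [exact: expR_ge0|exact: Wom3].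
  have h2 : 2 * (M * a n * (k^-1 * expR (k * phi x))) = a n / 2 * expR (k * phi x).
    by rewrite /k; field; rewrite gt_eqF.
  apply: le_trans (cnD _ _) _; apply: le_trans (lerD hy h1) _; rewrite h2.
  have h3 : N * oneDsqr x <= N * (oneDsqr x * expR (k * phi x)).
    by rewrite ler_wpM2l// ler_peMr// ltW// W_gt0.
  have h4 : a n / 2 * expR (k * phi x) <= a n / 2 * (oneDsqr x * expR (k * phi x)).
    rewrite ler_wpM2l ?mulr_ge0 ?invr_ge0//.
    by rewrite ler_peMl ?expR_ge0// W_ge1.
  apply: le_trans (lerD h3 h4) _; rewrite -mulrDl.
  rewrite (_ : N + a n / 2 = a n.+1)//.
  by rewrite /a exprS; field; rewrite expf_neq0.
have main n x : cn (u x) <= a n * (oneDsqr x * expR (k * phi x)) /\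
                cn (v x) <= a n * (oneDsqr x * expR (k * phi x)).
  elim: n x => [|n IH] x.
    have h y : cn y <= A * oneDsqr x -> cn y <= a 0%N * (oneDsqr x * expR (k * phi x)).
      move=> hy; apply: le_trans hy _; rewrite /a expr0 divr1 mulrA.
      have : 0 <= (2 * N + A) * oneDsqr x.
        by apply: mulr_ge0; [rewrite addr_ge0 ?mulr_ge0|exact/ltW/W_gt0].
      move=> h; apply: (@le_trans _ _ ((2 * N + A) * oneDsqr x)).
        by apply: ler_wpM2r; [exact/ltW/W_gt0|rewrite lerDr mulr_ge0].
      by rewrite ler_peMr.
    by split; apply: h.
  split.
    by rewrite eu; apply: step => // s; exact: (IH s).2.
  rewrite ev; under [X in prim X]eq_fun do rewrite mulrA.
  apply: step => //.
  - by have := ip x; under [X in cintegrable _ X -> _]eq_fun do rewrite mulrA.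
  - move=> s sx; rewrite cnM -[X in _ <= X]mul1r.
    by rewrite ler_pM ?cn_ge0 ?hE.
  - by move=> s; exact: (IH s).1.
have fin (y : C) x : (forall n, cn y <= a n * (oneDsqr x * expR (k * phi x))) ->
    cn y <= 2 * N * expR (4 * M * pi) * oneDsqr x.
  move=> h; have h1 : cn y <= 2 * N * (oneDsqr x * expR (k * phi x)).
    apply: (@le_geo _ _ (A * (oneDsqr x * expR (k * phi x)))) => n.
    by apply: le_trans (h n) _; rewrite /a mulrDl [A / _ * _]mulrAC.
  apply: le_trans h1 _; rewrite -[X in _ <= X]mulrA.
  apply: ler_wpM2l; first by rewrite mulr_ge0.
  rewrite mulrC; apply: ler_wpM2r; first exact/ltW/W_gt0.
  exact: expphi_le.
by move=> x; split; apply: fin => n; [exact: (main n x).1|exact: (main n x).2].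
Qed.

(** The intervals of half-length $2K/2^n$ around the terms are nested. *)
Lemma real_geo_lim (a : nat -> R) (K : R) :
  (forall n, `|a n.+1 - a n| <= K / 2 ^+ n) ->
  exists l, forall n, `|a n - l| <= 2 * K / 2 ^+ n.
Proof.
move=> h.
pose c n := a n - 2 * K / 2 ^+ n; pose d n := a n + 2 * K / 2 ^+ n.
have K0 : 0 <= K.
  by have := h 0%N; rewrite expr0 divr1; apply: le_trans; exact: normr_ge0.
have half n : 2 * K / 2 ^+ n.+1 = K / 2 ^+ n.
  by rewrite exprS; field; rewrite expf_neq0.
have cS n : c n <= c n.+1.
  rewrite /c half; have := h n; rewrite ler_norml => /andP[h1 h2].
  by rewrite -mulrA; lra.
have dS n : d n.+1 <= d n.
  rewrite /d half; have := h n; rewrite ler_norml => /andP[h1 h2].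
  by rewrite -mulrA; lra.
have cm n m : c n <= c (n + m)%N.
  by elim: m => [|m IH]; [rewrite addn0|rewrite addnS (le_trans IH)].
have dm n m : d (n + m)%N <= d n.
  by elim: m => [|m IH]; [rewrite addn0|rewrite addnS (le_trans (dS _))].
have cd n : c n <= d n.
  have : 0 <= 2 * K / 2 ^+ n by rewrite divr_ge0 ?mulr_ge0 ?exprn_ge0.
  by rewrite /c /d; lra.
have cdm n m : c n <= d m.
  apply: le_trans (cm n m) _; apply: le_trans (cd _) _.
  by rewrite addnC; exact: dm.
pose S := [set c n | n in [set: nat]].
have ubS m : ubound S (d m) by move=> _ [n _ <-]; exact: cdm.
have hS : has_sup S by split; [exists (c 0%N), 0%N|exists (d 0%N)].
exists (sup S) => n.
have h1 : c n <= sup S by apply: sup_upper_bound => //; exists n.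
have h2 : sup S <= d n by apply: ge_sup => //; exact: hS.1.
move: h1 h2; rewrite /c /d => h1 h2.
by rewrite ler_norml; apply/andP; split; lra.
Qed.

Lemma cplx_geo_lim (a : nat -> C) (K : R) :
  (forall n, cn (a n.+1 - a n) <= K / 2 ^+ n) ->
  exists l : C, forall n, cn (a n - l) <= 4 * K / 2 ^+ n.
Proof.
move=> h.
have [r hr] : exists l, forall n, `|cRe (a n) - l| <= 2 * K / 2 ^+ n.
  by apply: real_geo_lim => n; rewrite -ReB; apply: le_trans (Re_le _) (h n).
have [i hi] : exists l, forall n, `|cIm (a n) - l| <= 2 * K / 2 ^+ n.
  by apply: real_geo_lim => n; rewrite -ImB; apply: le_trans (Im_le _) (h n).
exists (r +i* i) => n; apply: le_trans (cn_le _) _; rewrite ReB ImB /=.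
apply: le_trans (lerD (hr n) (hi n)) _.
by rewrite -mulrDl -mulrDl -natrD.
Qed.

Lemma ccont_unif (f : nat -> R -> C) (g : R -> C) (K : R) :
  (forall n, ccont (f n)) -> (forall n x, cn (f n x - g x) <= K / 2 ^+ n) ->
  ccont g.
Proof.
move=> cf h.
have key (r : C -> R) : (forall z w : C, `|r z - r w| <= cn (z - w)) ->
    (forall n, continuous (r \o f n)) -> continuous (r \o g).
  move=> hr hc x; apply/cvgrPdist_lt => e e0.
  have e4 : 0 < e / 4 by rewrite divr_gt0.
  have [n hn] := geo_small K e4.
  have /cvgrPdist_lt/(_ _ e4) hx := hc n x.
  near=> t.
  have h1 : `|r (f n x) - r (f n t)| < e / 4 by near: t; exact: hx.
  have h2 y : `|r (f n y) - r (g y)| <= e / 4.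
    by apply: le_trans (hr _ _) (le_trans (h n y) hn).
  have := h2 x; have := h2 t; move: h1; rewrite /= !ltr_norml !ler_norml.
  move=> /andP[a1 a2] /andP[b1 b2] /andP[c1 c2].
  by apply/andP; split; lra.
split; apply: key => [z w|n].
- by rewrite -ReB Re_le.
- exact: (cf n).1.
- by rewrite -ImB Im_le.
- exact: (cf n).2.
Unshelve. all: by end_near. Qed.

End Volterra.

(** * Convolution with a decaying exponential *)

Section ExponentialKernel.
Context {R : realType}.
Local Notation C := R[i].
Implicit Types (f F : R -> C) (c z : C) (x s w : R).

(** The solution of $F' = -cF + f$ that vanishes at $-\infty$, for
   $\mathrm{Re}\, c \ge 0$. The exponential is split into a function of $x$ and
   a function of $s$, so that differentiation is the product rule. *)
Definition Kop c f x : C :=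
  cexp (- (c * x%:C)) * prim (fun s => cexp (c * s%:C) * f s) x.

Lemma lbounded_cexp c : 0 <= cRe c -> lbounded (fun s => cexp (c * s%:C)).
Proof.
move=> c0 X; exists (expR (cRe c * X)) => s sX.
by rewrite cn_cexp ReM ReR ImR mulr0 subr0 ler_expR ler_wpM2l.
Qed.

Lemma ltame_cexp c f : 0 <= cRe c -> ltame f ->
  ltame (fun s => cexp (c * s%:C) * f s).
Proof.
by move=> c0; apply: ltameM; [exact: ccont_cexp|exact: lbounded_cexp].
Qed.

Lemma kern_split c x s :
  cexp (- (c * (x - s)%:C)) = cexp (- (c * x%:C)) * cexp (c * s%:C) :> C.
Proof. by rewrite -cexpD rmorphB; congr cexp; ring. Qed.

Lemma kern_int c f x : 0 <= cRe c -> ltame f ->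
  cintegrable `]-oo, x] (fun s => cexp (- (c * (x - s)%:C)) * f s).
Proof.
move=> c0 hf; have h := ltame_int x (ltame_cexp c0 hf).
have := cintegrableZ (cexp (- (c * x%:C))) (mray x) h.
by apply: (eq_cintegrable (mray x)) => s _; rewrite kern_split mulrA.
Qed.

Lemma KopE c f x : 0 <= cRe c -> ltame f ->
  Kop c f x = prim (fun s => cexp (- (c * (x - s)%:C)) * f s) x.
Proof.
move=> c0 hf; have h := ltame_int x (ltame_cexp c0 hf).
rewrite /Kop /prim -(cintegralZ _ (mray x) h).
by apply: eq_cintegral => s _; rewrite kern_split mulrA.
Qed.

Lemma cn_kern c x s : 0 <= cRe c -> s <= x -> cn (cexp (- (c * (x - s)%:C)) : C) <= 1.
Proof.
move=> c0 sx; apply: cn_cexp_le1.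
by rewrite ReN ReM ReR ImR mulr0 subr0 oppr_le0 mulr_ge0// subr_ge0.
Qed.

Lemma cder_cexpN c x :
  cder (fun t => cexp (- (c * t%:C))) x (- c * cexp (- (c * x%:C))).
Proof.
rewrite -mulNr (_ : (fun t : R => _) = fun t : R => cexp (- c * t%:C)).
  exact: cder_cexp.
by apply/funext => t; rewrite mulNr.
Qed.

Lemma cexpNK c x : cexp (- (c * x%:C)) * cexp (c * x%:C) = 1 :> C.
Proof. by rewrite -cexpD addNr cexp0. Qed.

Lemma Kop_der c f x : 0 <= cRe c -> ltame f ->
  cder (Kop c f) x (- c * Kop c f x + f x).
Proof.
move=> c0 hf; have h := prim_der x (ltame_cexp c0 hf).
apply: cder_eq (cderM (cder_cexpN c x) h) _.
by rewrite /Kop [cexp _ * (cexp _ * _)]mulrA cexpNK; ring.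
Qed.

Lemma Kop_le c f (K : R) x : 0 <= cRe c -> ltame f ->
  (forall s, s <= x -> cn (f s) <= K * om s) -> cn (Kop c f x) <= 2 * (K * phi x).
Proof.
move=> c0 hf hK; rewrite KopE//; apply: prim_le; first exact: kern_int.
move=> s sx; rewrite cnM; apply: le_trans (hK _ sx).
by rewrite ler_piMl ?cn_ge0// cn_kern.
Qed.

Lemma Kop_van c f : 0 <= cRe c -> ltame f -> van (Kop c f).
Proof.
move=> c0 hf; have [_ /(_ 0)[K hK]] := hf.
have K0 : 0 <= K.
  have := hK 0 (lexx _); rewrite -(pmulr_lge0 _ (om_gt0 0)).
  by apply: le_trans; exact: cn_ge0.
move=> e e0; have e1 : 0 < e / (2 * (K + 1)).
  by rewrite divr_gt0// mulr_gt0// ltr_pwDr.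
have [A hA] := phi_van e1; exists (Num.min A 0) => x.
rewrite le_min => /andP[xA x0].
have := hA _ xA; rewrite ltr_pdivlMr ?mulr_gt0 ?ltr_pwDr// => h1.
apply: le_lt_trans (Kop_le (K := K) c0 hf _) _.
  by move=> s sx; apply: hK; exact: le_trans sx x0.
apply: le_lt_trans h1.
rewrite (_ : phi x * (2 * (K + 1)) = 2 * (K * phi x) + 2 * phi x); last by ring.
by rewrite lerDl mulr_ge0// phi_ge0.
Qed.

(** Multiplication by $e^{cx}$ turns the equation into that of a primitive. *)
Lemma Kop_uniq c f F : 0 <= cRe c -> ltame f -> van F ->
  (forall x, cder F x (- c * F x + f x)) -> forall x, F x = Kop c f x.
Proof.
move=> c0 hf vF dF x.
have h y : cder (fun t => cexp (c * t%:C) * F t) y (cexp (c * y%:C) * f y).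
  by apply: cder_eq (cderM (cder_cexp c y) (dF y)) _; ring.
have := prim_uniq h (ltame_cexp c0 hf) (vanM (lbounded_cexp c0) vF) x.
by rewrite /Kop => <-; rewrite mulrA cexpNK mul1r.
Qed.

Lemma KopB c f g x : 0 <= cRe c -> ltame f -> ltame g ->
  Kop c (fun s => f s - g s) x = Kop c f x - Kop c g x.
Proof.
move=> c0 hf hg; rewrite /Kop -mulrBr; congr (_ * _).
rewrite /prim -cintegralB.
- by apply: eq_cintegral => s _; rewrite mulrBr.
- exact: mray.
- exact/ltame_int/ltame_cexp.
- exact/ltame_int/ltame_cexp.
Qed.

Lemma KopZ c d f x : 0 <= cRe c -> ltame f ->
  Kop c (fun s => d * f s) x = d * Kop c f x.
Proof.
move=> c0 hf; rewrite /Kop mulrCA; congr (_ * _).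
rewrite /prim -cintegralZ.
- by apply: eq_cintegral => s _; rewrite mulrCA.
- exact: mray.
- exact/ltame_int/ltame_cexp.
Qed.

Lemma W_dist (x s : R) : s <= x ->
  (1 + 2 * (x - s)) ^+ 2 <= 18 * (oneDsqr x * oneDsqr s).
Proof.
move=> sx; rewrite !WE.
have := sqr_ge0 (x - s - 1); have := sqr_ge0 (x + s); have := sqr_ge0 (x * s).
nra.
Qed.

Definition zr z w : C := z + w%:C.
Definition zi z w : C := z + 'i * w%:C.

(** The constant $3 (1 + t)^2$ of an exponential grows with $t = k(x - s)$ and is
   absorbed into weights at $x$ and $s$, with $54 = 3 \cdot 18$. *)
Lemma hol3_kern (k : R) z w x s : 0 <= k <= 2 -> 0 <= cIm z -> 0 <= w -> s <= x ->
  hol3 (54 * (oneDsqr x * oneDsqr s)) w (cexp ('i * z * (k * (x - s))%:C))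
    (cexp ('i * zr z w * (k * (x - s))%:C))
    (cexp ('i * zi z w * (k * (x - s))%:C)).
Proof.
move=> /andP[k0 k2] z0 w0 sx; have xs : 0 <= x - s by rewrite subr_ge0.
have t0 : 0 <= k * (x - s) by rewrite mulr_ge0.
rewrite (_ : 'i * zr z w * (k * (x - s))%:C =
  'i * z * (k * (x - s))%:C + 'i * (k * (x - s) * w)%:C); last first.
  by rewrite /zr [(_ * w)%:C]rmorphM; ring.
rewrite (_ : 'i * zi z w * (k * (x - s))%:C =
  'i * z * (k * (x - s))%:C - (k * (x - s) * w)%:C); last first.
  rewrite /zi [(_ * w)%:C]rmorphM mulrDr mulrDl mulrA ii; ring.
rewrite !cexpD; apply: hol3_mono (hol3_exp t0 w0 _) => //.
  have h1 : (1 + k * (x - s)) ^+ 2 <= (1 + 2 * (x - s)) ^+ 2.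
    have h : k * (x - s) <= 2 * (x - s) by rewrite ler_wpM2r.
    by rewrite ler_pXn2r ?nnegrE//; lra.
  have := W_dist sx; lra.
apply: cn_cexp_le1; rewrite ReM ReM ImM !ReImE.
rewrite !mulr0 mul0r sub0r mul1r subr0 mulNr oppr_le0.
by rewrite mulr_ge0.
Qed.

End ExponentialKernel.

Arguments Kop : simpl never.

(** * Existence of Jost solutions *)

Section Jost.
Context {R : realType}.
Local Notation C := R[i].
Implicit Types (q p u v : R -> C) (z : C) (M N x s w : R).

Definition jc z : C := - (2 * 'i * z).

Lemma jc_ge0 z : 0 <= cIm z -> 0 <= cRe (jc z).
Proof.
rewrite /jc ReN (ReM (2 * 'i)) (ReM 2) (ImM 2) Rei Imi (Re_nat 2) (Im_nat 2).
by move=> h; lra.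
Qed.

(** The Volterra system of the first Jost function $r = (u, v)^T$ at $-\infty$ for
   the matrix with off-diagonal entries $q$, $p$; here [jc z] is $-2iz$. *)
Definition jsol q p z u v : Prop :=
  [/\ ccont u, ccont v, (exists N, forall x, cn (u x) <= N /\ cn (v x) <= N),
    (forall x, u x = 1 + prim (fun s => q s * v s) x) &
    (forall x, v x = Kop (jc z) (fun s => p s * u s) x)].

Lemma bounded_tameM M q u N : pot M q -> ccont u -> (forall x, cn (u x) <= N) ->
  tame (fun s => q s * u s).
Proof.
move=> hq cu hu; have := tameM cu hu (pot_tame hq).
by rewrite (_ : (fun s => u s * q s) = fun s => q s * u s)//; apply/funext => s; rewrite mulrC.
Qed.

Section Existence.
Variables (M : R) (q p : R -> C) (z : C).
Hypotheses (M0 : 0 < M) (hq : pot M q) (hp : pot M p) (z0 : 0 <= cIm z).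

Let k := 4 * M.
Let k0 : 0 < k. Proof. by rewrite mulr_gt0. Qed.

Definition picard_step (uv : (R -> C) * (R -> C)) : (R -> C) * (R -> C) :=
  (fun x => 1 + prim (fun s => q s * uv.2 s) x,
   Kop (jc z) (fun s => p s * uv.1 s)).

Definition picard n := iter n picard_step (fun=> 0, fun=> 0).

Let e (x : R) := expR (k * phi x).
Let K1 : R := expR (k * pi).

Let eK x : e x <= K1. Proof. exact: expphi_le. Qed.
Let e1 x : 1 <= e x. Proof. exact: expphi_ge1. Qed.

Let pot_exp (f : R -> C) (g : R -> C) (a : R) : 0 <= a -> pot M f ->
  (forall s, cn (g s) <= a * e s) ->
  forall s, cn (f s * g s) <= M * a * (om s * e s).
Proof.
move=> a0 [_ hf] hg s; rewrite cnM.
apply: le_trans (ler_pM (cn_ge0 _) (cn_ge0 _) (hf s) (hg s)) _.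
rewrite (_ : M * om s ^+ 3 * _ = M * a * (om s ^+ 3 * e s)); last by ring.
apply: ler_wpM2l; first by rewrite mulr_ge0// ltW.
by apply: ler_wpM2r; [exact: expR_ge0|exact: om3_le].
Qed.

Let prim_half (h : R -> C) (a x : R) : 0 <= a -> cintegrable `]-oo, x] h ->
  (forall s, s <= x -> cn (h s) <= M * a * (om s * e s)) ->
  cn (prim h x) <= a / 2 * e x.
Proof.
move=> a0 hi hh; have Ma : 0 <= M * a by rewrite mulr_ge0// ltW.
apply: le_trans (prim_exp_le k0 Ma hi hh) _.
by rewrite /e /k le_eqVlt; apply/orP; left; apply/eqP; field; rewrite gt_eqF.
Qed.

(** Consecutive iterates differ by $2^{-n} e^{4M\phi}$, since integration against
   a potential gains $M/k = 1/4$, doubled by the passage to complex values. *)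
Lemma picard_prop n : [/\ ccont (picard n).1, ccont (picard n).2 &
  forall x, [/\ cn ((picard n.+1).1 x - (picard n).1 x) <= 2^-1 ^+ n * e x,
    cn ((picard n.+1).2 x - (picard n).2 x) <= 2^-1 ^+ n * e x &
    cn ((picard n).1 x) <= 2 * K1 - 2 * 2^-1 ^+ n * K1 /\
    cn ((picard n).2 x) <= 2 * K1 - 2 * 2^-1 ^+ n * K1]].
Proof.
have jz := jc_ge0 z0.
elim: n => [|n [c1 c2 h]].
  split; [exact: ccont_cst|exact: ccont_cst|move=> x].
  have P0 (f : R -> C) : prim (fun s => f s * 0) x = 0.
    rewrite -(@prim_uniq _ (fun=> 0) (fun s => f s * 0))//.
    - by move=> y; rewrite mulr0; exact: cder_cst.
    - split; first by apply: (ccont_ext (F := fun=> 0)) => [t|]; [rewrite mulr0|exact: ccont_cst].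
      by move=> X; exists 0 => s _; rewrite mulr0 cn0 mul0r.
    - by move=> ep ep0; exists 0 => y _; rewrite cn0.
  have K0 : Kop (jc z) (fun s => p s * 0) x = 0.
    rewrite /Kop (_ : (fun s => _) = fun s => (cexp (jc z * s%:C) * p s) * 0).
      by rewrite P0 mulr0.
    by apply/funext => s; rewrite mulrA.
  have E1 : (picard 1).1 x = 1.
    by rewrite -[LHS]/(1 + prim (fun s => q s * 0) x) P0 addr0.
  have E2 : (picard 1).2 x = 0 by rewrite -[RHS]K0.
  rewrite E1 E2 -[(picard 0).1 x]/0 -[(picard 0).2 x]/0.
  rewrite !subr0 cn0 cn1 expr0 mul1r mulr1 subrr.
  by split => //; rewrite ltW// expR_gt0.
have bd x : cn ((picard n).1 x) <= 2 * K1 /\ cn ((picard n).2 x) <= 2 * K1.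
  have [_ _ [a b]] := h x.
  have : 0 <= 2 * 2^-1 ^+ n * K1.
    by rewrite !mulr_ge0 ?exprn_ge0 ?invr_ge0// expR_ge0.
  by split; lra.
have bdS x : cn ((picard n.+1).1 x) <= 2 * K1 - 2 * 2^-1 ^+ n.+1 * K1 /\
             cn ((picard n.+1).2 x) <= 2 * K1 - 2 * 2^-1 ^+ n.+1 * K1.
  have [d1 d2 [a b]] := h x.
  have ee : 2^-1 ^+ n * e x <= 2^-1 ^+ n * K1.
    by rewrite ler_wpM2l ?eK// exprn_ge0// invr_ge0.
  rewrite exprS (_ : 2 * (2^-1 * 2^-1 ^+ n) * K1 = 2^-1 ^+ n * K1 :> R); last by field.
  have := cnD ((picard n.+1).1 x - (picard n).1 x) ((picard n).1 x).
  have := cnD ((picard n.+1).2 x - (picard n).2 x) ((picard n).2 x).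
  by rewrite !subrK; split; lra.
have tq : tame (fun s => q s * (picard n).2 s).
  by apply: (bounded_tameM hq c2) => x; exact: (bd x).2.
have tp : tame (fun s => p s * (picard n).1 s).
  by apply: (bounded_tameM hp c1) => x; exact: (bd x).1.
have c1' : ccont (picard n.+1).1.
  apply: ccontD; first exact: ccont_cst.
  by apply: cder_cont => x; apply: prim_der; exact: tame_ltame.
have c2' : ccont (picard n.+1).2.
  by apply: cder_cont => x; apply: Kop_der => //; exact: tame_ltame.
have Pb x : cn ((picard n.+1).1 x) <= 2 * K1 /\ cn ((picard n.+1).2 x) <= 2 * K1.
  have [a b] := bdS x.
  have : 0 <= 2 * 2^-1 ^+ n.+1 * K1.
    by rewrite !mulr_ge0 ?exprn_ge0 ?invr_ge0// expR_ge0.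
  by split; lra.
have tq' : tame (fun s => q s * (picard n.+1).2 s).
  by apply: (bounded_tameM hq c2') => x; exact: (Pb x).2.
have tp' : tame (fun s => p s * (picard n.+1).1 s).
  by apply: (bounded_tameM hp c1') => x; exact: (Pb x).1.
split => // x; split => //.
- rewrite [X in cn (X - _)]/= [X in cn (_ - X)]/= opprD addrACA subrr add0r.
  rewrite /prim -cintegralB; [|exact: mray|exact/ltame_int/tame_ltame..].
  rewrite exprS mulrC [2^-1 * _]mulrC mulrC.
  apply: prim_half; first by rewrite exprn_ge0// invr_ge0.
    by apply: cintegrableB; [exact: mray|exact/ltame_int/tame_ltame..].
  move=> s _; rewrite -mulrBr.
  apply: (pot_exp _ hq (g := fun s => (picard n.+1).2 s - (picard n).2 s)).
    by rewrite exprn_ge0// invr_ge0.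
  by move=> y; have [] := h y.
- rewrite [X in cn (X - _)]/= [X in cn (_ - X)]/=.
  rewrite -KopB//; [|exact: tame_ltame..].
  have tB : ltame (fun s => p s * (picard n.+1).1 s - p s * (picard n).1 s).
    by apply: tame_ltame; exact: tameB.
  rewrite KopE// exprS mulrC [2^-1 * _]mulrC mulrC.
  apply: prim_half; first by rewrite exprn_ge0// invr_ge0.
    exact: kern_int.
  move=> s sx; rewrite cnM -[X in _ <= X]mul1r.
  apply: ler_pM; rewrite ?cn_ge0 ?cn_kern//.
  rewrite -mulrBr.
  apply: (pot_exp _ hp (g := fun s => (picard n.+1).1 s - (picard n).1 s)).
    by rewrite exprn_ge0// invr_ge0.
  by move=> y; have [] := h y.
Qed.

Lemma jsol_exists : exists uv, jsol q p z uv.1 uv.2.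
Proof.
have jz := jc_ge0 z0.
have K10 : 0 <= K1 by exact: expR_ge0.
have half n : 2^-1 ^+ n * K1 = K1 / 2 ^+ n by rewrite exprVn mulrC.
have du x n : cn ((picard n.+1).1 x - (picard n).1 x) <= K1 / 2 ^+ n.
  have [_ _ /(_ x) [h _ _]] := picard_prop n; rewrite -half.
  by apply: le_trans h _; rewrite ler_wpM2l ?eK// exprn_ge0// invr_ge0.
have dv x n : cn ((picard n.+1).2 x - (picard n).2 x) <= K1 / 2 ^+ n.
  have [_ _ /(_ x) [_ h _]] := picard_prop n; rewrite -half.
  by apply: le_trans h _; rewrite ler_wpM2l ?eK// exprn_ge0// invr_ge0.
pose u x := projT1 (cid (cplx_geo_lim (du x))).
pose v x := projT1 (cid (cplx_geo_lim (dv x))).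
have hu n x : cn ((picard n).1 x - u x) <= 4 * K1 / 2 ^+ n.
  exact: (projT2 (cid (cplx_geo_lim (du x)))).
have hv n x : cn ((picard n).2 x - v x) <= 4 * K1 / 2 ^+ n.
  exact: (projT2 (cid (cplx_geo_lim (dv x)))).
have cu : ccont u by apply: ccont_unif hu => n; have [] := picard_prop n.
have cv : ccont v by apply: ccont_unif hv => n; have [] := picard_prop n.
have bu x : cn (u x) <= 4 * K1.
  by have := hu 0%N x; rewrite /= sub0r cnN expr0 divr1.
have bv x : cn (v x) <= 4 * K1.
  by have := hv 0%N x; rewrite /= sub0r cnN expr0 divr1.
have tq : tame (fun s => q s * v s) by exact: (bounded_tameM hq cv bv).
have tp : tame (fun s => p s * u s) by exact: (bounded_tameM hp cu bu).
have bd n x : cn ((picard n).1 x) <= 2 * K1 /\ cn ((picard n).2 x) <= 2 * K1.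
  have [_ _ /(_ x) [_ _ [a b]]] := picard_prop n.
  have : 0 <= 2 * 2^-1 ^+ n * K1.
    by rewrite !mulr_ge0 ?exprn_ge0 ?invr_ge0// expR_ge0.
  by split; lra.
have tqn n : tame (fun s => q s * (picard n).2 s).
  have [_ c2 _] := picard_prop n.
  by apply: (bounded_tameM hq c2) => x; exact: (bd n x).2.
have tpn n : tame (fun s => p s * (picard n).1 s).
  have [c1 _ _] := picard_prop n.
  by apply: (bounded_tameM hp c1) => x; exact: (bd n x).1.
have zero (y : C) (d : R) : (forall n, cn y <= 0 + d / 2 ^+ n) -> y = 0.
  move=> h; apply: cn_eq0; apply/eqP; rewrite eq_le cn_ge0 andbT.
  exact: le_geo h.
have dom (f g g' : R -> C) n (s : R) : pot M f ->
    (forall x, cn (g x - g' x) <= 4 * K1 / 2 ^+ n) ->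
    cn (f s * g s - f s * g' s) <= M * (4 * K1 / 2 ^+ n) * om s.
  move=> [_ hf] hg; rewrite -mulrBr cnM mulrAC.
  apply: ler_pM; rewrite ?cn_ge0//.
  by apply: le_trans (hf s) _; rewrite ler_wpM2l ?om3_le// ltW.
have a0 n : 0 <= M * (4 * K1 / 2 ^+ n).
  by rewrite !mulr_ge0 ?invr_ge0 ?exprn_ge0// ltW.
have ph n x : 2 * (M * (4 * K1 / 2 ^+ n) * phi x) <= 2 * (M * (4 * K1) * pi) / 2 ^+ n.
  rewrite (_ : 2 * (M * (4 * K1) * pi) / 2 ^+ n = 2 * (M * (4 * K1 / 2 ^+ n) * pi)).
    by rewrite ler_pM2l// ler_wpM2l// phi_lepi.
  by field; rewrite expf_neq0.
exists (u, v); split => //=.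
- by exists (4 * K1).
- move=> x; apply/eqP; rewrite -subr_eq0; apply/eqP.
  apply: (zero _ (4 * K1 + 2 * (M * (4 * K1) * pi))) => n.
  rewrite add0r mulrDl.
  rewrite (_ : u x - _ = - ((picard n.+1).1 x - u x) +
     (prim (fun s => q s * (picard n).2 s) x - prim (fun s => q s * v s) x)).
    apply: le_trans (cnD _ _) _; rewrite cnN; apply: lerD.
      apply: le_trans (hu n.+1 x) _; rewrite ler_wpM2l ?mulr_ge0//.
      by rewrite lef_pV2 ?posrE ?exprn_gt0// ler_weXn2l// ler1n.
    rewrite /prim -cintegralB; [|exact: mray|exact/ltame_int/tame_ltame..].
    apply: le_trans (prim_le (K := M * (4 * K1 / 2 ^+ n)) _ _) (ph n x).
      by apply: cintegrableB; [exact: mray|exact/ltame_int/tame_ltame..].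
    by move=> s _; exact: dom.
  by rewrite /=; ring.
- move=> x; apply/eqP; rewrite -subr_eq0; apply/eqP.
  apply: (zero _ (4 * K1 + 2 * (M * (4 * K1) * pi))) => n.
  rewrite add0r mulrDl.
  rewrite (_ : v x - _ = - ((picard n.+1).2 x - v x) +
     (Kop (jc z) (fun s => p s * (picard n).1 s) x - Kop (jc z) (fun s => p s * u s) x)).
    apply: le_trans (cnD _ _) _; rewrite cnN; apply: lerD.
      apply: le_trans (hv n.+1 x) _; rewrite ler_wpM2l ?mulr_ge0//.
      by rewrite lef_pV2 ?posrE ?exprn_gt0// ler_weXn2l// ler1n.
    rewrite -KopB//; [|exact: tame_ltame..].
    apply: le_trans (Kop_le (K := M * (4 * K1 / 2 ^+ n)) _ _ _) (ph n x) => //.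
      by apply: tame_ltame; exact: tameB.
    by move=> s _; exact: dom.
  by rewrite /=; ring.
Qed.

End Existence.

End Jost.

(** * Jost solutions and their dependence on the spectral parameter *)

Section JostProperties.
Context {R : realType}.
Local Notation C := R[i].
Implicit Types (q p u v : R -> C) (z : C) (M N x s w : R).

Definition jost q p z : (R -> C) * (R -> C) :=
  xget (fun=> 0, fun=> 0) [set uv | jsol q p z uv.1 uv.2].

Definition jU q p z := (jost q p z).1.
Definition jV q p z := (jost q p z).2.

Variable M : R.
Hypothesis M0 : 0 < M.

Lemma jostP q p z : pot M q -> pot M p -> 0 <= cIm z ->
  jsol q p z (jU q p z) (jV q p z).
Proof.
move=> hq hp z0; have [uv huv] := jsol_exists M0 hq hp z0.
rewrite /jU /jV /jost.
by case: xgetP => [y -> //|/(_ uv)].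
Qed.

Section OneSolution.
Variables (q p u v : R -> C) (z : C).
Hypotheses (hq : pot M q) (hp : pot M p) (z0 : 0 <= cIm z) (h : jsol q p z u v).

Lemma jsol_tame_qv : tame (fun s => q s * v s).
Proof.
by case: h => _ cv [N hN] _ _; apply: (bounded_tameM hq cv) => x; exact: (hN x).2.
Qed.

Lemma jsol_tame_pu : tame (fun s => p s * u s).
Proof.
by case: h => cu _ [N hN] _ _; apply: (bounded_tameM hp cu) => x; exact: (hN x).1.
Qed.

Lemma jsol_du x : cder u x (q x * v x).
Proof.
case: h => _ _ _ eu _.
apply: cder_ext (fun t => esym (eu t)) _.
apply: cder_eq (cderD (cder_cst 1 x) (prim_der x (tame_ltame jsol_tame_qv))) _.
by rewrite add0r.
Qed.

Lemma jsol_dv x : cder v x (2 * 'i * z * v x + p x * u x).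
Proof.
case: h => _ _ _ _ ev.
apply: cder_ext (fun t => esym (ev t)) _.
apply: cder_eq (Kop_der x (jc_ge0 z0) (tame_ltame jsol_tame_pu)) _.
by rewrite -ev /jc opprK.
Qed.

Lemma jsol_vanu : van (fun x => u x - 1).
Proof.
case: h => _ _ _ eu _ e e0.
have [A hA] := prim_van (tame_ltame jsol_tame_qv) e0.
by exists A => x /hA; rewrite eu addrC addKr.
Qed.

Lemma jsol_vanv : van v.
Proof.
case: h => _ _ _ _ ev e e0.
have [A hA] := Kop_van (jc_ge0 z0) (tame_ltame jsol_tame_pu) e0.
by exists A => x /hA; rewrite ev.
Qed.

Lemma jsol_bounded : exists N, forall x, cn (u x) <= N /\ cn (v x) <= N.
Proof. by case: h. Qed.

Lemma jsol_kern x s : cexp (- (jc z * (x - s)%:C)) = cexp ('i * z * (2 * (x - s))%:C).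
Proof. by congr cexp; rewrite /jc [(2 * _)%:C]rmorphM/=; ring. Qed.

Lemma jsol_v x : v x = prim (fun s => cexp ('i * z * (2 * (x - s))%:C) * (p s * u s)) x.
Proof.
case: h => _ _ _ _ ev; rewrite ev KopE//; last exact/tame_ltame/jsol_tame_pu.
  by apply: eq_cintegral => s _; rewrite jsol_kern.
exact: jc_ge0.
Qed.

Lemma jsol_kint f x : tame f ->
  cintegrable `]-oo, x] (fun s => cexp ('i * z * (2 * (x - s))%:C) * f s).
Proof.
move=> hf; have := kern_int x (jc_ge0 z0) (tame_ltame hf).
by apply: (eq_cintegrable (mray x)) => s _; rewrite jsol_kern.
Qed.

Lemma jsol_cnkern x s : s <= x -> cn (cexp ('i * z * (2 * (x - s))%:C) : C) <= 1.
Proof. by rewrite -jsol_kern; apply: cn_kern; exact: jc_ge0. Qed.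

End OneSolution.

Lemma WgeC (N x : R) : 0 <= N -> N <= N * oneDsqr x.
Proof. by move=> N0; rewrite ler_peMr// W_ge1. Qed.

Definition JB0 := 2 * 1 * expR (4 * M * pi) : R.

Lemma jsol_le q p u v z : pot M q -> pot M p -> 0 <= cIm z -> jsol q p z u v ->
  forall x, cn (u x) <= JB0 * oneDsqr x /\ cn (v x) <= JB0 * oneDsqr x.
Proof.
move=> hq hp z0 h; have [N hN] := jsol_bounded h.
have N0 : 0 <= N by apply: le_trans (hN 0).1; exact: cn_ge0.
apply: (gronwall (q := q) (p := p) (N := 1) (A := N)
  (E := fun x s => cexp ('i * z * (2 * (x - s))%:C)) (F := fun=> 1) (G := fun=> 0)) => //.
- exact: hq.2.
- exact: hp.2.
- by move=> x s; exact: jsol_cnkern.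
- by move=> x; apply: ltame_int; apply: tame_ltame; exact: (jsol_tame_qv hq h).
- by move=> x; apply: jsol_kint => //; exact: (jsol_tame_pu hp h).
- by case: h.
- by move=> x; rewrite add0r; exact: (jsol_v hp z0 h).
- by move=> x; rewrite cn1 mul1r W_ge1.
- by move=> x; rewrite cn0 mul1r; exact/ltW/W_gt0.
- by move=> x; apply: le_trans (hN x).1 (WgeC _ _).
- by move=> x; apply: le_trans (hN x).2 (WgeC _ _).
Qed.

Lemma om3W2 (s : R) : om s ^+ 3 * oneDsqr s * oneDsqr s = om s.
Proof.
rewrite (_ : om s ^+ 3 * _ * _ = om s * (oneDsqr s * om s) ^+ 2); last by ring.
by rewrite Wom expr1n mulr1.
Qed.

Let D1 := 2 * (54 * M * JB0 * pi).
Definition JB1 := 2 * D1 * expR (4 * M * pi).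
Let D2 := 2 * (54 * M * (JB0 + 2 * JB1) * pi).
Definition JB2 := 2 * D2 * expR (4 * M * pi).

Lemma JB0_ge0 : 0 <= JB0. Proof. by rewrite /JB0 !mulr_ge0 ?expR_ge0. Qed.
Let D1_ge0 : 0 <= D1.
Proof.
have h := JB0_ge0; have h' := pi_ge0 R.
by rewrite /D1; do 3 apply: mulr_ge0 => //; apply: mulr_ge0 => //; exact: ltW.
Qed.
Lemma JB1_ge0 : 0 <= JB1.
Proof.
by rewrite /JB1; apply: mulr_ge0; [apply: mulr_ge0|exact: expR_ge0].
Qed.
Let D2_ge0 : 0 <= D2.
Proof.
have h := JB0_ge0; have h1 := JB1_ge0; have h' := pi_ge0 R.
have h2 : 0 <= JB0 + 2 * JB1 by lra.
by rewrite /D2; do 3 apply: mulr_ge0 => //; apply: mulr_ge0 => //; exact: ltW.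
Qed.
Lemma JB2_ge0 : 0 <= JB2.
Proof.
by rewrite /JB2; apply: mulr_ge0; [apply: mulr_ge0|exact: expR_ge0].
Qed.

(** The inhomogeneity in the equation for a difference of two Jost solutions:
   $D$ is a difference of kernels times a Jost solution, each of the two costs
   one factor $1 + s^2$, and the potential pays for both. *)
Lemma diff_term p (D : R -> C) (b x r : R) : pot M p -> 0 <= b -> 0 <= r ->
  cintegrable `]-oo, x] (fun s => D s * p s) ->
  (forall s, s <= x -> cn (D s) <= 54 * (oneDsqr x * oneDsqr s) * r * (b * oneDsqr s)) ->
  cn (prim (fun s => D s * p s) x) <= 2 * (54 * M * b * pi) * r * oneDsqr x.
Proof.
move=> hp b0 r0 hi hD.
have W0 := ltW (W_gt0 x).
apply: le_trans (prim_le (K := 54 * M * b * r * oneDsqr x) hi _) _.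
  move=> s sx; rewrite cnM.
  apply: le_trans (ler_pM (cn_ge0 _) (cn_ge0 _) (hD s sx) (hp.2 s)) _.
  rewrite (_ : _ * (M * om s ^+ 3) = 54 * M * b * r * oneDsqr x *
    (om s ^+ 3 * oneDsqr s * oneDsqr s)); first by rewrite om3W2.
  by ring.
rewrite [X in _ <= X](_ : _ = 2 * (54 * M * b * r * oneDsqr x * pi)); last by ring.
rewrite ler_pM2l//; apply: ler_wpM2l; last exact: phi_lepi.
by rewrite !mulr_ge0// ltW.
Qed.

(** First and second differences of Jost solutions solve the same Volterra system
   with an inhomogeneity of size $w$ and $w^2$, so that the Gronwall bound applies
   to each. *)
Lemma jsol_hol3 q p z w u0 v0 u1 v1 u2 v2 : pot M q -> pot M p -> 0 <= cIm z ->
  0 <= w -> jsol q p z u0 v0 -> jsol q p (zr z w) u1 v1 -> jsol q p (zi z w) u2 v2 ->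
  forall x, hol3 ((JB0 + JB1 + JB2) * oneDsqr x) w (u0 x) (u1 x) (u2 x) /\
            hol3 ((JB0 + JB1 + JB2) * oneDsqr x) w (v0 x) (v1 x) (v2 x).
Proof.
move=> hq hp z0 w0 h0 h1 h2.
have z10 : 0 <= cIm (zr z w) by rewrite ImD ImR addr0.
have z20 : 0 <= cIm (zi z w).
  by rewrite ImD ImM !ReImE mul1r mul0r add0r addr_ge0.
pose E z x s : C := cexp ('i * z * (2 * (x - s))%:C).
have hE x s : s <= x -> hol3 (54 * (oneDsqr x * oneDsqr s)) w
    (E z x s) (E (zr z w) x s) (E (zi z w) x s).
  by move=> sx; apply: hol3_kern => //; rewrite ler0n lexx.
have b0 := jsol_le hq hp z0 h0; have b1 := jsol_le hq hp z10 h1.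
have b2 := jsol_le hq hp z20 h2.
have tq0 := jsol_tame_qv hq h0; have tq1 := jsol_tame_qv hq h1.
have tq2 := jsol_tame_qv hq h2.
have tp0 := jsol_tame_pu hp h0; have tp1 := jsol_tame_pu hp h1.
have tp2 := jsol_tame_pu hp h2.
have eu0 x : u0 x = 1 + prim (fun s => q s * v0 s) x by case: h0.
have eu1 x : u1 x = 1 + prim (fun s => q s * v1 s) x by case: h1.
have eu2 x : u2 x = 1 + prim (fun s => q s * v2 s) x by case: h2.
have ev0 := jsol_v hp z0 h0; have ev1 := jsol_v hp z10 h1.
have ev2 := jsol_v hp z20 h2.
have i00 f x (tf : tame f) := jsol_kint z0 x tf.
have i11 f x (tf : tame f) := jsol_kint z10 x tf.
have i22 f x (tf : tame f) := jsol_kint z20 x tf.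
have JW x : 0 <= JB0 * oneDsqr x by apply: mulr_ge0; [exact: JB0_ge0|exact/ltW/W_gt0].
have first z' u' v' : 0 <= cIm z' -> jsol q p z' u' v' ->
    (forall x s, s <= x -> cn (E z' x s - E z x s) <= 54 * (oneDsqr x * oneDsqr s) * w) ->
    forall x, cn (u' x - u0 x) <= JB1 * w * oneDsqr x /\
              cn (v' x - v0 x) <= JB1 * w * oneDsqr x.
  move=> z'0 h' hEE x.
  have b' := jsol_le hq hp z'0 h'; have tq' := jsol_tame_qv hq h'.
  have tp' := jsol_tame_pu hp h'.
  have eu' y : u' y = 1 + prim (fun s => q s * v' s) y by case: h'.
  have ev' := jsol_v hp z'0 h'.
  rewrite (_ : JB1 * w = 2 * (D1 * w) * expR (4 * M * pi)); last by rewrite /JB1; ring.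
  apply: (gronwall (q := q) (p := p) (A := 2 * JB0) (u := fun x => u' x - u0 x)
    (v := fun x => v' x - v0 x) (E := E z) (F := fun=> 0)
    (G := fun x => prim (fun s => (E z' x s - E z x s) * u' s * p s) x)) => //.
  - exact: hq.2.
  - exact: hp.2.
  - by move=> y s; exact: jsol_cnkern.
  - move=> y; have := cintegrableB (mray y) (ltame_int y (tame_ltame tq'))
      (ltame_int y (tame_ltame tq0)).
    by apply: (eq_cintegrable (mray y)) => s _; rewrite mulrBr.
  - move=> y; have := cintegrableB (mray y) (i00 _ y tp') (i00 _ y tp0).
    by apply: (eq_cintegrable (mray y)) => s _; rewrite -mulrBr -mulrBr.
  - move=> y; rewrite add0r eu' eu0 opprD addrACA subrr add0r /prim -cintegralB.
    + by apply: eq_cintegral => s _; rewrite mulrBr.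
    + exact: mray.
    + exact/ltame_int/tame_ltame.
    + exact/ltame_int/tame_ltame.
  - move=> y; rewrite ev' ev0.
    have j1 := jsol_kint z'0 y tp'.
    rewrite /prim -cintegralB; [|exact: mray|exact: j1|exact: i00].
    rewrite -cintegralD; last 3 first.
    + exact: mray.
    + have := cintegrableB (mray y) j1 (i00 _ y tp').
      by apply: (eq_cintegrable (mray y)) => s _; rewrite -/(E z y s) -/(E z' y s); ring.
    + have := cintegrableB (mray y) (i00 _ y tp') (i00 _ y tp0).
      by apply: (eq_cintegrable (mray y)) => s _; rewrite -/(E z y s); ring.
    by apply: eq_cintegral => s _; rewrite -/(E z y s) -/(E z' y s); ring.
  - by apply: mulr_ge0; rewrite ?D1_ge0 ?D2_ge0.
  - by move=> y; rewrite cn0; apply: mulr_ge0; [apply: mulr_ge0;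
      rewrite ?D1_ge0 ?D2_ge0|exact/ltW/W_gt0].
  - move=> y; apply: diff_term => //; first exact: JB0_ge0.
      have := cintegrableB (mray y) (jsol_kint z'0 y tp') (i00 _ y tp').
      by apply: (eq_cintegrable (mray y)) => s _; rewrite -/(E z y s) -/(E z' y s); ring.
    move=> s sy; rewrite cnM; apply: ler_pM; rewrite ?cn_ge0//.
      exact: hEE.
    exact: (b' s).1.
  - move=> y; apply: le_trans (cnB _ _) _.
    by have := (b' y).1; have := (b0 y).1; lra.
  - move=> y; apply: le_trans (cnB _ _) _.
    by have := (b' y).2; have := (b0 y).2; lra.
have f1 := first _ _ _ z10 h1 (fun x s sx => let: And4 _ _ _ (And3 a _ _) := hE x s sx in a).
have f2 := first _ _ _ z20 h2 (fun x s sx => let: And4 _ _ _ (And3 _ a _) := hE x s sx in a).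
have second x : cn (u2 x - u0 x - 'i * (u1 x - u0 x)) <= JB2 * w ^+ 2 * oneDsqr x /\
    cn (v2 x - v0 x - 'i * (v1 x - v0 x)) <= JB2 * w ^+ 2 * oneDsqr x.
  rewrite (_ : JB2 * w ^+ 2 = 2 * (D2 * w ^+ 2) * expR (4 * M * pi));
    last by rewrite /JB2; ring.
  have T (k0 k1 k2 : R -> C) : tame k0 -> tame k1 -> tame k2 ->
      tame (fun s => k2 s - k0 s - 'i * (k1 s - k0 s)).
    by move=> a b c; apply: tameB; [exact: tameB|apply: tameZ; exact: tameB].
  have w2 : 0 <= w ^+ 2 by rewrite exprn_ge0.
  (* The second difference of the products of kernel and solution, minus the
     kernel times the second difference of the solutions. *)
  pose Dt y s : C := (E (zi z w) y s - E z y s - 'i * (E (zr z w) y s - E z y s)) * u0 s +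
    (E (zi z w) y s - E z y s) * (u2 s - u0 s) -
    'i * ((E (zr z w) y s - E z y s) * (u1 s - u0 s)).
  have iD y : cintegrable `]-oo, y] (fun s => Dt y s * p s).
    have k0 : cintegrable `]-oo, y] (fun s => E (zi z w) y s * (p s * u2 s) -
        E z y s * (p s * u2 s)).
      by apply: cintegrableB; [exact: mray|exact: i22|exact: i00].
    have k1 : cintegrable `]-oo, y] (fun s => 'i * (E (zr z w) y s * (p s * u1 s) -
        E z y s * (p s * u1 s))).
      by apply: cintegrableZ; [exact: mray|apply: cintegrableB;
        [exact: mray|exact: i11|exact: i00]].
    have := cintegrableB (mray y) k0 k1.
    by apply: (eq_cintegrable (mray y)) => s _; rewrite /Dt; ring.
  apply: (gronwall (q := q) (p := p) (A := 4 * JB0)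
    (u := fun x => u2 x - u0 x - 'i * (u1 x - u0 x))
    (v := fun x => v2 x - v0 x - 'i * (v1 x - v0 x)) (E := E z) (F := fun=> 0)
    (G := fun x => prim (fun s => Dt x s * p s) x)) => //.
  - exact: hq.2.
  - exact: hp.2.
  - by move=> y s; exact: jsol_cnkern.
  - move=> y; have := ltame_int y (tame_ltame (T _ _ _ tq0 tq1 tq2)).
    by apply: (eq_cintegrable (mray y)) => s _; ring.
  - move=> y; have := i00 _ y (T _ _ _ tp0 tp1 tp2).
    by apply: (eq_cintegrable (mray y)) => s _; rewrite -/(E z y s); ring.
  - move=> y; rewrite add0r eu2 eu1 eu0.
    have cancel1 (a b c : C) : 1 + a - (1 + b) - 'i * (1 + c - (1 + b)) =
      a - b - 'i * (c - b) by ring.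
    rewrite cancel1 /prim.
    rewrite -[X in _ - 'i * X]cintegralB; [|exact: mray|exact/ltame_int/tame_ltame..].
    rewrite -[X in X - _]cintegralB; [|exact: mray|exact/ltame_int/tame_ltame..].
    rewrite -cintegralZ; [|exact: mray|exact/ltame_int/tame_ltame/tameB].
    rewrite -cintegralB; [|exact: mray|exact/ltame_int/tame_ltame/tameB|
       exact/ltame_int/tame_ltame/tameZ/tameB].
    by apply: eq_cintegral => s _; ring.
  - move=> y; rewrite ev2 ev1 ev0 /prim.
    rewrite -[X in _ - 'i * X]cintegralB; [|exact: mray|exact: i11|exact: i00].
    rewrite -[X in X - _ = _]cintegralB; [|exact: mray|exact: i22|exact: i00].
    rewrite -cintegralZ; [|exact: mray|apply: cintegrableB;
      [exact: mray|exact: i11|exact: i00]].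
    rewrite -cintegralB; [|exact: mray|apply: cintegrableB;
      [exact: mray|exact: i22|exact: i00]|apply: cintegrableZ; [exact: mray|
      apply: cintegrableB; [exact: mray|exact: i11|exact: i00]]].
    rewrite -cintegralD; [|exact: mray|exact: iD|]; last first.
      have := i00 _ y (T _ _ _ tp0 tp1 tp2).
      by apply: (eq_cintegrable (mray y)) => s _; rewrite -/(E z y s); ring.
    by apply: eq_cintegral => s _; rewrite /Dt /E; ring.
  - by apply: mulr_ge0; rewrite ?D1_ge0 ?D2_ge0.
  - by move=> y; rewrite cn0; apply: mulr_ge0; [apply: mulr_ge0;
      rewrite ?D1_ge0 ?D2_ge0|exact/ltW/W_gt0].
  - move=> y; apply: diff_term => //.
      by have := JB0_ge0; have := JB1_ge0; lra.
    move=> s sy; have [_ _ _ [g1 g2 g3]] := hE y s sy.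
    have Ws := ltW (W_gt0 s).
    rewrite /Dt; apply: le_trans (cnD _ _) _.
    apply: le_trans (lerD (cnD _ _) (lexx _)) _; rewrite cnN !cnM cni mul1r.
    have t1 := ler_pM (cn_ge0 _) (cn_ge0 _) g3 (b0 s).1.
    have t2 := ler_pM (cn_ge0 _) (cn_ge0 _) g2 (f2 s).1.
    have t3 := ler_pM (cn_ge0 _) (cn_ge0 _) g1 (f1 s).1.
    apply: le_trans (lerD (lerD t1 t2) t3) _.
    by rewrite le_eqVlt; apply/orP; left; apply/eqP; ring.
  - move=> y; apply: le_trans (cnB _ _) _; rewrite cnM cni mul1r.
    have := cnB (u2 y) (u0 y); have := cnB (u1 y) (u0 y).
    by have := (b0 y).1; have := (b1 y).1; have := (b2 y).1; lra.
  - move=> y; apply: le_trans (cnB _ _) _; rewrite cnM cni mul1r.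
    have := cnB (v2 y) (v0 y); have := cnB (v1 y) (v0 y).
    by have := (b0 y).2; have := (b1 y).2; have := (b2 y).2; lra.
move=> x; have Wx := ltW (W_gt0 x).
have B1 := JB1_ge0; have B2 := JB2_ge0; have B0 := JB0_ge0.
have g (b r : R) (y : C) : 0 <= r -> cn y <= b * r * oneDsqr x -> b <= JB0 + JB1 + JB2 ->
    cn y <= (JB0 + JB1 + JB2) * oneDsqr x * r.
  move=> r0 hy hb; apply: le_trans hy _; rewrite mulrAC ler_wpM2r// ler_wpM2r//.
have g0 (y : C) : cn y <= JB0 * oneDsqr x -> cn y <= (JB0 + JB1 + JB2) * oneDsqr x.
  by move=> hy; rewrite -[X in _ <= X]mulr1; apply: (g JB0); rewrite ?mulr1//; lra.
have w2 : 0 <= w ^+ 2 by rewrite exprn_ge0.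
split; split; [exact/g0/(b0 x).1|exact/g0/(b1 x).1|exact/g0/(b2 x).1|split|
  exact/g0/(b0 x).2|exact/g0/(b1 x).2|exact/g0/(b2 x).2|split].
- by apply: (g JB1) (f1 x).1 _ => //; lra.
- by apply: (g JB1) (f2 x).1 _ => //; lra.
- by apply: (g JB2) (second x).1 _ => //; lra.
- by apply: (g JB1) (f1 x).2 _ => //; lra.
- by apply: (g JB1) (f2 x).2 _ => //; lra.
- by apply: (g JB2) (second x).2 _ => //; lra.
Qed.

End JostProperties.

(** * The four Jost functions as one Volterra system *)

Section Uniqueness.
Context {R : realType}.
Local Notation C := R[i].
Local Notation C2 := 'cV[R[i]]_2.
Implicit Types (q p u v : R -> C) (z : C) (M N x s w : R).

Lemma ord2_1 : lift ord0 ord0 = 1 :> 'I_2. Proof. exact/val_inj. Qed.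

Lemma ord2P (P : 'I_2 -> Prop) : P 0 -> P 1 -> forall i, P i.
Proof.
move=> h0 h1 [[|[|//]] Hi].
- by rewrite (_ : Ordinal Hi = 0)//; exact/val_inj.
- by rewrite (_ : Ordinal Hi = 1)//; exact/val_inj.
Qed.

Lemma col2P (a b : C2) : a 0 0 = b 0 0 -> a 1 0 = b 1 0 -> a = b.
Proof. by move=> h0 h1; apply/colP; apply: ord2P. Qed.

Lemma sum2 (F : 'I_2 -> C) : \sum_j F j = F 0 + F 1.
Proof. by rewrite !big_ord_recl big_ord0 addr0 ord2_1. Qed.

(** The lower left entry of the matrix $\mathbf Q$. *)
Definition pQ (tau : C) q (s : R) : C := tau * (q s)^*.

Lemma Qv tau q s (r : C2) :
  (Qmx tau q s *m r) 0 0 = q s * r 1 0 /\ (Qmx tau q s *m r) 1 0 = pQ tau q s * r 0 0.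
Proof.
by rewrite /pQ !mxE !sum2 !mxE /= !(mulr0, mulr1, add0r, addr0, mul0r).
Qed.

Lemma diagv (a b : C) (r : C2) :
  (diag2 a b *m r) 0 0 = a * r 0 0 /\ (diag2 a b *m r) 1 0 = b * r 1 0.
Proof. by rewrite !mxE !sum2 !mxE /= !(add0r, addr0, mul0r). Qed.

Lemma kernel_entries a b tau q s (r : C2) :
  (diag2 a b *m Qmx tau q s *m r) 0 0 = a * (q s * r 1 0) /\
  (diag2 a b *m Qmx tau q s *m r) 1 0 = b * (pQ tau q s * r 0 0).
Proof.
have [q0 q1] := Qv tau q s r; have [d0 d1] := diagv a b (Qmx tau q s *m r).
by rewrite -mulmxA d0 d1 q0 q1.
Qed.

(** In contrast to [jsol] no continuity is required, to match the definition of
   the Jost functions as bounded solutions. *)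
Definition wsol q p z u v : Prop :=
  [/\ exists N, forall x, cn (u x) <= N /\ cn (v x) <= N,
    forall x, cintegrable `]-oo, x] (fun s => q s * v s),
    forall x, cintegrable `]-oo, x]
      (fun s => cexp ('i * z * (2 * (x - s))%:C) * (p s * u s)),
    forall x, u x = 1 + prim (fun s => q s * v s) x &
    forall x, v x = prim (fun s => cexp ('i * z * (2 * (x - s))%:C) * (p s * u s)) x].

Lemma jsol_wsol M q p z u v : pot M q -> pot M p -> 0 <= cIm z ->
  jsol q p z u v -> wsol q p z u v.
Proof.
move=> hq hp z0 h; split.
- exact: jsol_bounded h.
- by move=> x; apply/ltame_int/tame_ltame; exact: (jsol_tame_qv hq h).
- by move=> x; apply: jsol_kint => //; exact: (jsol_tame_pu hp h).
- by case: h.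
- exact: (jsol_v hp z0 h).
Qed.

Lemma wsol_uniq M q p z u v u' v' : 0 < M -> pot M q -> pot M p -> 0 <= cIm z ->
  wsol q p z u v -> wsol q p z u' v' -> forall x, u x = u' x /\ v x = v' x.
Proof.
move=> M0 hq hp z0 [[N hN] i1 i2 eu ev] [[N' hN'] i1' i2' eu' ev'] x.
have H : cn (u x - u' x) <= 2 * 0 * expR (4 * M * pi) * oneDsqr x /\
         cn (v x - v' x) <= 2 * 0 * expR (4 * M * pi) * oneDsqr x.
  apply: (gronwall (q := q) (p := p) (A := N + N') (u := fun x => u x - u' x)
    (v := fun x => v x - v' x) (E := fun x s => cexp ('i * z * (2 * (x - s))%:C))
    (F := fun=> 0) (G := fun=> 0)) => //.
  - exact: hq.2.
  - exact: hp.2.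
  - by move=> y s; exact: jsol_cnkern.
  - move=> y; apply: (eq_cintegrable (mray y)) (cintegrableB (mray y) (i1 y) (i1' y)).
    by move=> s _; rewrite mulrBr.
  - move=> y; apply: (eq_cintegrable (mray y)) (cintegrableB (mray y) (i2 y) (i2' y)).
    by move=> s _; rewrite -!mulrBr.
  - move=> y; rewrite add0r eu eu' opprD addrACA subrr add0r.
    rewrite /prim -(cintegralB (mray y) (i1 y) (i1' y)).
    by apply: eq_cintegral => s _; rewrite mulrBr.
  - move=> y; rewrite add0r ev ev' /prim -(cintegralB (mray y) (i2 y) (i2' y)).
    by apply: eq_cintegral => s _; rewrite -!mulrBr.
  - by move=> y; rewrite cn0 mul0r.
  - by move=> y; rewrite cn0 mul0r.
  - move=> y; apply: le_trans (cnB _ _) _.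
    apply: le_trans (lerD (hN y).1 (hN' y).1) _; apply: WgeC.
    by apply: addr_ge0; [apply: le_trans (hN y).1|apply: le_trans (hN' y).1]; exact: cn_ge0.
  - move=> y; apply: le_trans (cnB _ _) _.
    apply: le_trans (lerD (hN y).2 (hN' y).2) _; apply: WgeC.
    by apply: addr_ge0; [apply: le_trans (hN y).2|apply: le_trans (hN' y).2]; exact: cn_ge0.
move: H; rewrite mulr0 !mul0r => -[h1 h2].
have z_ (y : C) : cn y <= 0 -> y = 0.
  by move=> h; apply: cn_eq0; apply/eqP; rewrite eq_le h cn_ge0.
by split; apply/eqP; rewrite -subr_eq0; apply/eqP; exact: z_.
Qed.

Lemma vintegrable2 D (F : R -> C2) :
  vintegrable D F <-> cintegrable D (fun x => F x 0 0) /\ cintegrable D (fun x => F x 1 0).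
Proof. by split => [h|[h0 h1]]; [split; exact: h|exact: ord2P]. Qed.

Lemma bounded2 (r : R -> C2) :
  (exists M : R, forall x i, cn (r x i 0) <= M) <->
  (exists M : R, forall x, cn (r x 0 0) <= M /\ cn (r x 1 0) <= M).
Proof.
split=> -[M hM]; exists M => x; first by split; exact: hM.
by have [h0 h1] := hM x; apply: ord2P.
Qed.

(** Reflection $x \mapsto -x$ turns Volterra equations from $+\infty$ into
   equations from $-\infty$, and changes the sign of the potential. *)
Definition oppf (f : R -> C) (t : R) : C := - f (- t).

Lemma pot_oppf M q : pot M q -> pot M (oppf q).
Proof.
move=> [c h]; split; first exact/ccontN/ccont_opp.
by move=> s; rewrite /oppf cnN -om_opp.
Qed.

Section FourSolutions.
Variables (tau : C) (q : R -> C) (z : C).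
Local Notation p := (pQ tau q).

Lemma ker_r1m (x s : R) : cexp (2 * 'i * z * (x - s)%:C) = cexp ('i * z * (2 * (x - s))%:C).
Proof. by congr cexp; rewrite [(2 * _)%:C]rmorphM/=; ring. Qed.

Lemma ker_r1p (x s : R) :
  cexp (- (2 * 'i * z * (x - s)%:C)) = cexp ('i * - z * (2 * (x - s))%:C).
Proof. by congr cexp; rewrite [(2 * _)%:C]rmorphM/=; ring. Qed.

Lemma sol_r1m r : bounded_solution tau q e1 1 (fun x => `]-oo, x]%classic)
    (fun t => diag2 1 (cexp (2 * 'i * z * t%:C))) r <->
  wsol q p z (fun x => r x 0 0) (fun x => r x 1 0).
Proof.
rewrite /bounded_solution /wsol/= bounded2; split.
- move=> [hb h]; split => // x; have [/vintegrable2[i0 i1] e] := h x.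
  + move: i0; apply: (eq_cintegrable (mray x)) => s _.
    by rewrite (kernel_entries _ _ _ _ _ _).1 mul1r.
  + move: i1; apply: (eq_cintegrable (mray x)) => s _.
    by rewrite (kernel_entries _ _ _ _ _ _).2 ker_r1m.
  + rewrite [LHS](congr1 (fun c : C2 => c 0 0) e) !mxE /= mul1r; congr (_ + _).
    by apply: eq_cintegral => s _; rewrite (kernel_entries _ _ _ _ _ _).1 mul1r.
  + rewrite [LHS](congr1 (fun c : C2 => c 1 0) e) !mxE /= mul1r add0r.
    by apply: eq_cintegral => s _; rewrite (kernel_entries _ _ _ _ _ _).2 ker_r1m.
- move=> [hb i0 i1 eu ev]; split => // x; split.
    apply/vintegrable2; split.
    + move: (i0 x); apply: (eq_cintegrable (mray x)) => s _.
      by rewrite (kernel_entries _ _ _ _ _ _).1 mul1r.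
    + move: (i1 x); apply: (eq_cintegrable (mray x)) => s _.
      by rewrite (kernel_entries _ _ _ _ _ _).2 ker_r1m.
  apply: col2P.
  + rewrite eu !mxE /= mul1r; congr (_ + _).
    by apply: eq_cintegral => s _; rewrite (kernel_entries _ _ _ _ _ _).1 mul1r.
  + rewrite ev !mxE /= mul1r add0r.
    by apply: eq_cintegral => s _; rewrite (kernel_entries _ _ _ _ _ _).2 ker_r1m.
Qed.

(** Exchanging the two components exchanges $q$ with $p$ and $z$ with $-z$. *)
Lemma sol_r1p r : bounded_solution tau q e2 1 (fun x => `]-oo, x]%classic)
    (fun t => diag2 (cexp (- (2 * 'i * z * t%:C))) 1) r <->
  wsol p q (- z) (fun x => r x 1 0) (fun x => r x 0 0).
Proof.
rewrite /bounded_solution /wsol/= bounded2; split.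
- move=> [[N hb] h]; split => [|x|x|x|x]; [by exists N => x; have [] := hb x|..];
    have [/vintegrable2[i0 i1] e] := h x.
  + move: i1; apply: (eq_cintegrable (mray x)) => s _.
    by rewrite (kernel_entries _ _ _ _ _ _).2 mul1r.
  + move: i0; apply: (eq_cintegrable (mray x)) => s _.
    by rewrite (kernel_entries _ _ _ _ _ _).1 ker_r1p.
  + rewrite [LHS](congr1 (fun c : C2 => c 1 0) e) !mxE /= mul1r; congr (_ + _).
    by apply: eq_cintegral => s _; rewrite (kernel_entries _ _ _ _ _ _).2 mul1r.
  + rewrite [LHS](congr1 (fun c : C2 => c 0 0) e) !mxE /= mul1r add0r.
    by apply: eq_cintegral => s _; rewrite (kernel_entries _ _ _ _ _ _).1 ker_r1p.
- move=> [[N hb] i0 i1 eu ev]; split; first by exists N => x; have [] := hb x.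
  move=> x; split.
    apply/vintegrable2; split.
    + move: (i1 x); apply: (eq_cintegrable (mray x)) => s _.
      by rewrite (kernel_entries _ _ _ _ _ _).1 ker_r1p.
    + move: (i0 x); apply: (eq_cintegrable (mray x)) => s _.
      by rewrite (kernel_entries _ _ _ _ _ _).2 mul1r.
  apply: col2P.
  + rewrite ev !mxE /= mul1r add0r.
    by apply: eq_cintegral => s _; rewrite (kernel_entries _ _ _ _ _ _).1 ker_r1p.
  + rewrite eu !mxE /= mul1r; congr (_ + _).
    by apply: eq_cintegral => s _; rewrite (kernel_entries _ _ _ _ _ _).2 mul1r.
Qed.

Lemma right_int (h k : R -> C) (x : R) :
  (forall t, k t = - h (- t)) ->
  cintegrable `[x, +oo[ h <-> cintegrable `]-oo, (- x)] k.
Proof.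
move=> hk; split => hi.
- have [h1 _] := cintegral_rray hi.
  apply: (eq_cintegrable (mray (- x))) (cintegrableN (mray (- x)) h1) => t _.
  by rewrite hk.
- apply: cintegrable_rray.
  apply: (eq_cintegrable (mray (- x))) (cintegrableN (mray (- x)) hi) => t _.
  by rewrite hk opprK.
Qed.

Lemma right_intE (h k : R -> C) (x : R) :
  (forall t, k t = - h (- t)) -> cintegrable `[x, +oo[ h ->
  - cintegral `[x, +oo[ h = prim k (- x).
Proof.
move=> hk hi; have [h1 ->] := cintegral_rray hi.
rewrite /prim -(cintegralN (mray (- x)) h1).
by apply: eq_cintegral => t _; rewrite hk.
Qed.

(** Reflection, together with an exchange of the components. *)
Lemma sol_r2p r : bounded_solution tau q e2 (-1) (fun x => `[x, +oo[%classic)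
    (fun t => diag2 (cexp (- (2 * 'i * z * t%:C))) 1) r <->
  wsol (oppf p) (oppf q) z (fun y => r (- y) 1 0) (fun y => r (- y) 0 0).
Proof.
pose h0 (x s : R) : C := cexp (- (2 * 'i * z * (x - s)%:C)) * (q s * r s 1 0).
pose h1 (s : R) : C := p s * r s 0 0.
have k0 x t : cexp ('i * z * (2 * (- x - t))%:C) * (oppf q t * r (- t) 1 0) =
    - h0 x (- t).
  rewrite /h0 /oppf -mulrN mulNr; congr (cexp _ * _).
  by rewrite [(2 * _)%:C]rmorphM !rmorphB !rmorphN/=; ring.
have k1 t : oppf p t * r (- t) 0 0 = - h1 (- t) by rewrite /h1 /oppf mulNr.
rewrite /bounded_solution /wsol/= bounded2; split.
- move=> [[N hb] h].
  have H x : [/\ cintegrable `[x, +oo[ (h0 x), cintegrable `[x, +oo[ h1,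
      r x 0 0 = - cintegral `[x, +oo[ (h0 x) &
      r x 1 0 = 1 - cintegral `[x, +oo[ h1].
    have [/vintegrable2[i0 i1] e] := h x; split.
    + move: i0; apply: (eq_cintegrable (mrray x)) => s _.
      by rewrite (kernel_entries _ _ _ _ _ _).1.
    + move: i1; apply: (eq_cintegrable (mrray x)) => s _.
      by rewrite (kernel_entries _ _ _ _ _ _).2 mul1r.
    + rewrite [LHS](congr1 (fun c : C2 => c 0 0) e) !mxE /= mulN1r add0r; congr (- _).
      by apply: eq_cintegral => s _; rewrite (kernel_entries _ _ _ _ _ _).1.
    + rewrite [LHS](congr1 (fun c : C2 => c 1 0) e) !mxE /= mulN1r; congr (_ - _).
      by apply: eq_cintegral => s _; rewrite (kernel_entries _ _ _ _ _ _).2 mul1r.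
  split => [|y|y|y|y]; [by exists N => x; have [] := hb (- x)|..];
    have [i0 i1 e0 e1] := H (- y).
  + by move/(right_int _ k1) : i1; rewrite opprK.
  + have K t : cexp ('i * z * (2 * (y - t))%:C) * (oppf q t * r (- t) 1 0) =
      - h0 (- y) (- t) by rewrite -k0 opprK.
    by move/(right_int _ K) : i0; rewrite opprK.
  + by rewrite e1 (right_intE k1 i1) opprK.
  + have K t : cexp ('i * z * (2 * (y - t))%:C) * (oppf q t * r (- t) 1 0) =
      - h0 (- y) (- t) by rewrite -k0 opprK.
    by rewrite e0 (right_intE K i0) opprK.
- move=> [[N hb] i1 i0 eu ev].
  have j0 x : cintegrable `[x, +oo[ (h0 x).
    exact/(right_int x (k0 x)).
  have j1 x : cintegrable `[x, +oo[ h1 by exact/(right_int x k1).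
  split; first by exists N => x; have [] := hb (- x); rewrite opprK.
  move=> x; split.
    apply/vintegrable2; split.
    + move: (j0 x); apply: (eq_cintegrable (mrray x)) => s _.
      by rewrite (kernel_entries _ _ _ _ _ _).1.
    + move: (j1 x); apply: (eq_cintegrable (mrray x)) => s _.
      by rewrite (kernel_entries _ _ _ _ _ _).2 mul1r.
  apply: col2P.
  + have := ev (- x); rewrite opprK -(right_intE (k0 x) (j0 x)) => ->.
    rewrite !mxE /= mulN1r add0r; congr (- _).
    by apply: eq_cintegral => s _; rewrite (kernel_entries _ _ _ _ _ _).1.
  + have := eu (- x); rewrite opprK -(right_intE k1 (j1 x)) => ->.
    rewrite !mxE /= mulN1r; congr (_ - _).
    by apply: eq_cintegral => s _; rewrite (kernel_entries _ _ _ _ _ _).2 mul1r.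
Qed.

Lemma sol_r2m r : bounded_solution tau q e1 (-1) (fun x => `[x, +oo[%classic)
    (fun t => diag2 1 (cexp (2 * 'i * z * t%:C))) r <->
  wsol (oppf q) (oppf p) (- z) (fun y => r (- y) 0 0) (fun y => r (- y) 1 0).
Proof.
pose h1 (x s : R) : C := cexp (2 * 'i * z * (x - s)%:C) * (p s * r s 0 0).
pose h0 (s : R) : C := q s * r s 1 0.
have k1 x t : cexp ('i * - z * (2 * (- x - t))%:C) * (oppf p t * r (- t) 0 0) =
    - h1 x (- t).
  rewrite /h1 /oppf (_ : 'i * - z * (2 * (- x - t))%:C = 2 * 'i * z * (x - - t)%:C).
    by ring.
  by rewrite [(2 * _)%:C]rmorphM !rmorphB !rmorphN/=; ring.
have k0 t : oppf q t * r (- t) 1 0 = - h0 (- t) by rewrite /h0 /oppf mulNr.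
rewrite /bounded_solution /wsol/= bounded2; split.
- move=> [[N hb] h].
  have H x : [/\ cintegrable `[x, +oo[ (h1 x), cintegrable `[x, +oo[ h0,
      r x 1 0 = - cintegral `[x, +oo[ (h1 x) &
      r x 0 0 = 1 - cintegral `[x, +oo[ h0].
    have [/vintegrable2[i0 i1] e] := h x; split.
    + move: i1; apply: (eq_cintegrable (mrray x)) => s _.
      by rewrite (kernel_entries _ _ _ _ _ _).2.
    + move: i0; apply: (eq_cintegrable (mrray x)) => s _.
      by rewrite (kernel_entries _ _ _ _ _ _).1 mul1r.
    + rewrite [LHS](congr1 (fun c : C2 => c 1 0) e) !mxE /= mulN1r add0r; congr (- _).
      by apply: eq_cintegral => s _; rewrite (kernel_entries _ _ _ _ _ _).2.
    + rewrite [LHS](congr1 (fun c : C2 => c 0 0) e) !mxE /= mulN1r; congr (_ - _).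
      by apply: eq_cintegral => s _; rewrite (kernel_entries _ _ _ _ _ _).1 mul1r.
  split => [|y|y|y|y]; [by exists N => x; have [] := hb (- x)|..];
    have [i1 i0 e1 e0] := H (- y).
  + by move/(right_int _ k0) : i0; rewrite opprK.
  + have K t : cexp ('i * - z * (2 * (y - t))%:C) * (oppf p t * r (- t) 0 0) =
      - h1 (- y) (- t) by rewrite -k1 opprK.
    by move/(right_int _ K) : i1; rewrite opprK.
  + by rewrite e0 (right_intE k0 i0) opprK.
  + have K t : cexp ('i * - z * (2 * (y - t))%:C) * (oppf p t * r (- t) 0 0) =
      - h1 (- y) (- t) by rewrite -k1 opprK.
    by rewrite e1 (right_intE K i1) opprK.
- move=> [[N hb] i0 i1 eu ev].
  have j1 x : cintegrable `[x, +oo[ (h1 x).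
    exact/(right_int x (k1 x)).
  have j0 x : cintegrable `[x, +oo[ h0 by exact/(right_int x k0).
  split; first by exists N => x; have [] := hb (- x); rewrite opprK.
  move=> x; split.
    apply/vintegrable2; split.
    + move: (j0 x); apply: (eq_cintegrable (mrray x)) => s _.
      by rewrite (kernel_entries _ _ _ _ _ _).1 mul1r.
    + move: (j1 x); apply: (eq_cintegrable (mrray x)) => s _.
      by rewrite (kernel_entries _ _ _ _ _ _).2.
  apply: col2P.
  + have := eu (- x); rewrite opprK -(right_intE k0 (j0 x)) => ->.
    rewrite !mxE /= mulN1r; congr (_ - _).
    by apply: eq_cintegral => s _; rewrite (kernel_entries _ _ _ _ _ _).1 mul1r.
  + have := ev (- x); rewrite opprK -(right_intE (k1 x) (j1 x)) => ->.
    rewrite !mxE /= mulN1r add0r; congr (- _).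
    by apply: eq_cintegral => s _; rewrite (kernel_entries _ _ _ _ _ _).2.
Qed.

Variable M : R.
Hypotheses (M0 : 0 < M) (hq : pot M q) (hp : pot M p).

(** The choice in the definition is harmless: whatever holds for all bounded
   solutions holds for the chosen one, once a bounded solution exists. *)
Lemma ubs_ext e eps D K (P : (R -> C2) -> Prop) r0 :
  (forall r, bounded_solution tau q e eps D K r -> P r) ->
  bounded_solution tau q e eps D K r0 ->
  P (unique_bounded_solution tau q e eps D K).
Proof.
move=> h h0; rewrite /unique_bounded_solution; case: xgetP => [y -> hy|].
  exact: h.
by move=> /(_ r0).
Qed.

Definition vec2 (a b : C) : C2 := \col_i (if i == 0 then a else b).
Lemma vec2_0 a b : vec2 a b 0 0 = a. Proof. by rewrite mxE. Qed.
Lemma vec2_1 a b : vec2 a b 1 0 = b. Proof. by rewrite mxE. Qed.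

Lemma r1mE x : 0 <= cIm z ->
  r1m tau q x z 0 0 = jU q p z x /\ r1m tau q x z 1 0 = jV q p z x.
Proof.
move=> z0; have hw := jsol_wsol hq hp z0 (jostP M0 hq hp z0).
rewrite /r1m; move: x.
apply: (@ubs_ext _ _ _ _ (fun r => forall x, r x 0 0 = jU q p z x /\
  r x 1 0 = jV q p z x) (fun x => vec2 (jU q p z x) (jV q p z x))).
- by move=> r /sol_r1m hr x; exact: (wsol_uniq M0 hq hp z0 hr hw).
- apply/sol_r1m.
  by under eq_fun do rewrite vec2_0; under [X in wsol _ _ _ _ X]eq_fun do rewrite vec2_1.
Qed.

Lemma r1pE x : cIm z <= 0 ->
  r1p tau q x z 1 0 = jU p q (- z) x /\ r1p tau q x z 0 0 = jV p q (- z) x.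
Proof.
move=> z0; have z1 : 0 <= cIm (- z) by rewrite ImN oppr_ge0.
have hw := jsol_wsol hp hq z1 (jostP M0 hp hq z1).
rewrite /r1p; move: x.
apply: (@ubs_ext _ _ _ _ (fun r => forall x, r x 1 0 = jU p q (- z) x /\
  r x 0 0 = jV p q (- z) x) (fun x => vec2 (jV p q (- z) x) (jU p q (- z) x))).
- by move=> r /sol_r1p hr x; exact: (wsol_uniq M0 hp hq z1 hr hw).
- apply/sol_r1p.
  by under eq_fun do rewrite vec2_1; under [X in wsol _ _ _ _ X]eq_fun do rewrite vec2_0.
Qed.

Lemma r2pE x : 0 <= cIm z ->
  r2p tau q x z 1 0 = jU (oppf p) (oppf q) z (- x) /\
  r2p tau q x z 0 0 = jV (oppf p) (oppf q) z (- x).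
Proof.
move=> z0; have hq' := pot_oppf hq; have hp' := pot_oppf hp.
have hw := jsol_wsol hp' hq' z0 (jostP M0 hp' hq' z0).
rewrite /r2p; move: x.
apply: (@ubs_ext _ _ _ _ (fun r => forall x, r x 1 0 = jU (oppf p) (oppf q) z (- x) /\
  r x 0 0 = jV (oppf p) (oppf q) z (- x)) (fun x =>
    vec2 (jV (oppf p) (oppf q) z (- x)) (jU (oppf p) (oppf q) z (- x)))).
- move=> r /sol_r2p hr x; have := wsol_uniq M0 hp' hq' z0 hr hw (- x).
  by rewrite opprK.
- apply/sol_r2p.
  under eq_fun do rewrite vec2_1 opprK.
  by under [X in wsol _ _ _ _ X]eq_fun do rewrite vec2_0 opprK.
Qed.

Lemma r2mE x : cIm z <= 0 ->
  r2m tau q x z 0 0 = jU (oppf q) (oppf p) (- z) (- x) /\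
  r2m tau q x z 1 0 = jV (oppf q) (oppf p) (- z) (- x).
Proof.
move=> z0; have z1 : 0 <= cIm (- z) by rewrite ImN oppr_ge0.
have hq' := pot_oppf hq; have hp' := pot_oppf hp.
have hw := jsol_wsol hq' hp' z1 (jostP M0 hq' hp' z1).
rewrite /r2m; move: x.
apply: (@ubs_ext _ _ _ _ (fun r => forall x, r x 0 0 = jU (oppf q) (oppf p) (- z) (- x) /\
  r x 1 0 = jV (oppf q) (oppf p) (- z) (- x)) (fun x =>
    vec2 (jU (oppf q) (oppf p) (- z) (- x)) (jV (oppf q) (oppf p) (- z) (- x)))).
- move=> r /sol_r2m hr x; have := wsol_uniq M0 hq' hp' z1 hr hw (- x).
  by rewrite opprK.
- apply/sol_r2m.
  under eq_fun do rewrite vec2_0 opprK.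
  by under [X in wsol _ _ _ _ X]eq_fun do rewrite vec2_1 opprK.
Qed.

End FourSolutions.

End Uniqueness.

(** * Rapidly decreasing functions with finitely many derivatives *)

Section RapidDecay.
Context {R : realType}.
Local Notation C := R[i].
Implicit Types (f g : R -> C) (M N x s : R).

(** Decay of order six is enough for two integrations by parts of the resolvent. *)
Definition rapid0 f := exists M, pot M f.

Fixpoint rapid n f : Prop :=
  if n is n'.+1 then
    rapid0 f /\ exists2 g, (forall x, cder f x (g x)) & rapid n' g
  else rapid0 f.

Lemma rapid_rapid0 n f : rapid n f -> rapid0 f.
Proof. by case: n => [|n] //= []. Qed.

Lemma rapidW n f : rapid n.+1 f -> rapid n f.
Proof.
elim: n f => [|n IH] f; first by case.
by move=> [h [g dg /IH hg]]; split => //; exists g.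
Qed.

Lemma pot_mono M N f : M <= N -> pot M f -> pot N f.
Proof.
move=> MN [c h]; split => // s; apply: le_trans (h s) _.
by rewrite ler_wpM2r// exprn_ge0// om_ge0.
Qed.

Lemma rapid0D f g : rapid0 f -> rapid0 g -> rapid0 (fun s => f s + g s).
Proof.
move=> [M [cf hf]] [N [cg hg]]; exists (M + N); split; first exact: ccontD.
by move=> s; apply: le_trans (cnD _ _) _; rewrite mulrDl lerD.
Qed.

Lemma rapid0M f g : rapid0 f -> rapid0 g -> rapid0 (fun s => f s * g s).
Proof.
move=> [M hf] [N hg]; have M0 := pot_ge0 hf; have N0 := pot_ge0 hg.
exists (M * N); split; first by apply: ccontM; [case: hf|case: hg].
move=> s; rewrite cnM.
apply: le_trans (ler_pM (cn_ge0 _) (cn_ge0 _) (hf.2 s) (hg.2 s)) _.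
rewrite mulrACA; apply: ler_wpM2l; first exact: mulr_ge0.
have o0 := om_ge0 s; rewrite -[X in _ <= X]mulr1 ler_wpM2l ?exprn_ge0//.
by rewrite exprn_ile1// om_le1.
Qed.

Lemma rapid0Z (c : C) f : rapid0 f -> rapid0 (fun s => c * f s).
Proof.
move=> [M [cf hf]]; exists (cn c * M); split; first exact: ccontZ.
by move=> s; rewrite cnM -mulrA ler_wpM2l ?cn_ge0.
Qed.

Lemma rapid0_opp f : rapid0 f -> rapid0 (fun s => f (- s)).
Proof.
move=> [M [cf hf]]; exists M; split; first exact: ccont_opp.
by move=> s; rewrite -om_opp.
Qed.

Lemma rapidD n f g : rapid n f -> rapid n g -> rapid n (fun s => f s + g s).
Proof.
elim: n f g => [|n IH] f g; first exact: rapid0D.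
move=> [hf [f' df hf']] [hg [g' dg hg']]; split; first exact: rapid0D.
by exists (fun s => f' s + g' s); [move=> x; exact: cderD|exact: IH].
Qed.

Lemma rapidZ n (c : C) f : rapid n f -> rapid n (fun s => c * f s).
Proof.
elim: n f => [|n IH] f; first exact: rapid0Z.
move=> [hf [f' df hf']]; split; first exact: rapid0Z.
by exists (fun s => c * f' s); [move=> x; exact: cderZ|exact: IH].
Qed.

Lemma rapid_ext n f g : (forall s, f s = g s) -> rapid n f -> rapid n g.
Proof. by move=> /funext ->. Qed.

Lemma rapidN n f : rapid n f -> rapid n (fun s => - f s).
Proof. by move=> /(rapidZ (-1)); apply: rapid_ext => s; rewrite mulN1r. Qed.

Lemma rapidM n f g : rapid n f -> rapid n g -> rapid n (fun s => f s * g s).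
Proof.
elim: n f g => [|n IH] f g; first exact: rapid0M.
move=> Hf Hg; have := rapidW Hf; have := rapidW Hg.
move: Hf Hg => [hf [f' df hf']] [hg [g' dg hg']] gn fn; split; first exact: rapid0M.
exists (fun s => f' s * g s + f s * g' s); first by move=> x; exact: cderM.
by apply: rapidD; exact: IH.
Qed.

Lemma rapid_tame n f : rapid n f -> tame f.
Proof. by move=> /rapid_rapid0[M]; exact: pot_tame. Qed.

Lemma rapid_pot n f : rapid n f -> exists2 M, 0 < M & pot M f.
Proof.
move=> /rapid_rapid0[M h]; exists (M + 1); last by apply: pot_mono h; rewrite lerDl.
by rewrite ltr_pwDr// (pot_ge0 h).
Qed.

Lemma schwartz_om (g : R -> R) : schwartz g -> forall n,
  exists M : R, forall s, `|(g^`(n))%classic s| <= M * om s ^+ 3.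
Proof.
move=> [_ hb] n.
have [M0 h0] := hb 0%N n; have [M2 h2] := hb 2%N n.
have [M4 h4] := hb 4%N n; have [M6 h6] := hb 6%N n.
(* The expansion of $(1 + s^2)^3$. *)
exists (M0 + 3 * M2 + 3 * M4 + M6) => s.
rewrite /om exprVn ler_pdivlMr ?exprn_gt0 ?W_gt0//.
have := h0 s; have := h2 s; have := h4 s; have := h6 s.
have nx k (y : R) : `|s ^+ k * y| = `|s| ^+ k * `|y| by rewrite normrM normrX.
rewrite !nx expr0 mul1r.
have e2 : `|s| ^+ 2 = s ^+ 2 by rewrite -normrX ger0_norm// sqr_ge0.
rewrite (_ : `|s| ^+ 6 = (s ^+ 2) ^+ 3); last by rewrite -e2 -exprM.
rewrite (_ : `|s| ^+ 4 = (s ^+ 2) ^+ 2); last by rewrite -e2 -exprM.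
rewrite e2 WE; set y := `|_|; set t := s ^+ 2.
rewrite (_ : y * (1 + t) ^+ 3 = y + 3 * (t * y) + 3 * (t ^+ 2 * y) + t ^+ 3 * y);
  last by ring.
lra.
Qed.

Lemma cschwartz_rapid n (h : R -> C) : cschwartz h -> rapid n h.
Proof.
move=> [hr hi].
pose D k (x : R) : C := ((cRe \o h)^`(k))%classic x +i* ((cIm \o h)^`(k))%classic x.
have dD k x : cder (D k) x (D k.+1 x).
  split => /=.
  - have /derivableP := hr.1 k x; rewrite -derive1E -derive1nS => d.
    exact: d.
  - have /derivableP := hi.1 k x; rewrite -derive1E -derive1nS => d.
    exact: d.
have r0 k : rapid0 (D k).
  have [M hM] := schwartz_om hr k; have [N hN] := schwartz_om hi k.
  exists (M + N); split; first exact: cder_cont (dD k).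
  by move=> s; apply: le_trans (cn_le _) _; rewrite mulrDl lerD//=.
have rn m k : rapid m (D k).
  elim: m k => [|m IH] k; first exact: r0.
  by split; [exact: r0|exists (D k.+1) => //; exact: IH].
have := rn n 0%N; apply: rapid_ext => s.
by rewrite /D /=; case: (h s).
Qed.

Lemma conj_rapid0 f : rapid0 f -> rapid0 (fun s => (f s)^*).
Proof.
move=> [M [[c1 c2] h]]; exists M; split.
  split => x.
  - rewrite (_ : _ \o _ = cRe \o f); first exact: c1.
    by apply/funext => s /=; case: (f s).
  - rewrite (_ : _ \o _ = fun s => - cIm (f s)); first by apply: cvgN; exact: c2.
    by apply/funext => s /=; case: (f s).
by move=> s; apply: le_trans (h s); rewrite !cnE; case: (f s) => a b /=; rewrite sqrrN.
Qed.

Lemma conj_rapid n (tau : C) f : rapid n f -> rapid n (pQ tau f).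
Proof.
rewrite /pQ => h; apply: rapidZ; elim: n f h => [|n IH] f; first exact: conj_rapid0.
move=> [/conj_rapid0 h0 [g dg hg]].
split => //; exists (fun s => (g s)^*); last exact: IH.
move=> x; have [d1 d2] := dg x; split.
- rewrite (_ : _ \o _ = cRe \o f); last by apply/funext => s /=; case: (f s).
  by refine (is_derive_eq d1 _); case: (g x).
- rewrite (_ : _ \o _ = fun s => 0 - cIm (f s)); last first.
    by apply/funext => s /=; rewrite sub0r; case: (f s).
  refine (is_derive_eq (is_derive_rB (is_derive_cst 0 x 1) d2) _).
  by rewrite sub0r; case: (g x).
Qed.

End RapidDecay.

(** * The resolvent kernel *)

Section Resolvent.
Context {R : realType}.
Local Notation C := R[i].
Implicit Types (q p f g y : R -> C) (z : C) (M N x s w : R).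

Definition opp1 f (t : R) : C := f (- t).

(** The entries of the Jost function at $+\infty$, reflected: [Ut] at $-x$ is the
   second and [Vt] at $-x$ the first component of $\mathbf r_{2,+}(x)$. *)
Definition Ut q p z := jU (oppf p) (oppf q) z.
Definition Vt q p z := jV (oppf p) (oppf q) z.
(** The determinant of the two Jost functions, that is $a(z)$. *)
Definition aco q p z : C := jU q p z 0 * Ut q p z 0 - jV q p z 0 * Vt q p z 0.
Definition Jin q p z f1 f2 s : C := - jV q p z s * f1 s + jU q p z s * f2 s.
Definition J q p z f1 f2 x : C := Kop (- ('i * z)) (Jin q p z f1 f2) x.
(** The two components of the bounded solution of
   $y' = (-iz\sigma_3 + Q) y + (f_1, f_2)^T$ by variation of constants:
   $y = (T - z)^{-1} i\sigma_3 f$ with $T$ the operator of the theorem. The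
   integral over the right half-line is the reflection of one over a left
   half-line. *)
Definition S1 q p z f1 f2 x : C := (aco q p z)^-1 *
  (Vt q p z (- x) * J q p z f1 f2 x -
   jU q p z x * J (oppf p) (oppf q) z (opp1 f2) (opp1 f1) (- x)).
Definition S2 q p z f1 f2 x : C := (aco q p z)^-1 *
  (Ut q p z (- x) * J q p z f1 f2 x -
   jV q p z x * J (oppf p) (oppf q) z (opp1 f2) (opp1 f1) (- x)).

Lemma ik_ge0 z : 0 <= cIm z -> 0 <= cRe (- ('i * z)).
Proof. by rewrite ReN (ReM 'i) Rei Imi mul0r mul1r sub0r opprK. Qed.

Variables (M : R) (q p : R -> C).
Hypotheses (M0 : 0 < M) (hq : pot M q) (hp : pot M p).

Let hq' := pot_oppf hq.
Let hp' := pot_oppf hp.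

Section FixedParameter.
Variable z : C.
Hypothesis z0 : 0 <= cIm z.

Let js := jostP M0 hq hp z0.
Let jt := jostP M0 hp' hq' z0.

Lemma Jin_tame f1 f2 : tame f1 -> tame f2 -> tame (Jin q p z f1 f2).
Proof.
move=> t1 t2; case: js => cu cv [N hN] _ _; apply: tameD.
- apply: (tameM (B := N)) => //; first exact: ccontN.
  by move=> s; rewrite cnN; exact: (hN s).2.
- by apply: (tameM (B := N)) => // s; exact: (hN s).1.
Qed.

Lemma Ut_der x : cder (fun t => Ut q p z (- t)) x (p x * Vt q p z (- x)).
Proof.
apply: cder_eq (cder_opp (jsol_du hp' jt (- x))) _.
by rewrite /oppf opprK /Vt; ring.
Qed.

Lemma Vt_der x : cder (fun t => Vt q p z (- t)) x
  (- (2 * 'i * z) * Vt q p z (- x) + q x * Ut q p z (- x)).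
Proof.
apply: cder_eq (cder_opp (jsol_dv hq' z0 jt (- x))) _.
by rewrite /oppf opprK /Vt /Ut; ring.
Qed.

Lemma aco_cst x : jU q p z x * Ut q p z (- x) - jV q p z x * Vt q p z (- x) = aco q p z.
Proof.
have h t : cder (fun x => jU q p z x * Ut q p z (- x) - jV q p z x * Vt q p z (- x)) t 0.
  apply: cder_eq (cderB (cderM (jsol_du hq js t) (Ut_der t))
    (cderM (jsol_dv hp z0 js t) (Vt_der t))) _.
  by ring.
by have := cder0_cst h x 0; rewrite oppr0.
Qed.

(** The derivative of $-n_1 y_1 + n_0 y_2$, where $n$ is the Jost solution at
   $-\infty$, is the integrand on the left up to an exponential factor, because $n$
   satisfies the homogeneous equation. *)
Lemma J_ibp y1 y2 d1 d2 : (forall x, cder y1 x (d1 x)) -> (forall x, cder y2 x (d2 x)) ->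
  tame y1 -> tame y2 -> tame d1 -> tame d2 -> forall x,
  J q p z (fun s => d1 s + 'i * z * y1 s - q s * y2 s)
          (fun s => d2 s - 'i * z * y2 s - p s * y1 s) x =
  - jV q p z x * y1 x + jU q p z x * y2 x.
Proof.
move=> h1 h2 t1 t2 t1' t2' x; symmetry.
case: (js) => cu cv [N hN] _ _.
have tq : tame q := pot_tame hq; have tp : tame p := pot_tame hp.
apply: (@Kop_uniq _ _ _ (fun x => - jV q p z x * y1 x + jU q p z x * y2 x)).
- exact: ik_ge0.
- apply: tame_ltame; apply: Jin_tame.
  + by apply: tameB; [apply: tameD => //; exact: tameZ|exact: tame_mul].
  + by apply: tameB; [apply: tameB => //; exact: tameZ|exact: tame_mul].
- apply: vanD; apply: vanM.
  + by move=> X; exists N => s _; rewrite cnN; exact: (hN s).2.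
  + exact/ltame_van/tame_ltame.
  + by move=> X; exists N => s _; exact: (hN s).1.
  + exact/ltame_van/tame_ltame.
- move=> t; apply: cder_eq (cderD (cderM (cderN (jsol_dv hp z0 js t)) (h1 t))
    (cderM (jsol_du hq js t) (h2 t))) _.
  by rewrite /Jin; ring.
Qed.

End FixedParameter.

End Resolvent.

(** * Bounded holomorphic functions on the closed upper half-plane *)

Section HolomorphicFamilies.
Context {R : realType}.
Local Notation C := R[i].
Implicit Types (z : C) (B w : R).

(** Boundedness is part of the definition, through the first three inequalities of
   the triple. *)
Definition hol (g : C -> C) : Prop := exists B, forall z w, 0 <= cIm z ->
  0 < w -> w <= 1 -> hol3 B w (g z) (g (zr z w)) (g (zi z w)).

Lemma zr_ge0 z w : 0 <= cIm z -> 0 <= cIm (zr z w).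
Proof. by rewrite ImD ImR addr0. Qed.

Lemma zi_ge0 z w : 0 <= cIm z -> 0 <= w -> 0 <= cIm (zi z w).
Proof. by move=> z0 w0; rewrite ImD (ImM 'i) Rei Imi ReR mul0r mul1r add0r addr_ge0. Qed.

Lemma hol_cst (c : C) : hol (fun=> c).
Proof. by exists (cn c) => z w _ w0 _; apply: hol3_cst; exact: ltW. Qed.

Lemma holD f g : hol f -> hol g -> hol (fun z => f z + g z).
Proof.
move=> [B hB] [D hD]; exists (B + D) => z w z0 w0 w1.
by apply: hol3D; [exact: hB|exact: hD].
Qed.

Lemma holM f g : hol f -> hol g -> hol (fun z => f z * g z).
Proof.
move=> [B hB] [D hD]; exists (4 * (B * D)) => z w z0 w0 w1.
by apply: hol3M; [exact: ltW|exact: hB|exact: hD].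
Qed.

Lemma hol_ext f g : (forall z, f z = g z) -> hol f -> hol g.
Proof. by move=> /funext ->. Qed.

Lemma holN f : hol f -> hol (fun z => - f z).
Proof. by move=> /(holM (hol_cst (-1))); apply: hol_ext => z; rewrite mulN1r. Qed.

Lemma holB f g : hol f -> hol g -> hol (fun z => f z - g z).
Proof. by move=> hf hg; apply: holD => //; exact: holN. Qed.

Lemma holV f (d : R) : 0 < d -> (forall z, 0 <= cIm z -> d <= cn (f z)) ->
  hol f -> hol (fun z => (f z)^-1).
Proof.
move=> d0 hd [B hB]; exists (d^-1 + B * d^-1 ^+ 2 + 2 * (B ^+ 2 * d^-1 ^+ 3)).
move=> z w z0 w0 w1; apply: hol3V => //; first exact: ltW.
- exact: hd.
- by apply: hd; exact: zr_ge0.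
- by apply: hd; apply: zi_ge0 => //; exact: ltW.
- exact: hB.
Qed.

Lemma hol_bounded f : hol f -> exists2 B, 0 <= B & forall z, 0 <= cIm z -> cn (f z) <= B.
Proof.
move=> [B hB]; exists B.
  by apply: (@hol3_ge0 _ B 1 _ _ _ (hB 0 1 _ _ _)).
by move=> z z0; have [] := hB z 1 z0 ltr01 (lexx _).
Qed.

End HolomorphicFamilies.

(** * Linearity, integration by parts and holomorphy of the resolvent *)

Section ResolventProperties.
Context {R : realType}.
Local Notation C := R[i].
Implicit Types (q p f g y : R -> C) (z : C) (N x s w : R).

Lemma opp1_tame f : tame f -> tame (opp1 f).
Proof. exact: tame_opp. Qed.

Section WithPotential.
Variables (M : R) (q p : R -> C).
Hypotheses (M0 : 0 < M) (hq : pot M q) (hp : pot M p).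

Lemma J_lin z (c : C) f1 f2 g1 g2 x : 0 <= cIm z ->
  tame f1 -> tame f2 -> tame g1 -> tame g2 ->
  J q p z (fun s => c * f1 s + g1 s) (fun s => c * f2 s + g2 s) x =
  c * J q p z f1 f2 x + J q p z g1 g2 x.
Proof.
move=> z0 tf1 tf2 tg1 tg2; have k0 := ik_ge0 z0.
have tf := tame_ltame (Jin_tame M0 hq hp z0 tf1 tf2).
have tg := tame_ltame (Jin_tame M0 hq hp z0 tg1 tg2).
have tcf : ltame (fun s => c * Jin q p z f1 f2 s).
  by apply: tame_ltame; apply: tameZ; exact: (Jin_tame M0 hq hp z0 tf1 tf2).
have tNg : ltame (fun s => - Jin q p z g1 g2 s).
  by apply: tame_ltame; apply: tameN; exact: (Jin_tame M0 hq hp z0 tg1 tg2).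
rewrite /J (_ : Jin q p z _ _ = fun s => c * Jin q p z f1 f2 s -
    - Jin q p z g1 g2 s); last first.
  by apply/funext => s; rewrite /Jin; ring.
rewrite KopB// KopZ//; congr (_ + _).
rewrite (_ : (fun s => - Jin q p z g1 g2 s) = fun s => (-1) * Jin q p z g1 g2 s).
  by rewrite KopZ// mulN1r opprK.
by apply/funext => s; rewrite mulN1r.
Qed.

Lemma jU_hol x : hol (fun z => jU q p z x).
Proof.
exists ((JB0 M + JB1 M + JB2 M) * oneDsqr x) => z w z0 w0 w1.
have [h _] := jsol_hol3 M0 hq hp z0 (ltW w0) (jostP M0 hq hp z0)
  (jostP M0 hq hp (zr_ge0 w z0)) (jostP M0 hq hp (zi_ge0 z0 (ltW w0))) x.
exact: h.
Qed.

Lemma jV_hol x : hol (fun z => jV q p z x).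
Proof.
exists ((JB0 M + JB1 M + JB2 M) * oneDsqr x) => z w z0 w0 w1.
have [_ h] := jsol_hol3 M0 hq hp z0 (ltW w0) (jostP M0 hq hp z0)
  (jostP M0 hq hp (zr_ge0 w z0)) (jostP M0 hq hp (zi_ge0 z0 (ltW w0))) x.
exact: h.
Qed.

Lemma JE z f1 f2 x : 0 <= cIm z -> tame f1 -> tame f2 ->
  cintegrable `]-oo, x] (fun s => cexp ('i * z * (1 * (x - s))%:C) * Jin q p z f1 f2 s)
  /\ J q p z f1 f2 x =
     prim (fun s => cexp ('i * z * (1 * (x - s))%:C) * Jin q p z f1 f2 s) x.
Proof.
move=> z0 t1 t2; have k0 := ik_ge0 z0.
have tf := tame_ltame (Jin_tame M0 hq hp z0 t1 t2).
have e s : cexp (- (- ('i * z) * (x - s)%:C)) = cexp ('i * z * (1 * (x - s))%:C).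
  by rewrite mul1r mulNr opprK.
split.
  by apply: (eq_cintegrable (mray x)) (kern_int x k0 tf) => s _; rewrite e.
by rewrite /J KopE//; apply: eq_cintegral => s _; rewrite e.
Qed.

(** Decay of the sources pays for the weights of the kernel and of the Jost
   solution. *)
Lemma J_hol f1 f2 x : rapid0 f1 -> rapid0 f2 -> hol (fun z => J q p z f1 f2 x).
Proof.
move=> [N1 h1] [N2 h2].
pose B := JB0 M + JB1 M + JB2 M.
pose N := N1 + N2; have N10 := pot_ge0 h1; have N20 := pot_ge0 h2.
have N0 : 0 <= N by rewrite addr_ge0.
have B0 : 0 <= B.
  by rewrite /B; have := JB0_ge0 M; have := JB1_ge0 M0; have := JB2_ge0 M0; lra.
have n1 s : cn (f1 s) <= N * om s ^+ 3.
  by apply: le_trans (h1.2 s) _; rewrite ler_wpM2r ?exprn_ge0 ?om_ge0// lerDl.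
have n2 s : cn (f2 s) <= N * om s ^+ 3.
  by apply: le_trans (h2.2 s) _; rewrite ler_wpM2r ?exprn_ge0 ?om_ge0// lerDr.
pose K := 4 * (54 * (8 * (B * N))) * oneDsqr x.
exists (2 * (K * pi)) => z w z0 w0 w1; have w0' := ltW w0.
have z10 := zr_ge0 w z0; have z20 := zi_ge0 z0 w0'.
have t1 := pot_tame h1; have t2 := pot_tame h2.
have [i0 ->] := JE x z0 t1 t2.
have [i1 ->] := JE x z10 t1 t2.
have [i2 ->] := JE x z20 t1 t2.
apply: hol3_prim => // s sx.
have Hk : hol3 (54 * (oneDsqr x * oneDsqr s)) w (cexp ('i * z * (1 * (x - s))%:C))
    (cexp ('i * zr z w * (1 * (x - s))%:C)) (cexp ('i * zi z w * (1 * (x - s))%:C)).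
  by apply: hol3_kern => //; rewrite ler01 ler1n.
have [hU hV] := jsol_hol3 M0 hq hp z0 w0' (jostP M0 hq hp z0)
  (jostP M0 hq hp z10) (jostP M0 hq hp z20) s.
have e1 := hol3Z (- f1 s) w0' hV.
have e2 := hol3Z (f2 s) w0' hU.
have Hs : hol3 (8 * (N * om s ^+ 3 * (B * oneDsqr s))) w (Jin q p z f1 f2 s)
    (Jin q p (zr z w) f1 f2 s) (Jin q p (zi z w) f1 f2 s).
  have e3 := hol3D e1 e2.
  have J3 z' : - f1 s * jV q p z' s + f2 s * jU q p z' s = Jin q p z' f1 f2 s.
    by rewrite /Jin; ring.
  rewrite -!J3; apply: hol3_mono e3 => //.
  have BW : 0 <= B * oneDsqr s by apply: mulr_ge0 => //; exact/ltW/W_gt0.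
  rewrite cnN -/B.
  have a1 := ler_wpM2r BW (n1 s); have a2 := ler_wpM2r BW (n2 s).
  lra.
apply: hol3_mono (hol3M w0' Hk Hs) => //.
rewrite (_ : 4 * (_ * _) = K * (om s ^+ 3 * oneDsqr s * oneDsqr s)).
  by rewrite om3W2.
by rewrite /K; ring.
Qed.

End WithPotential.

Variables (M : R) (q p : R -> C).
Hypotheses (M0 : 0 < M) (hq : pot M q) (hp : pot M p).

Let hq' := pot_oppf hq.
Let hp' := pot_oppf hp.

Lemma aco_hol : hol (aco q p).
Proof.
apply: holB; apply: holM.
- exact: (jU_hol M0 hq hp).
- exact: (jU_hol M0 hp' hq').
- exact: (jV_hol M0 hq hp).
- exact: (jV_hol M0 hp' hq').
Qed.

Lemma S_lin z (c : C) f1 f2 g1 g2 x : 0 <= cIm z ->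
  tame f1 -> tame f2 -> tame g1 -> tame g2 ->
  S1 q p z (fun s => c * f1 s + g1 s) (fun s => c * f2 s + g2 s) x =
    c * S1 q p z f1 f2 x + S1 q p z g1 g2 x /\
  S2 q p z (fun s => c * f1 s + g1 s) (fun s => c * f2 s + g2 s) x =
    c * S2 q p z f1 f2 x + S2 q p z g1 g2 x.
Proof.
move=> z0 tf1 tf2 tg1 tg2; rewrite /S1 /S2 (J_lin M0 hq hp)//.
have := J_lin M0 hp' hq' c (- x) z0 (opp1_tame tf2) (opp1_tame tf1)
  (opp1_tame tg2) (opp1_tame tg1).
rewrite /opp1 => ->; split; ring.
Qed.

(** The left and right integrals contribute $-n_1 y_1 + n_0 y_2$ and its
   counterpart for the other Jost solution; Cramer's rule recovers $y$. *)
Lemma S_ibp z y1 y2 d1 d2 : 0 <= cIm z -> aco q p z <> 0 ->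
  (forall x, cder y1 x (d1 x)) -> (forall x, cder y2 x (d2 x)) ->
  tame y1 -> tame y2 -> tame d1 -> tame d2 -> forall x,
  S1 q p z (fun s => d1 s + 'i * z * y1 s - q s * y2 s)
           (fun s => d2 s - 'i * z * y2 s - p s * y1 s) x = y1 x /\
  S2 q p z (fun s => d1 s + 'i * z * y1 s - q s * y2 s)
           (fun s => d2 s - 'i * z * y2 s - p s * y1 s) x = y2 x.
Proof.
move=> z0 a0 h1 h2 t1 t2 t1' t2' x.
have k1 t : cder (fun s => y2 (- s)) t (- d2 (- t)) by exact: cder_opp.
have k2 t : cder (fun s => y1 (- s)) t (- d1 (- t)) by exact: cder_opp.
have E1 := J_ibp M0 hq hp z0 h1 h2 t1 t2 t1' t2' x.
have E2 := J_ibp M0 hp' hq' z0 k1 k2 (tame_opp t2) (tame_opp t1)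
  (tameN (tame_opp t2')) (tameN (tame_opp t1')) (- x).
pose f1 s := d1 s + 'i * z * y1 s - q s * y2 s.
pose f2 s := d2 s - 'i * z * y2 s - p s * y1 s.
have tz0 : tame (fun=> 0 : C).
  have := tameZ 0 t1; rewrite (_ : (fun s => _) = fun=> 0)//.
  by apply/funext => s; rewrite mul0r.
have tq : tame q := pot_tame hq; have tp : tame p := pot_tame hp.
have tf1 : tame f1.
  by apply: tameB; [apply: tameD => //; exact: tameZ|exact: tame_mul].
have tf2 : tame f2.
  by apply: tameB; [apply: tameB => //; exact: tameZ|exact: tame_mul].
have E3 : J (oppf p) (oppf q) z (opp1 f2) (opp1 f1) (- x) =
    Vt q p z (- x) * y2 x - Ut q p z (- x) * y1 x.
  have L := J_lin M0 hp' hq' (-1) (- x) z0 (opp1_tame tf2) (opp1_tame tf1)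
    tz0 tz0.
  have Z := J_lin M0 hp' hq' (-1) (- x) z0 tz0 tz0 tz0 tz0.
  have e0 : J (oppf p) (oppf q) z (fun=> 0) (fun=> 0) (- x) = 0.
    move: Z; rewrite (_ : (fun s : R => _) = fun=> 0); last first.
      by apply/funext => s; rewrite mulr0 addr0.
    by rewrite mulN1r addNr.
  rewrite e0 addr0 mulN1r in L.
  rewrite -[LHS]opprK -L.
  have q2 s : -1 * opp1 f2 s + 0 = - d2 (- s) + 'i * z * y2 (- s) - oppf p s * y1 (- s).
    by rewrite /opp1 /f2 /oppf; ring.
  have q1 s : -1 * opp1 f1 s + 0 = - d1 (- s) - 'i * z * y1 (- s) - oppf q s * y2 (- s).
    by rewrite /opp1 /f1 /oppf; ring.
  by rewrite (funext q1) (funext q2) E2 /Vt /Ut !opprK; ring.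
have ac := aco_cst M0 hq hp z0 x.
have a0' : aco q p z != 0 by apply/eqP.
rewrite /S1 /S2 -/f1 -/f2 E3 E1.
split; apply: (mulfI a0'); rewrite mulrA mulfV// mul1r -ac; ring.
Qed.

(** One integration by parts: the resolvent applied to $g$ equals a multiple of
   $(g_1, -g_2)/(z+i)$ plus $1/(z+i)$ times the resolvent of a first-order expression
   in $g$. The factor $z + i$ in place of $z$ does not vanish on the closed upper
   half-plane. *)
Lemma S_step z g1 g2 d1 d2 : 0 <= cIm z -> aco q p z <> 0 ->
  (forall x, cder g1 x (d1 x)) -> (forall x, cder g2 x (d2 x)) ->
  tame g1 -> tame g2 -> tame d1 -> tame d2 ->
  tame (fun s => d1 s + g1 s + q s * g2 s) ->
  tame (fun s => - d2 s + g2 s - p s * g1 s) -> forall x,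
  'i * (z + 'i) * S1 q p z g1 g2 x +
    S1 q p z (fun s => d1 s + g1 s + q s * g2 s)
             (fun s => - d2 s + g2 s - p s * g1 s) x = g1 x /\
  'i * (z + 'i) * S2 q p z g1 g2 x +
    S2 q p z (fun s => d1 s + g1 s + q s * g2 s)
             (fun s => - d2 s + g2 s - p s * g1 s) x = - g2 x.
Proof.
move=> z0 a0 h1 h2 t1 t2 t1' t2' n1 n2 x.
have [L1 L2] := S_lin ('i * (z + 'i)) x z0 t1 t2 n1 n2.
rewrite -L1 -L2.
have := S_ibp z0 a0 h1 (fun x => cderN (h2 x)) t1 (tameN t2) t1' (tameN t2') x.
have e1 s : 'i * (z + 'i) * g1 s + (d1 s + g1 s + q s * g2 s) =
    d1 s + 'i * z * g1 s - q s * - g2 s.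
  by rewrite mulrDr mulrDl ii; ring.
have e2 s : 'i * (z + 'i) * g2 s + (- d2 s + g2 s - p s * g1 s) =
    - d2 s - 'i * z * - g2 s - p s * g1 s.
  by rewrite mulrDr mulrDl ii; ring.
by rewrite (funext e1) (funext e2).
Qed.

Lemma S1_hol f1 f2 x (d : R) : 0 < d -> (forall z, 0 <= cIm z -> d <= cn (aco q p z)) ->
  rapid0 f1 -> rapid0 f2 -> hol (fun z => S1 q p z f1 f2 x).
Proof.
move=> d0 hd h1 h2; apply: holM; first exact: (holV d0 hd aco_hol).
apply: holB; apply: holM.
- exact: (jV_hol M0 hp' hq').
- exact: (J_hol M0 hq hp).
- exact: (jU_hol M0 hq hp).
- by apply: (J_hol M0 hp' hq'); exact: rapid0_opp.
Qed.

Lemma S2_hol f1 f2 x (d : R) : 0 < d -> (forall z, 0 <= cIm z -> d <= cn (aco q p z)) ->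
  rapid0 f1 -> rapid0 f2 -> hol (fun z => S2 q p z f1 f2 x).
Proof.
move=> d0 hd h1 h2; apply: holM; first exact: (holV d0 hd aco_hol).
apply: holB; apply: holM.
- exact: (jU_hol M0 hp' hq').
- exact: (J_hol M0 hq hp).
- exact: (jV_hol M0 hq hp).
- by apply: (J_hol M0 hp' hq'); exact: rapid0_opp.
Qed.

End ResolventProperties.

(** * A lower bound for the scattering coefficient *)

Section LowerBound.
Context {R : realType}.
Local Notation C := R[i].
Implicit Types (q p f g y : R -> C) (z : C) (N x s w : R).

Lemma zrE (x y w : R) : zr (x +i* y) w = (x + w) +i* y :> C.
Proof. by apply: complexP; rewrite ?ReD ?ImD /=; rewrite ?addr0. Qed.

Lemma ziE (x y w : R) : zi (x +i* y) w = x +i* (y + w) :> C.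
Proof.
by apply: complexP => /=; ring.
Qed.

Lemma hol_lip (g : C -> C) : hol g -> exists2 B, 0 <= B & forall x y x' y' : R,
  0 <= y -> 0 <= y' -> `|x - x'| <= 1 -> `|y - y'| <= 1 ->
  cn (g (x +i* y) - g (x' +i* y')) <= B * (`|x - x'| + `|y - y'|).
Proof.
move=> [B hB]; have B0 : 0 <= B.
  by have := hB 0 1 (lexx _) ltr01 (lexx _); exact: hol3_ge0.
exists B => // x y x' y' y0 y0' hx hy.
have lr (u v : R) : `|u - v| <= 1 -> cn (g (u +i* y) - g (v +i* y)) <= B * `|u - v|.
  case: (ltgtP u v) => [uv|uv|-> _]; last first.
  - by rewrite subrr cn0 subrr normr0 mulr0.
  - rewrite gtr0_norm ?subr_gt0// => h.
    have [|_ _ _ [h1 _ _]] := hB (v +i* y) (u - v) y0 _ h; first by rewrite subr_gt0.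
    by move: h1; rewrite zrE subrKC.
  - rewrite distrC gtr0_norm ?subr_gt0// => h.
    have [|_ _ _ [h1 _ _]] := hB (u +i* y) (v - u) y0 _ h; first by rewrite subr_gt0.
    by move: h1; rewrite zrE subrKC cnBC.
have li (u v : R) : 0 <= u -> 0 <= v -> `|u - v| <= 1 ->
    cn (g (x' +i* u) - g (x' +i* v)) <= B * `|u - v|.
  move=> u0 v0; case: (ltgtP u v) => [uv|uv|-> _]; last first.
  - by rewrite subrr cn0 subrr normr0 mulr0.
  - rewrite gtr0_norm ?subr_gt0// => h.
    have [|_ _ _ [_ h1 _]] := hB (x' +i* v) (u - v) v0 _ h; first by rewrite subr_gt0.
    by move: h1; rewrite ziE subrKC.
  - rewrite distrC gtr0_norm ?subr_gt0// => h.
    have [|_ _ _ [_ h1 _]] := hB (x' +i* u) (v - u) u0 _ h; first by rewrite subr_gt0.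
    by move: h1; rewrite ziE subrKC cnBC.
rewrite (_ : g _ - g _ = (g (x +i* y) - g (x' +i* y)) + (g (x' +i* y) - g (x' +i* y')));
  last by ring.
apply: le_trans (cnD _ _) _; rewrite mulrDr; apply: lerD; [exact: lr|exact: li].
Qed.

(** Continuity and compactness. The absolute value on the second coordinate extends
   the function to a full rectangle. *)
Lemma hol_min (g : C -> C) (L : R) : hol g -> 0 <= L ->
  (forall z, 0 <= cIm z -> g z <> 0) ->
  exists2 d : R, 0 < d & forall z, 0 <= cIm z -> cn z <= L -> d <= cn (g z).
Proof.
move=> hg L0 g0.
pose F (t : R * R) : R := cn (g (t.1 +i* `|t.2|)).
have [B B0 hB] := hol_lip hg.
have cF : continuous F.
  move=> [x y]; apply/cvgrPdist_lt => e e0.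
  pose d := Num.min 1 (e / (2 * (B + 1))).
  have d0 : 0 < d by rewrite lt_min ltr01 divr_gt0// mulr_gt0// ltr_pwDr.
  exists (ball x d, ball y d) => /=; first by split; exact: nbhsx_ballx.
  move=> [x' y'] [/= hx hy]; rewrite /F /=.
  have {}hx : `|x - x'| < d by exact: hx.
  have {}hy : `|y - y'| < d by exact: hy.
  have hy2 : `| `|y| - `|y'| | < d by apply: le_lt_trans hy; exact: ler_dist_dist.
  move: (hx) (hy2); rewrite !lt_min => /andP[hx1 hx2] /andP[hy1 hy2'].
  have := hB x `|y| x' `|y'| (normr_ge0 _) (normr_ge0 _) (ltW hx1) (ltW hy1).
  set a := g _; set b := g _ => hab.
  have h1 : `|cn a - cn b| <= cn (a - b).
    rewrite ler_norml; apply/andP; split.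
      by have := cnD (b - a) a; rewrite subrK cnBC; lra.
    by have := cnD (a - b) b; rewrite subrK; lra.
  apply: le_lt_trans h1 _; apply: le_lt_trans hab _.
  have h2 : `|x - x'| + `| `|y| - `|y'| | < e / (B + 1).
    rewrite (_ : e / (B + 1) = e / (2 * (B + 1)) + e / (2 * (B + 1))).
      by rewrite ltrD.
    by field; rewrite gt_eqF// ltr_pwDr.
  move: h2; rewrite ltr_pdivlMr ?ltr_pwDr// => h2.
  by apply: le_lt_trans h2; rewrite mulrC ler_wpM2l ?addr_ge0// lerDl.
pose A : set (R * R) := `[- L, L]%classic `*` `[- L, L]%classic.
have cA : compact A by apply: compact_setX; exact: segment_compact.
have A0 : A !=set0.
  by exists (0, 0); split; rewrite /= in_itv/= oppr_le0 L0.
have [c cA' hc] := compact_EVT_min A0 cA (continuous_subspaceT cF).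
exists (F c); first by apply: cn_gt0; apply/eqP; apply: g0; rewrite /= normr_ge0.
move=> [x y] /= y0 zL.
have := hc (x, y); rewrite /F /= (ger0_norm y0); apply; rewrite inE.
have := Re_le (x +i* y); have := Im_le (x +i* y); rewrite /= => h1 h2.
by split; rewrite /= in_itv/= -ler_norml; [exact: le_trans h2 zL|exact: le_trans h1 zL].
Qed.

Section Asymptotics.
Variables (M : R) (q p dp : R -> C).
Hypotheses (M0 : 0 < M) (hq : pot M q) (hp : pot M p) (hdp : pot M dp).
Hypothesis pd : forall x, cder p x (dp x).

Let B := JB0 M.

Let pb (f : R -> C) z s : pot M f -> 0 <= cIm z ->
  cn (f s * jU q p z s) <= M * B * om s /\ cn (f s * jV q p z s) <= M * B * om s.
Proof.
move=> hf z0; have [h1 h2] := jsol_le M0 hq hp z0 (jostP M0 hq hp z0) s.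
have o0 := om_ge0 s; have B0 : 0 <= B by exact: JB0_ge0.
have W0 := ltW (W_gt0 s).
have aux (y : C) : cn y <= B * oneDsqr s -> cn (f s * y) <= M * B * om s.
  move=> hy; rewrite cnM.
  apply: le_trans (ler_pM (cn_ge0 _) (cn_ge0 _) (hf.2 s) hy) _.
  rewrite [X in X <= _](_ : _ = M * B * (om s ^+ 3 * oneDsqr s)); last by ring.
  apply: ler_wpM2l; first by apply: mulr_ge0 => //; exact: ltW.
  rewrite -[X in _ <= X](om3W2 s) ler_peMr ?W_ge1//.
  by rewrite mulr_ge0 ?exprn_ge0.
by split; apply: aux.
Qed.

(** One integration by parts in the oscillatory integral for $v$ gives decay
   $1/|z|$; in terms of differential equations,
   $v + p u / (2i(z + i))$ solves an equation whose source carries the factor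
   $1/(z+i)$. *)
Lemma jost_asym : exists2 K, 0 <= K & forall z x, 0 <= cIm z ->
  cn (jU q p z x - 1) <= K / cn (z + 'i) /\ cn (jV q p z x) <= K / cn (z + 'i).
Proof.
have B0 : 0 <= B by exact: JB0_ge0.
have pi0 : 0 <= pi :> R by exact: pi_ge0.
have MB : 0 <= M * B by apply: mulr_ge0 => //; exact: ltW.
pose K' := M * B + 2 * (M * B) + M * (M * B).
have K'0 : 0 <= K'.
  by rewrite /K' !addr_ge0// mulr_ge0//; exact: ltW.
pose K2 := 2 * (K' * pi) + M * B.
have K20 : 0 <= K2 by rewrite /K2 addr_ge0// mulr_ge0// mulr_ge0.
exists (K2 + 2 * (M * K2 * pi)).
  by apply: addr_ge0 => //; do 2 apply: mulr_ge0 => //; apply: mulr_ge0 => //; exact: ltW.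
have V z x : 0 <= cIm z -> cn (jV q p z x) <= K2 / cn (z + 'i).
  move=> z0; have js := jostP M0 hq hp z0.
  have zi0 : z + 'i != 0.
    by apply/eqP => /(congr1 (@complex.Im R)); rewrite ImD Imi Im0; lra.
  pose k : C := (2 * 'i * (z + 'i))^-1.
  have i0 : 2 * 'i * (z + 'i) != 0 :> C.
    rewrite mulf_neq0// mulf_neq0//.
    by apply/eqP => /(congr1 (@complex.Im R)); rewrite Imi Im0 => /eqP; rewrite oner_eq0.
  have ck : cn k = 2^-1 / cn (z + 'i).
    by rewrite /k cnV !cnM cni cn_nat mulr1 invfM.
  pose G s := dp s * jU q p z s - 2 * (p s * jU q p z s) + p s * (q s * jV q p z s).
  have [cu cv _ _ _] := js.
  have cG : ccont G.
    apply: ccontD; first apply: ccontB.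
    - by apply: ccontM => //; case: hdp.
    - by apply: ccontZ; apply: ccontM => //; case: hp.
    - by apply: ccontM; [case: hp|apply: ccontM => //; case: hq].
  have hG s : cn (G s) <= K' * om s.
    have h1 := (pb s hdp z0).1; have h2 := (pb s hp z0).1; have h3 := (pb s hq z0).2.
    have pM : cn (p s) <= M.
      apply: le_trans (hp.2 s) _; rewrite -[X in _ <= X]mulr1 ler_wpM2l//; first exact: ltW.
      by rewrite exprn_ile1// ?om_ge0 ?om_le1.
    have h4 : cn (p s * (q s * jV q p z s)) <= M * (M * B * om s).
      by rewrite cnM ler_pM ?cn_ge0.
    have h5 : cn (2 * (p s * jU q p z s)) <= 2 * (M * B * om s).
      by rewrite cnM cn_nat ler_pM2l.
    apply: le_trans (cnD _ _) _; apply: le_trans (lerD (cnB _ _) (lexx _)) _.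
    rewrite (_ : K' * om s = M * B * om s + 2 * (M * B * om s) + M * (M * B * om s)).
      by apply: lerD => //; exact: lerD.
    by rewrite /K'; ring.
  have tG : ltame G by apply: tame_ltame; split => //; exists K'.
  (* The correction cancels the slowly decaying source $p u$ up to order $1/z$. *)
  pose rho s := jV q p z s + k * (p s * jU q p z s).
  have er : rho x = Kop (jc z) (fun s => k * G s) x.
    apply: Kop_uniq.
    - exact: jc_ge0.
    - by apply: ltameM => //; [exact: ccont_cst|move=> X; exists (cn k)].
    - apply: vanD; first exact: (jsol_vanv hp z0 js).
      apply: vanM; first by move=> X; exists (cn k).
      exact: ltame_van (tame_ltame (jsol_tame_pu hp js)).
    - move=> t; apply: cder_eq (cderD (jsol_dv hp z0 js t)
        (cderZ k (cderM (pd t) (jsol_du hq js t)))) _.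
      have kk : 2 * 'i * (z + 'i) * k = 1 by rewrite mulfV.
      have kz : 2 * 'i * z * k = 1 + 2 * k.
        rewrite (_ : 2 * 'i * z * k = 2 * 'i * (z + 'i) * k - 2 * ('i * 'i) * k);
          last by ring.
        by rewrite kk ii; ring.
      rewrite /rho /jc /G.
      rewrite (_ : - - (2 * 'i * z) * (jV q p z t + k * (p t * jU q p z t)) =
        2 * 'i * z * jV q p z t + (2 * 'i * z * k) * (p t * jU q p z t)); last by ring.
      by rewrite kz; ring.
  have h1 : cn (Kop (jc z) (fun s => k * G s) x) <= 2 * (cn k * K' * phi x).
    apply: Kop_le.
    - exact: jc_ge0.
    - by apply: ltameM => //; [exact: ccont_cst|move=> X; exists (cn k)].
    - by move=> s _; rewrite cnM -mulrA ler_wpM2l ?cn_ge0.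
  have h2 : jV q p z x = rho x - k * (p x * jU q p z x) by rewrite /rho addrK.
  rewrite h2; apply: le_trans (cnB _ _) _; rewrite er cnM.
  apply: le_trans (lerD h1 (lexx _)) _.
  have n0 : 0 <= (cn (z + 'i))^-1 by rewrite invr_ge0 cn_ge0.
  have h3 : cn (p x * jU q p z x) <= M * B.
    apply: le_trans (pb x hp z0).1 _; rewrite -[X in _ <= X]mulr1 ler_wpM2l//.
    exact: om_le1.
  have h4 : K' * phi x <= K' * pi by rewrite ler_wpM2l// phi_lepi.
  rewrite ck.
  rewrite (_ : _ + _ = (K' * phi x + 2^-1 * cn (p x * jU q p z x)) * (cn (z + 'i))^-1).
    apply: ler_wpM2r => //; rewrite /K2.
    have : 0 <= K' * pi by rewrite mulr_ge0.
    have := cn_ge0 (p x * jU q p z x); lra.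
  have zn : cn (z + 'i) != 0 by rewrite gt_eqF// cn_gt0.
  by field.
move=> z x z0.
have n0 : 0 <= (cn (z + 'i))^-1 by rewrite invr_ge0 cn_ge0.
have js := jostP M0 hq hp z0.
split; last first.
  apply: le_trans (V z x z0) _; rewrite ler_wpM2r// lerDl.
  by do 2 apply: mulr_ge0 => //; apply: mulr_ge0 => //; exact: ltW.
have [_ _ _ eu _] := js; rewrite eu addrC addKr.
apply: le_trans (prim_le (K := M * (K2 / cn (z + 'i))) _ _) _.
- by apply: ltame_int; apply: tame_ltame; exact: (jsol_tame_qv hq js).
- move=> s _; rewrite cnM mulrAC; apply: ler_pM; rewrite ?cn_ge0 ?V//.
  by apply: le_trans (hq.2 s) _; rewrite ler_wpM2l ?om3_le// ltW.
rewrite [X in _ <= X](_ : _ = K2 / cn (z + 'i) +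
  2 * (M * (K2 / cn (z + 'i)) * pi)); last by ring.
apply: ler_wpDl; first exact: mulr_ge0.
rewrite ler_pM2l// ler_wpM2l ?phi_lepi//.
by apply: mulr_ge0; [exact: ltW|exact: mulr_ge0].
Qed.

End Asymptotics.

(** The coefficient tends to 1 at infinity, and is continuous without zeros on
   bounded parts of the closed half-plane. *)
Lemma aco_lower M q p dq dp : 0 < M -> pot M q -> pot M p -> pot M dq -> pot M dp ->
  (forall x, cder q x (dq x)) -> (forall x, cder p x (dp x)) ->
  (forall z, 0 <= cIm z -> aco q p z <> 0) ->
  exists2 d : R, 0 < d & forall z, 0 <= cIm z -> d <= cn (aco q p z).
Proof.
move=> M0 hq hp hdq hdp dq_ dp_ a0.
have hq' := pot_oppf hq; have hp' := pot_oppf hp.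
have dq' x : cder (oppf q) x (dq (- x)).
  by apply: cder_eq (cderN (cder_opp (dq_ (- x)))) _; rewrite opprK.
have hdq' : pot M (fun x => dq (- x)).
  by split; [apply: ccont_opp; case: hdq|move=> s; rewrite -om_opp; exact: hdq.2].
have [K1 K10 h1] := jost_asym M0 hq hp hdp dp_.
have [K2 K20 h2] := jost_asym M0 hp' hq' hdq' dq'.
have [BU BU0 hBU] := hol_bounded (jU_hol M0 hp' hq' 0).
have [BV BV0 hBV] := hol_bounded (jV_hol M0 hp' hq' 0).
pose K := K1 * BU + K2 + K1 * BV.
have K0 : 0 <= K by rewrite /K !addr_ge0// mulr_ge0.
have asym z : 0 <= cIm z -> cn (aco q p z - 1) <= K / cn (z + 'i).
  move=> z0; have [u1 v1] := h1 z 0 z0; have [u2 v2] := h2 z 0 z0.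
  rewrite (_ : aco q p z - 1 = (jU q p z 0 - 1) * Ut q p z 0 + (Ut q p z 0 - 1)
    - jV q p z 0 * Vt q p z 0); last by rewrite /aco; ring.
  apply: le_trans (cnB _ _) _; apply: le_trans (lerD (cnD _ _) (lexx _)) _.
  rewrite !cnM (_ : K / cn (z + 'i) = K1 / cn (z + 'i) * BU + K2 / cn (z + 'i) +
    K1 / cn (z + 'i) * BV); last by rewrite /K; ring.
  apply: lerD; first apply: lerD => //.
    by apply: ler_pM; rewrite ?cn_ge0// hBU.
  by apply: ler_pM; rewrite ?cn_ge0// hBV.
(* Outside the ball of this radius the coefficient is at distance at most 1/2
   from 1. *)
pose L := 2 * K + 1 + 1.
have L0 : 0 <= L by rewrite /L; lra.
have [d d0 hd] := hol_min (aco_hol M0 hq hp) L0 a0.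
exists (Num.min d (1 / 2)); first by rewrite lt_min d0 divr_gt0.
move=> z z0; rewrite ge_min; have [zL|zL] := leP (cn z) L.
  by rewrite hd.
apply/orP; right.
have h3 : 2 * K + 1 <= cn (z + 'i).
  have := cnB (z + 'i) 'i; rewrite addrK cni; move: zL; rewrite /L; lra.
have p0 : 0 < cn (z + 'i) by lra.
have h4 : K / cn (z + 'i) <= 1 / 2 by rewrite ler_pdivrMr//; lra.
have := cnD (1 - aco q p z) (aco q p z); rewrite subrK cn1 cnBC.
by have := asym z z0; lra.
Qed.

End LowerBound.

(** * Vanishing of the line integral *)

Section Contour.
Context {R : realType}.
Local Notation C := R[i].
Local Notation mu := (@lebesgue_measure R).
Implicit Types (z : C) (B N x s w e l : R).

Definition ck z : C := (z + 'i)^-1.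

Lemma zi_neq0 z : 0 <= cIm z -> z + 'i != 0.
Proof. by move=> z0; apply/eqP => /(congr1 (@complex.Im R)); rewrite ImD Imi Im0; lra. Qed.

Lemma cn_ck2 l e : cn (ck (l +i* e)) ^+ 2 = (l ^+ 2 + (1 + e) ^+ 2)^-1.
Proof.
by rewrite /ck cnV exprVn cn_sqr ReD ImD Rei Imi /= addr0 [e + 1]addrC.
Qed.

Lemma ck_le1 z : 0 <= cIm z -> cn (ck z) <= 1.
Proof.
move=> z0; rewrite /ck cnV invf_le1 ?cn_gt0 ?zi_neq0//.
by apply: le_trans (Im_le _); rewrite ImD Imi ger0_norm ?addr_ge0// lerDr.
Qed.

Lemma ck2_le l e : 0 <= e -> cn (ck (l +i* e)) ^+ 2 <= om l.
Proof.
move=> e0; rewrite cn_ck2 /om WE lef_pV2 ?posrE; last 2 first.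
- by have := sqr_ge0 l; have := sqr_ge0 e; nra.
- by have := sqr_ge0 l; lra.
by have := sqr_ge0 e; nra.
Qed.

Lemma ck_diff z d : 0 <= cIm z -> 0 <= cIm (z + d) ->
  ck (z + d) = ck z * (1 - d * ck (z + d)).
Proof.
move=> z0 zd0; have h1 := zi_neq0 z0; have h2 := zi_neq0 zd0.
by rewrite /ck; field; rewrite h1 h2.
Qed.

(** Quotients of values of $1/(z+i)$ at the three points: the triple is taken
   relative to its first value, so that the decay in $z$ can be factored out. *)
Lemma rho_hol3 z w : 0 <= cIm z -> 0 < w -> w <= 1 ->
  hol3 2 w 1 (1 - w%:C * ck (zr z w)) (1 - 'i * w%:C * ck (zi z w)).
Proof.
move=> z0 w0 w1; have w0' := ltW w0.
have z1 := zr_ge0 w z0; have z2 := zi_ge0 z0 w0'.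
have k1 := ck_le1 z1; have k2 := ck_le1 z2.
have a1 : cn (w%:C * ck (zr z w)) <= w.
  by rewrite cnM cnR ger0_norm// ler_piMr.
have a2 : cn ('i * w%:C * ck (zi z w)) <= w.
  by rewrite cnM cnM cni mul1r cnR ger0_norm// ler_piMr.
split; [by rewrite cn1; lra| | |split].
- by apply: le_trans (cnB _ _) _; rewrite cn1; lra.
- by apply: le_trans (cnB _ _) _; rewrite cn1; lra.
- by rewrite addrAC subrr add0r cnN; lra.
- by rewrite addrAC subrr add0r cnN; lra.
- have h1 := zi_neq0 z1; have h2 := zi_neq0 z2.
  rewrite (_ : _ - _ - _ = 'i * w%:C * (ck (zr z w) - ck (zi z w))); last by ring.
  rewrite (_ : ck (zr z w) - ck (zi z w) = ('i - 1) * w%:C * (ck (zr z w) * ck (zi z w))).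
    rewrite !cnM cni mul1r cnR (ger0_norm w0').
    have h3 : cn ('i - 1 : C) <= 2 by apply: le_trans (cnB _ _) _; rewrite cni cn1; lra.
    have h4 : cn (ck (zr z w)) * cn (ck (zi z w)) <= 1.
      by rewrite -[X in _ <= X]mulr1 ler_pM ?cn_ge0.
    rewrite (_ : 2 * w ^+ 2 = w * (2 * w * 1)); last by ring.
    apply: ler_wpM2l => //; apply: ler_pM => //.
      by rewrite mulr_ge0 ?cn_ge0.
      by rewrite mulr_ge0 ?cn_ge0.
    by rewrite ler_wpM2r.
  by rewrite /ck /zr /zi; field; rewrite -/(zr z w) -/(zi z w) h1 h2.
Qed.

Section Line.
Variable g : C -> C.
Hypothesis hg : hol g.

(** The integrand at height [e], as a function on the real line. *)
Definition hl e l : C := ck (l +i* e) ^+ 2 * g (l +i* e).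

Lemma hl_hol3 : exists2 K, 0 <= K & forall e l w, 0 <= e -> 0 < w -> w <= 1 ->
  hol3 (K * om l) w (hl e l) (hl e (l + w)) (hl (e + w) l).
Proof.
have [B hB] := hg.
have B0 : 0 <= B by have := hB 0 1 (lexx _) ltr01 (lexx _); exact: hol3_ge0.
exists (4 * (4 * (4 * (2 * 2) * B))); first by rewrite !mulr_ge0.
move=> e l w e0 w0 w1; have w0' := ltW w0; set z := l +i* e.
have z0 : 0 <= cIm z by [].
have r := rho_hol3 z0 w0 w1.
have H := hol3Z (ck z ^+ 2) w0' (hol3M w0' (hol3M w0' r r) (hB z w z0 w0 w1)).
have z1 := zr_ge0 w z0; have z2 := zi_ge0 z0 w0'.
have e1 : hl e l = ck z ^+ 2 * (1 * 1 * g z) by rewrite /hl !mul1r.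
have e2 : hl e (l + w) = ck z ^+ 2 * ((1 - w%:C * ck (zr z w)) *
    (1 - w%:C * ck (zr z w)) * g (zr z w)).
  rewrite /hl -zrE -/z [in LHS](_ : ck (zr z w) = ck z * (1 - w%:C * ck (zr z w))).
    by ring.
  exact: ck_diff.
have e3 : hl (e + w) l = ck z ^+ 2 * ((1 - 'i * w%:C * ck (zi z w)) *
    (1 - 'i * w%:C * ck (zi z w)) * g (zi z w)).
  rewrite /hl -ziE -/z [in LHS](_ : ck (zi z w) = ck z * (1 - 'i * w%:C * ck (zi z w))).
    by ring.
  exact: ck_diff.
rewrite e1 e2 e3; apply: hol3_mono H => //.
rewrite cn_exp [X in _ <= X](_ : _ = 4 * (om l * (4 * (4 * (2 * 2) * B)))); last by ring.
rewrite ler_pM2l// ler_wpM2r ?ck2_le//.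
by rewrite !mulr_ge0.
Qed.

Lemma hl_tame e : 0 <= e -> tame (hl e).
Proof.
move=> e0; have [K K0 hK] := hl_hol3; split.
  apply: (@ccont_lip _ _ K) => x w w0 w1.
  have [_ _ _ [h _ _]] := hK e x w e0 w0 w1.
  apply: le_trans h _; apply: ler_wpM2r; first exact: ltW.
  by rewrite ler_piMr// om_le1.
by exists K => l; have [] := hK e l 1 e0 ltr01 (lexx _).
Qed.

Lemma atan_prim (c x : R) : 1 <= c ->
  \int[mu]_(s in `]-oo, x]) (s ^+ 2 + c ^+ 2)^-1 <= c^-1 * (atan (c^-1 * x + 0) + pi / 2) /\
  tame (fun s : R => ((s ^+ 2 + c ^+ 2)^-1)%:C).
Proof.
move=> c1; have c0 : 0 < c by lra.
have pos (s : R) : 0 < s ^+ 2 + c ^+ 2.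
  by apply: ltr_wpDl; [exact: sqr_ge0|exact: exprn_gt0].
have dG y : is_derive y (1 : R) (fun x => c^-1 * (atan (c^-1 * x + 0) + pi / 2))
    ((y ^+ 2 + c ^+ 2)^-1).
  have h := is_derive_comp_aff (is_derive1_atan (c^-1 * y + 0)).
  refine (is_derive_eq (is_derive_rM (is_derive_cst c^-1 y 1)
    (is_derive_rD h (is_derive_cst (pi / 2) y 1))) _).
  have cn0 : c != 0 by rewrite gt_eqF.
  have pn : y ^+ 2 + c ^+ 2 != 0 by rewrite gt_eqF.
  have e : 1 + (c^-1 * y + 0) ^+ 2 = (y ^+ 2 + c ^+ 2) / c ^+ 2 by field.
  by rewrite e mul0r add0r addr0 /cst; field; rewrite cn0 pn.
have ht : tame (fun s : R => ((s ^+ 2 + c ^+ 2)^-1)%:C).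
  split.
    apply: ccontR => x0; apply: cvgV; first by rewrite gt_eqF.
    by apply: cvgD; [exact: exprn_continuous|exact: cst_continuous].
  exists 1 => s; rewrite cnR ger0_norm; last by rewrite invr_ge0; exact/ltW/pos.
  rewrite mul1r /om WE.
  rewrite lef_pV2 ?posrE//; last by have := sqr_ge0 s; lra.
  by nra.
split => //; apply: Rprim_le => //.
move=> y; apply: mulr_ge0; first by rewrite invr_ge0 ltW.
by have := atan_gtNpi2 (c^-1 * y + 0); lra.
Qed.

Definition Il e : C := cintegral setT (hl e).

(** At height $e$ the integrand is at most $B / (l^2 + (1+e)^2)$, whose integral is
   of order $1/(1+e)$. *)
Lemma Il_small : exists2 K, 0 <= K & forall e, 0 <= e -> cn (Il e) <= K / (1 + e).
Proof.
have [B B0 hB] := hol_bounded hg.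
exists (2 * (B * pi)) => [|e e0].
  by rewrite !mulr_ge0 ?pi_ge0.
have c1 : 1 <= 1 + e by rewrite lerDl.
have ht := hl_tame e0.
have bd l : cn (hl e l) <= B * (l ^+ 2 + (1 + e) ^+ 2)^-1.
  by rewrite /hl cnM cn_exp cn_ck2 mulrC ler_wpM2r ?hB// -cn_ck2 exprn_ge0// cn_ge0.
have aux (h : R -> C) : tame h -> (forall l, cn (h l) <= B * (l ^+ 2 + (1 + e) ^+ 2)^-1) ->
    cn (prim h 0) <= B * pi / (1 + e).
  move=> th hh; have [P Pt] := atan_prim 0 c1.
  have [ig _] := tame_int (mray 0) Pt.
  have := @cintegral_norm R _ h (fun s => B * (s ^+ 2 + (1 + e) ^+ 2)^-1) (mray 0)
    (ltame_int 0 (tame_ltame th)) (integrable_rZ B (mray 0) ig) (fun s _ => hh s).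
  rewrite (RintegralZl _ (mray 0) ig) => h1; apply: le_trans h1 _.
  rewrite (_ : B * pi / (1 + e) = 2 * (B * ((1 + e)^-1 * (pi / 2)))).
    by rewrite ler_pM2l// ler_wpM2l//; apply: le_trans P _;
      rewrite mulr0 addr0 atan0 add0r.
  by field; rewrite gt_eqF//; lra.
rewrite /Il cintegralT//; apply: le_trans (cnD _ _) _.
have h1 := aux _ ht bd.
have h2 : cn (prim (fun s => hl e (- s)) 0) <= B * pi / (1 + e).
  by apply: aux; [exact: tame_opp|move=> l; apply: le_trans (bd (- l)) _; rewrite sqrrN].
rewrite (_ : 2 * (B * pi) / (1 + e) = B * pi / (1 + e) + B * pi / (1 + e)).
  exact: lerD.
by ring.
Qed.

(** Translation invariance makes the integral of $h(l + w) - h(l)$ vanish, so the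
   change of height equals the Cauchy-Riemann defect. *)
Lemma Il_step : exists2 K, 0 <= K & forall e w, 0 <= e -> 0 < w -> w <= 1 ->
  cn (Il (e + w) - Il e) <= K * w ^+ 2.
Proof.
have [K K0 hK] := hl_hol3; exists (4 * (K * pi)).
  by rewrite !mulr_ge0 ?pi_ge0.
move=> e w e0 w0 w1.
have t0 := hl_tame e0.
have t2 : tame (hl (e + w)) by apply: hl_tame; rewrite addr_ge0// ltW.
have t1 : tame (fun l => hl e (l + w)).
  split; first by apply: ccont_comp; [case: t0|move=> x; apply: cvgD;
    [exact: cvg_id|exact: cst_continuous]].
  by exists K => l; have [] := hK e l w e0 w0 w1.
have mT : @measurable _ (measurableTypeR R) setT by exact: measurableT.
have E : Il (e + w) - Il e = cintegral setT
    (fun l => hl (e + w) l - hl e l - 'i * (hl e (l + w) - hl e l)).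
  rewrite cintegralB//; last 2 first.
  - by apply: (tame_int mT); exact: tameB.
  - by apply: (tame_int mT); apply: tameZ; exact: tameB.
  rewrite cintegralZ//; last by apply: (tame_int mT); exact: tameB.
  rewrite !cintegralB//; try exact: (tame_int mT).
  by rewrite (cintegralT_shift t0 t1) subrr mulr0 subr0.
rewrite E (_ : 4 * (K * pi) * w ^+ 2 = 4 * (K * w ^+ 2 * pi)); last by ring.
apply: prim_tail_le.
  by apply: tameB; [exact: tameB|apply: tameZ; exact: tameB].
by move=> l; have [_ _ _ [_ _ h]] := hK e l w e0 w0 w1; rewrite mulrAC.
Qed.

Lemma Il_many K w n : (forall e w, 0 <= e -> 0 < w -> w <= 1 ->
  cn (Il (e + w) - Il e) <= K * w ^+ 2) -> 0 < w -> w <= 1 ->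
  cn (Il (n%:R * w) - Il 0) <= n%:R * (K * w ^+ 2).
Proof.
move=> hK w0 w1; elim: n => [|n IH]; first by rewrite !mul0r subrr cn0.
rewrite (_ : Il _ - Il 0 = (Il (n%:R * w + w) - Il (n%:R * w)) +
  (Il (n%:R * w) - Il 0)); last first.
  by rewrite -addn1 natrD mulrDl mul1r; ring.
apply: le_trans (cnD _ _) _; rewrite -addn1 natrD mulrDl mul1r addrC.
by apply: lerD => //; apply: hK => //; rewrite mulr_ge0// ltW.
Qed.

(** Going up to height $n$ in $n^3$ steps of length $1/n^2$ changes the integral by
   at most $n^3 K / n^4$, and at height $n$ it is of order $1/n$. *)
Lemma Il0 : Il 0 = 0.
Proof.
have [K K0 hK] := Il_step; have [D D0 hD] := Il_small.
apply: cn_eq0; apply/eqP; rewrite eq_le cn_ge0 andbT leNgt; apply/negP => p0.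
pose n := (Num.trunc ((K + D) / cn (Il 0))).+1.
have hn : (K + D) / cn (Il 0) < n%:R by exact: truncnS_gt.
have n0 : 0 < n%:R :> R by rewrite ltr0n.
have n1 : 1 <= n%:R :> R by rewrite ler1n.
have w0 : 0 < (n%:R ^+ 2)^-1 :> R by rewrite invr_gt0 exprn_gt0.
have w1 : (n%:R ^+ 2)^-1 <= 1 :> R.
  by rewrite invf_le1 ?exprn_gt0// exprn_ege1.
have h1 := Il_many (n ^ 3) hK w0 w1.
have e1 : (n ^ 3)%:R * (n%:R ^+ 2)^-1 = n%:R :> R.
  by rewrite natrX; field; rewrite gt_eqF.
have e2 : (n ^ 3)%:R * (K * (n%:R ^+ 2)^-1 ^+ 2) = K / n%:R.
  by rewrite natrX; field; rewrite gt_eqF.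
rewrite e1 e2 in h1.
have h2 := hD n%:R (ltW n0).
have h3 : D / (1 + n%:R) <= D / n%:R.
  by rewrite ler_wpM2l// lef_pV2 ?posrE ?addr_gt0// lerDr.
have h4 : cn (Il 0) <= (K + D) / n%:R.
  have := cnB (Il n%:R) (Il n%:R - Il 0); rewrite opprB addrC subrK mulrDl.
  by move=> h; lra.
move: hn; rewrite ltr_pdivrMr// => hn.
move: h4; rewrite ler_pdivlMr// mulrC.
by move=> h4; lra.
Qed.

End Line.

(** This plays the role of Cauchy's theorem, with the contour closed at infinity. *)
Lemma contour (g : C -> C) : hol g ->
  tame (fun l : R => ck l%:C ^+ 2 * g l%:C) /\
  cintegral setT (fun l : R => ck l%:C ^+ 2 * g l%:C) = 0.
Proof. by move=> hg; split; [exact: (hl_tame hg (lexx 0))|exact: Il0]. Qed.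

End Contour.

(** * Eigenvalues belong to the spectrum *)

Section Spectrum.
Context {R : realType}.
Local Notation C := R[i].
Local Notation C2 := 'cV[R[i]]_2.
Local Notation mu := (@lebesgue_measure R).
Implicit Types (q p f g : R -> C) (z : C) (N x s : R).

Lemma L2_tame (u : R -> C2) (K : R) :
  (forall i, ccont (fun x => u x i 0)) ->
  (forall x i, cn (u x i 0) <= K * om x) -> L2 u.
Proof.
move=> cu hK; split.
  move=> i; have [c1 c2] := cu i; split; exact: continuous_measurable_fun.
have K0 : 0 <= K.
  have := hK 0 0; rewrite -(pmulr_lge0 _ (om_gt0 0)).
  by apply: le_trans; exact: cn_ge0.
rewrite /L2norm unlock; apply: poweR_lty.
have mn (i : 'I_2) : measurable_fun setT (fun x => cn (u x i 0)).
  have [c1 c2] := cu i; apply: continuous_measurable_fun => x.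
  rewrite (_ : (fun x => _) = (@Num.sqrt R) \o (fun x => cRe (u x i 0) * cRe (u x i 0) +
      cIm (u x i 0) * cIm (u x i 0))).
    apply: continuous_comp; last exact: sqrt_continuous.
    by apply: cvgD; apply: cvgM; [exact: c1|exact: c1|exact: c2|exact: c2].
  by apply/funext => t; rewrite cnE.
have n2 x : norm2 (u x) ^+ 2 = cn (u x 0 0) ^+ 2 + cn (u x 1 0) ^+ 2.
  rewrite /norm2 !big_ord_recl big_ord0 addr0 ord2_1 sqr_sqrtr//.
  by rewrite addr_ge0// sqr_ge0.
have io : mu.-integrable setT (EFin \o (fun x => 2 * K ^+ 2 * om x)).
  exact: (integrable_rZ (2 * K ^+ 2) (@measurableT _ _) om_int).
have sq0 x : 0 <= cn (u x 0 0) ^+ 2 + cn (u x 1 0) ^+ 2.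
  by rewrite addr_ge0// exprn_ge0// cn_ge0.
have : mu.-integrable setT (EFin \o (fun x => cn (u x 0 0) ^+ 2 + cn (u x 1 0) ^+ 2)).
  apply: (le_integrable (@measurableT _ _) _ _ io).
    apply/measurable_EFinP; apply: measurable_funD;
      apply: measurable_funX; exact: mn.
  move=> x _; rewrite /= lee_fin ger0_norm//.
  rewrite ger0_norm; last by rewrite !mulr_ge0 ?exprn_ge0 ?om_ge0.
  have aux i : cn (u x i 0) ^+ 2 <= K ^+ 2 * om x.
    apply: (@le_trans _ _ ((K * om x) ^+ 2)).
      by rewrite ler_pXn2r ?nnegrE ?cn_ge0 ?mulr_ge0 ?om_ge0.
    rewrite exprMn ler_wpM2l ?exprn_ge0// -[X in _ <= X]expr1.
    by rewrite ler_wiXn2l ?om_ge0 ?om_le1.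
  by have := aux 0; have := aux 1; lra.
move=> /integrableP[_]; congr (_ < _)%E; apply: eq_integral => x _.
rewrite /= ger0_norm// ger0_norm; last exact: sqrtr_ge0.
by rewrite powR_mulrn ?sqrtr_ge0// n2.
Qed.

Lemma cintegral_der0 (F h : R -> C) : (forall x, cder F x (h x)) -> tame h ->
  van F -> van (fun x => F (- x)) -> cintegral setT h = 0.
Proof.
move=> dF th v1 v2; rewrite cintegralT//.
rewrite -(prim_uniq dF (tame_ltame th) v1).
have d2 x : cder (fun x => - F (- x)) x (h (- x)).
  by apply: cder_eq (cderN (cder_opp (dF (- x)))) _; rewrite opprK.
have v3 : van (fun x => - F (- x)).
  by move=> e e0; have [A hA] := v2 e e0; exists A => x /hA; rewrite cnN.
rewrite -(prim_uniq d2 (tame_ltame (tame_opp th)) v3).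
by rewrite oppr0 subrr.
Qed.

Lemma test_bounded (phi : R -> R) : test_function phi ->
  [/\ forall x, is_derive x (1 : R) phi ((phi^`())%classic x),
     continuous phi, continuous (phi^`())%classic &
     exists B M : R, forall x, `|phi x| <= B /\ `|(phi^`())%classic x| <= B /\
        (M < `|x| -> phi x = 0)].
Proof.
move=> [hd [M hM]].
have d0 x : is_derive x (1 : R) phi ((phi^`())%classic x).
  by have /derivableP := hd 0%N x; rewrite -derive1E.
have d1 x : is_derive x (1 : R) (phi^`())%classic ((phi^`(2))%classic x).
  by have /derivableP := hd 1%N x; rewrite -derive1E.
have c0 : continuous phi by move=> x; exact: is_derive_cont (d0 x).
have c1 : continuous (phi^`())%classic by move=> x; exact: is_derive_cont (d1 x).
have z1 x : M < `|x| -> (phi^`())%classic x = 0.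
  move=> Mx; have [_ <-] := d0 x.
  rewrite (@near_eq_derive _ _ _ phi (fun=> 0)); last first.
  - have hn : `|t| @[t --> x] --> `|x| by exact: (@norm_continuous _ R^o x).
    by near=> t; apply: hM; near: t; exact: (cvgr_gt _ hn _ Mx).
  - by have [_ ->] := is_derive_cst (0 : R) x 1.
have bd (f : R -> R) : continuous f -> (forall x, M < `|x| -> f x = 0) ->
    exists B, forall x, `|f x| <= B.
  move=> cf f0.
  pose L := `|M|.
  have L0 : - L <= L by have := normr_ge0 M; rewrite -/L; lra.
  have cn_ : continuous (fun x => `|f x|).
    by move=> x; apply: cvg_norm; exact: cf.
  have [c _ hc] := EVT_max L0 (continuous_subspaceT cn_).
  exists (`|f c|) => x; have [xL|xL] := leP `|x| L.
    by apply: hc; rewrite in_itv/= -ler_norml.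
  by rewrite f0 ?normr0// (le_lt_trans _ xL)// ler_norm.
have [B0 hB0] := bd _ c0 hM; have [B1 hB1] := bd _ c1 z1.
split => //; exists (Num.max B0 B1), M => x; split; first by rewrite le_max hB0.
by split; [rewrite le_max hB1 orbT|exact: hM].
Unshelve. all: by end_near. Qed.

Lemma weak_der_classical (u v : R -> C2) :
  (forall i x, cder (fun t => u t i 0) x (v x i 0)) ->
  (forall i, tame (fun t => u t i 0)) -> (forall i, tame (fun t => v t i 0)) ->
  weak_derivative u v.
Proof.
move=> duv tu tv phi /test_bounded[dphi c0 c1 [B [M hB]]].
have ccR (f : R -> R) : continuous f -> ccont (fun x : R => (f x)%:C : C) by exact: ccontR.
apply/colP => i; rewrite !mxE.
have t1 : tame (fun x => ((phi^`())%classic x)%:C * u x i 0).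
  apply: (tameM (B := B)) => //; first exact: ccR.
  by move=> s; rewrite cnR; have [_ []] := hB s.
have t2 : tame (fun x => (phi x)%:C * v x i 0).
  apply: (tameM (B := B)) => //; first exact: ccR.
  by move=> s; rewrite cnR; have [] := hB s.
have e0 : cintegral setT (fun x => ((phi^`())%classic x)%:C * u x i 0 +
    (phi x)%:C * v x i 0) = 0.
  apply: (@cintegral_der0 (fun x => (phi x)%:C * u x i 0)).
  - move=> x; apply: cderM => //; split; first exact: dphi.
    exact: is_derive_cst.
  - exact: tameD.
  - move=> e e0; exists (- `|M| - 1) => x xM.
    have [_ [_ ->]] := hB x; first by rewrite mul0r cn0.
    apply: le_lt_trans (ler_norm M) _.
    have := normr_ge0 M; have := ler_norm (- x); rewrite normrN; lra.
  - move=> e e0; exists (- `|M| - 1) => x xM.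
    have [_ [_ ->]] := hB (- x); first by rewrite mul0r cn0.
    apply: le_lt_trans (ler_norm M) _.
    have := normr_ge0 M; have := ler_norm (- x); lra.
have mT : @measurable _ (measurableTypeR R) setT by exact: measurableT.
move: e0; rewrite cintegralD//; [|exact: (tame_int mT)..] => /eqP.
rewrite addr_eq0 => /eqP e0.
transitivity (cintegral setT (fun x => ((phi^`())%classic x)%:C * u x i 0)).
  by apply: eq_cintegral => x _; rewrite !mxE.
by rewrite e0; congr (- _); apply: eq_cintegral => x _; rewrite !mxE.
Qed.

(** A point where a continuous function is nonzero has a ball of positive measure
   around it. *)
Lemma ae0_continuous (u : R -> C2) : (forall i, ccont (fun x => u x i 0)) ->
  {ae mu, forall x, u x = 0} -> forall x, u x = 0.
Proof.
move=> cu hae x; apply/colP => i; rewrite mxE; apply: contrapT => ux.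
have [c1 c2] := cu i.
have cont : continuous (fun t => cRe (u t i 0) * cRe (u t i 0) + cIm (u t i 0) * cIm (u t i 0)).
  by move=> t; apply: cvgD; apply: cvgM; [exact: c1|exact: c1|exact: c2|exact: c2].
have p0 : 0 < cRe (u x i 0) * cRe (u x i 0) + cIm (u x i 0) * cIm (u x i 0).
  rewrite -!expr2 -cn_sqr exprn_gt0// cn_gt0//; exact/eqP.
have [A [mA A0 hA]] := hae.
have : \forall t \near x, 0 < cRe (u t i 0) * cRe (u t i 0) + cIm (u t i 0) * cIm (u t i 0).
  exact: (cvgr_gt _ (cont x) _ p0).
move=> [e /= e0 he].
have sub : ball x e `<=` A.
  move=> t xt; apply: hA => /= ut; have := he t xt.
  by rewrite ut mxE !ReImE mulr0 addr0 ltxx.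
have : (mu (ball x e) <= mu A)%E.
  by apply: le_measure; rewrite ?inE//; exact: measurable_ball.
rewrite A0 lebesgue_measure_ball ?(ltW e0)// lee_fin => h.
by move: h; rewrite pmulrn_lle0// leNgt e0.
Qed.

Lemma linE (c : C) (v w : C2) i : (c *: v - c *: w) i 0 = c * v i 0 - c * w i 0.
Proof. by rewrite !mxE. Qed.

(** The eigenfunction and 0 are two distinct solutions of the resolvent equation
   with source 0. *)
Lemma spectrum_eigen (tau : C) q z (m0 m1 : R -> C) (Mq : R) : pot Mq q -> pot Mq (pQ tau q) ->
  (forall x, cder m0 x (- ('i * z) * m0 x + q x * m1 x)) ->
  (forall x, cder m1 x ('i * z * m1 x + pQ tau q x * m0 x)) ->
  tame m0 -> tame m1 -> (exists x, m0 x <> 0 \/ m1 x <> 0) ->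
  spectrum (calT tau q) z.
Proof.
move=> hq hp d0 d1 t0 t1 [x0 hx0] [uniq_ _].
pose u x : C2 := vec2 (m0 x) (m1 x).
pose u' x : C2 := vec2 (- ('i * z) * m0 x + q x * m1 x) ('i * z * m1 x + pQ tau q x * m0 x).
pose w x : C2 := z *: u x.
have tq := pot_tame hq; have tp := pot_tame hp.
have tu' i : tame (fun t => u' t i 0).
  move: i; apply: ord2P.
  - rewrite (_ : (fun t => _) = fun t => - ('i * z) * m0 t + q t * m1 t).
      by apply: tameD; [exact: tameZ|exact: tame_mul].
    by apply/funext => t; rewrite vec2_0.
  - rewrite (_ : (fun t => _) = fun t => 'i * z * m1 t + pQ tau q t * m0 t).
      by apply: tameD; [exact: tameZ|exact: tame_mul].
    by apply/funext => t; rewrite vec2_1.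
have tu i : tame (fun t => u t i 0).
  move: i; apply: ord2P.
  - by rewrite (_ : (fun t => _) = m0)//; apply/funext => t; rewrite vec2_0.
  - by rewrite (_ : (fun t => _) = m1)//; apply/funext => t; rewrite vec2_1.
have tw i : tame (fun t => w t i 0).
  rewrite (_ : (fun t => _) = fun t => z * u t i 0); first exact: tameZ.
  by apply/funext => t; rewrite mxE.
have tz (i : 'I_2) : tame (fun t : R => (0 : C2) i 0).
  have := tameZ 0 t0; rewrite (_ : (fun s => 0 * m0 s) = fun t : R => (0 : C2) i 0)//.
  by apply/funext => s; rewrite mul0r mxE.
have L2t (v : R -> C2) : (forall i, tame (fun t => v t i 0)) -> L2 v.
  move=> tv; have [c0 [K0 h0]] := tv 0; have [c1 [K1 h1]] := tv 1.
  apply: (@L2_tame _ (Num.max K0 K1)); first by move=> i; case: (tv i).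
  move=> x; apply: ord2P.
  - by apply: le_trans (h0 x) _; rewrite ler_wpM2r ?om_ge0// le_max lexx.
  - by apply: le_trans (h1 x) _; rewrite ler_wpM2r ?om_ge0// le_max lexx orbT.
have du i x : cder (fun t => u t i 0) x (u' x i 0).
  move: i; apply: ord2P.
  - by rewrite (_ : (fun t => _) = m0) ?vec2_0//; apply/funext => t; rewrite vec2_0.
  - by rewrite (_ : (fun t => _) = m1) ?vec2_1//; apply/funext => t; rewrite vec2_1.
have Tu : calT tau q u w.
  exists u'; split; [exact: L2t|exact: L2t|exact: weak_der_classical|exact: L2t|].
  apply/aeW => x; rewrite -mulmxA.
  have [Q0 Q1] := Qv tau q x (u x).
  have [s0 s1] := diagv 1 (-1) (u' x).
  have [r0 r1] := diagv 1 (-1) (Qmx tau q x *m u x).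
  apply: col2P.
  - rewrite linE s0 r0 Q0 /w mxE /u /u' !vec2_0 vec2_1.
    rewrite (_ : 'i * _ - _ = - ('i * 'i) * z * m0 x); last by ring.
    by rewrite ii opprK mul1r.
  - rewrite linE s1 r1 Q1 /w mxE /u /u' !vec2_1 vec2_0.
    rewrite (_ : 'i * _ - _ = - ('i * 'i) * z * m1 x); last by ring.
    by rewrite ii opprK mul1r.
have := uniq_ (fun=> 0) u (fun=> 0).
move=> /(_ (L2t _ tz)).
have S1 : solves (calT tau q) z u (fun=> 0).
  by exists w => //; apply/aeW => x; rewrite subrr.
have S2 : solves (calT tau q) z (fun=> 0) (fun=> 0).
  exists (fun=> 0); last by apply/aeW => x; rewrite scaler0 subrr.
  exists (fun=> 0); split; [exact: L2t|exact: L2t| |exact: L2t|].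
    apply: weak_der_classical => //.
    by move=> i x; rewrite mxE; exact: cder_cst.
  by apply/aeW => x; rewrite !mulmx0 !scaler0 subrr.
move=> /(_ S1 S2) hae.
have h0 := ae0_continuous (fun i => (tu i).1) hae x0.
case: hx0; apply.
  by move/(congr1 (fun v : C2 => v 0 0)) : h0; rewrite vec2_0 mxE.
by move/(congr1 (fun v : C2 => v 1 0)) : h0; rewrite vec2_1 mxE.
Qed.

End Spectrum.

(** * Zeros of the scattering coefficient are eigenvalues *)

Section Eigenfunction.
Context {R : realType}.
Local Notation C := R[i].
Implicit Types (q p f g : R -> C) (z : C) (N x s : R).

Lemma Re_inv (z : C) : cRe z^-1 = cRe z / (cRe z * cRe z + cIm z * cIm z).
Proof. by case: z. Qed.

Lemma Im_inv (z : C) : cIm z^-1 = - (cIm z / (cRe z * cRe z + cIm z * cIm z)).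
Proof. by case: z. Qed.

Lemma cderV (F : R -> C) x d : F x != 0 -> cder F x d ->
  cder (fun t => (F t)^-1) x (- d * ((F x)^-1 * (F x)^-1)).
Proof.
move=> F0 [h1 h2].
pose n t : R := cRe (F t) * cRe (F t) + cIm (F t) * cIm (F t).
have n0 : n x != 0.
  rewrite /n -!expr2 -cn_sqr expf_neq0//; apply: contra F0 => /eqP/cn_eq0 ->//.
have dn := is_derive_rD (is_derive_rM h1 h1) (is_derive_rM h2 h2).
have dv := is_deriveV n0 dn.
have e : cRe (F x) * cRe (F x) + cIm (F x) * cIm (F x) != 0 by exact: n0.
split.
- rewrite (_ : _ \o _ = fun t => cRe (F t) * (n t)^-1); last first.
    by apply/funext => t; exact: Re_inv.
  refine (is_derive_eq (is_derive_rM h1 dv) _).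
  rewrite (ReM (- d)) ReN ImN (ReM (F x)^-1) (ImM (F x)^-1) Re_inv Im_inv /n /GRing.scale /=.
  field.
  by rewrite ?expr2 e.
- rewrite (_ : _ \o _ = fun t => 0 - cIm (F t) * (n t)^-1); last first.
    by apply/funext => t; rewrite sub0r; exact: Im_inv.
  refine (is_derive_eq (is_derive_rB (is_derive_cst 0 x 1) (is_derive_rM h2 dv)) _).
  rewrite (ImM (- d)) ReN ImN (ReM (F x)^-1) (ImM (F x)^-1) Re_inv Im_inv /n /GRing.scale /=.
  field.
  by rewrite ?expr2 e.
Qed.

Lemma cder0_left (F : R -> C) A : (forall t, t <= A -> cder F t 0) ->
  forall x, x <= A -> F x = F A.
Proof.
move=> h x; rewrite le_eqVlt => /predU1P[->//|xA].
have aux (r : R -> R) : (forall t, t <= A -> is_derive t (1 : R) r 0) -> r x = r A.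
  move=> hr; have [] := @MVT R r (fun=> 0) x A xA.
  - by move=> t; rewrite in_itv/= => /andP[_ /ltW]; exact: hr.
  - apply: derivable_within_continuous => t; rewrite in_itv/= => /andP[_ tA].
    by have [] := hr t tA.
  - by move=> c _ /eqP; rewrite mul0r subr_eq0 => /eqP.
apply: complexP.
- exact: (aux (cRe \o F) (fun t tA => (h t tA).1)).
- exact: (aux (cIm \o F) (fun t tA => (h t tA).2)).
Qed.

(** Exponential decay beats the weight on every right half-line. *)
Lemma exp_om (d A : R) : 0 < d -> exists2 K, 0 <= K & forall x, A <= x ->
  expR (- (d * x)) <= K * om x.
Proof.
move=> d0; pose K := expR (2 * d * `|A|) * (1 + 4 / d ^+ 2).
have dd : 0 < d ^+ 2 by rewrite exprn_gt0.
have c0 : 0 <= 1 + 4 / d ^+ 2 by rewrite addr_ge0// divr_ge0// ltW.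
exists K; first by rewrite mulr_ge0// expR_ge0.
move=> x Ax.
have h1 (t : R) : 0 <= t -> expR (- (d * t)) * oneDsqr t <= 1 + 4 / d ^+ 2.
  move=> t0; have e1 : 1 + d * t / 2 <= expR (d * t / 2) by exact: expR_ge1Dx.
  have dt : 0 <= d * t by rewrite mulr_ge0// ltW.
  have e2 : (1 + d * t / 2) ^+ 2 <= expR (d * t).
    rewrite [in X in _ <= X](_ : d * t = d * t / 2 + d * t / 2); last by field.
    by rewrite expRD -expr2 ler_pXn2r ?nnegrE ?expR_ge0//; lra.
  have e3 : oneDsqr t <= (1 + 4 / d ^+ 2) * expR (d * t).
    apply: le_trans (ler_wpM2l c0 e2); rewrite WE.
    have e4 : (1 + 4 / d ^+ 2) * (1 + d * t / 2) ^+ 2 =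
      1 + t ^+ 2 + (d * t + (d * t) ^+ 2 / 4) + 4 / d ^+ 2 * (1 + d * t).
      by field; rewrite gt_eqF.
    rewrite e4.
    have : 0 <= 4 / d ^+ 2 * (1 + d * t) by rewrite mulr_ge0 ?divr_ge0 ?addr_ge0// ltW.
    by have := sqr_ge0 (d * t); lra.
  rewrite expRN mulrC ler_pdivrMr ?expR_gt0//.
have h2 : expR (- (d * x)) <= expR (2 * d * `|A|) * expR (- (d * `|x|)).
  rewrite -expRD ler_expR.
  have : `|x| - x <= 2 * `|A|.
    case: (leP 0 x) => x0; first by rewrite ger0_norm// subrr mulr_ge0.
    rewrite ltr0_norm//; have := ler_norm (- A); rewrite normrN; lra.
  by move=> h; have := ler_wpM2l (ltW d0) h; lra.
apply: le_trans h2 _; rewrite /K -[X in _ <= X]mulrA ler_wpM2l ?expR_ge0//.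
rewrite /om ler_pdivlMr ?W_gt0//.
have := h1 `|x| (normr_ge0 x).
by rewrite (_ : oneDsqr `|x| = oneDsqr x)// !WE real_normK// num_real.
Qed.

(** When the determinant vanishes, the solution decaying at $+\infty$ is a multiple
   of the one decaying at $-\infty$. The proportionality is established on the
   half-line where the first component of the latter does not vanish, by
   differentiating the quotient. *)
Lemma eigen_exists M q p z : 0 < M -> pot M q -> pot M p -> 0 < cIm z ->
  aco q p z = 0 -> exists m0 m1, [/\
    forall x, cder m0 x (- ('i * z) * m0 x + q x * m1 x),
    forall x, cder m1 x ('i * z * m1 x + p x * m0 x),
    tame m0, tame m1 & exists x, m1 x <> 0].
Proof.
move=> M0 hq hp zp a0; have z0 := ltW zp.
have js := jostP M0 hq hp z0.
have jt := jostP M0 (pot_oppf hp) (pot_oppf hq) z0.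
pose E (x : R) : C := cexp ('i * z * x%:C).
pose E' (x : R) : C := cexp (- ('i * z) * x%:C).
have dE x : cder E x ('i * z * E x) by exact: cder_cexp.
have dE' x : cder E' x (- ('i * z) * E' x) by exact: cder_cexp.
pose m0 x := E x * Vt q p z (- x); pose m1 x := E x * Ut q p z (- x).
pose n0 x := E' x * jU q p z x; pose n1 x := E' x * jV q p z x.
have dm0 x : cder m0 x (- ('i * z) * m0 x + q x * m1 x).
  apply: cder_eq (cderM (dE x) (Vt_der M0 hq hp z0 x)) _.
  by rewrite /m0 /m1; ring.
have dm1 x : cder m1 x ('i * z * m1 x + p x * m0 x).
  apply: cder_eq (cderM (dE x) (Ut_der M0 hq hp z0 x)) _.
  by rewrite /m0 /m1; ring.
have dn0 x : cder n0 x (- ('i * z) * n0 x + q x * n1 x).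
  apply: cder_eq (cderM (dE' x) (jsol_du hq js x)) _.
  by rewrite /n0 /n1; ring.
have det x : m1 x * n0 x - m0 x * n1 x = 0.
  rewrite /m0 /m1 /n0 /n1 (_ : _ - _ = E x * E' x *
    (jU q p z x * Ut q p z (- x) - jV q p z x * Vt q p z (- x))); last by ring.
  by rewrite (aco_cst M0 hq hp z0) a0 mulr0.
have [A hA] := jsol_vanu hq js ltr01.
have n0n x : x <= A -> n0 x != 0.
  move=> /hA h; rewrite mulf_neq0 ?cexp_neq0//; apply/eqP => u0.
  by move: h; rewrite u0 sub0r cnN cn1 ltxx.
have const x : x <= A -> m0 x * (n0 x)^-1 = m0 A * (n0 A)^-1.
  move=> xA; apply: (cder0_left (F := fun x => m0 x * (n0 x)^-1)) xA => t tA.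
  have nt := n0n t tA.
  apply: cder_eq (cderM (dm0 t) (cderV nt (dn0 t))) _.
  have := det t => dt.
  rewrite (_ : _ + _ = q t * ((n0 t)^-1 * (n0 t)^-1) * (m1 t * n0 t - m0 t * n1 t)).
    by rewrite dt mulr0.
  by field.
pose c := m0 A * (n0 A)^-1.
have em0 x : x <= A -> m0 x = c * n0 x.
  by move=> xA; rewrite /c -(const x xA) mulfVK// n0n.
have em1 x : x <= A -> m1 x = c * n1 x.
  move=> xA; apply: (mulIf (n0n x xA)).
  have := det x; rewrite (em0 x xA) => /eqP; rewrite subr_eq0 => /eqP ->.
  by ring.
have [N1 hN1] := jsol_bounded js; have [N2 hN2] := jsol_bounded jt.
have [K1 K10 hK1] := exp_om A zp; have [K2 K20 hK2] := exp_om (- A) zp.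
have cE x : cn (E x) = expR (- (cIm z * x)).
  by rewrite cn_cexp (ReM ('i * z)) (ReM 'i) !ReImE; congr expR; ring.
have cE' x : cn (E' x) = expR (- (cIm z * - x)).
  by rewrite cn_cexp (ReM (- _)) ReN (ReM 'i) !ReImE; congr expR; ring.
have N10 : 0 <= N1 by apply: le_trans (hN1 0).1; exact: cn_ge0.
have N20 : 0 <= N2 by apply: le_trans (hN2 0).1; exact: cn_ge0.
have bd (m n w v : R -> C) : (forall x, m x = E x * w (- x)) ->
    (forall x, cn (w x) <= N2) -> (forall x, n x = E' x * v x) ->
    (forall x, cn (v x) <= N1) -> (forall x, x <= A -> m x = c * n x) ->
    exists K, forall x, cn (m x) <= K * om x.
  move=> em hw en hv emn; exists (K1 * N2 + cn c * (K2 * N1)) => x.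
  have o0 := om_ge0 x.
  have p1 : 0 <= K1 * N2 * om x by rewrite !mulr_ge0.
  have p2 : 0 <= cn c * (K2 * N1) * om x by rewrite !mulr_ge0 ?cn_ge0.
  rewrite mulrDl; have [Ax|xA] := leP A x.
    apply: ler_wpDr => //; rewrite em cnM cE mulrAC.
    by apply: ler_pM; rewrite ?expR_ge0 ?cn_ge0 ?hK1.
  apply: ler_wpDl => //; rewrite (emn x (ltW xA)) cnM -mulrA; apply: ler_wpM2l; first exact: cn_ge0.
  rewrite en cnM cE' mulrAC.
  apply: ler_pM; rewrite ?expR_ge0 ?cn_ge0//.
  by rewrite -om_opp; apply: hK2; rewrite lerN2 ltW.
have cm0 : ccont m0 by exact: cder_cont dm0.
have cm1 : ccont m1 by exact: cder_cont dm1.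
have t0 : tame m0.
  split => //; apply: (bd m0 n0 (Vt q p z) (jU q p z)) => // x.
    exact: (hN2 x).2.
  exact: (hN1 x).1.
have t1 : tame m1.
  split => //; apply: (bd m1 n1 (Ut q p z) (jV q p z)) => // x.
    exact: (hN2 x).1.
  exact: (hN1 x).2.
have [D hD] := jsol_vanu (pot_oppf hp) jt ltr01.
have nz : m1 (- D) <> 0.
  apply/eqP; rewrite mulf_neq0 ?cexp_neq0// opprK; apply/eqP => u0.
  by have := hD D (lexx _); rewrite -/(Ut q p z D) u0 sub0r cnN cn1 ltxx.
by exists m0, m1; split => //; exists (- D).
Qed.

End Eigenfunction.

(** * The jump of the resolvent and its expansion *)

Section RealLine.
Context {R : realType}.
Local Notation C := R[i].
Implicit Types (q p f g : R -> C) (z : C) (M N x s l : R).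

(** The components of $\mathbf m_{1,-}$ (L) and $\mathbf m_{2,+}$ (R). For the
   pair $(p, q)$ at $-z$ the same formulas give $\mathbf m_{1,+}$ and
   $\mathbf m_{2,-}$ with their components exchanged. *)
Definition mL0 q p z x : C := cexp (- ('i * z * x%:C)) * jU q p z x.
Definition mL1 q p z x : C := cexp (- ('i * z * x%:C)) * jV q p z x.
Definition mR0 q p z x : C := cexp ('i * z * x%:C) * Vt q p z (- x).
Definition mR1 q p z x : C := cexp ('i * z * x%:C) * Ut q p z (- x).

(** This is $c_+$; for $(p, q)$ at $-z$ and the exchanged sources it is $-c_-$. *)
Definition coef q p z f1 f2 : C := (aco q p z)^-1 *
  cintegral setT (fun s => - mL1 q p z s * f1 s + mL0 q p z s * f2 s).

(** Solutions of $\mathbf m' = (-iz\sigma_3 + Q) \mathbf m$. *)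
Definition dsol q p z (m0 m1 : R -> C) : Prop := forall x,
  cder m0 x (- ('i * z) * m0 x + q x * m1 x) /\
  cder m1 x ('i * z * m1 x + p x * m0 x).

Lemma wronskian q p z a0 a1 b0 b1 : dsol q p z a0 a1 -> dsol q p z b0 b1 ->
  forall x y, a0 x * b1 x - a1 x * b0 x = a0 y * b1 y - a1 y * b0 y.
Proof.
move=> ha hb; apply: (cder0_cst (F := fun x => a0 x * b1 x - a1 x * b0 x)) => x.
have [da0 da1] := ha x; have [db0 db1] := hb x.
by apply: cder_eq (cderB (cderM da0 db1) (cderM da1 db0)) _; ring.
Qed.

Lemma dsol_swap q p z m0 m1 : dsol p q (- z) m0 m1 -> dsol q p z m1 m0.
Proof.
move=> h x; have [d0 d1] := h x; split.
- by apply: cder_eq d1 _; ring.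
- by apply: cder_eq d0 _; ring.
Qed.

Section WithPotential.
Variables (M : R) (q p : R -> C).
Hypotheses (M0 : 0 < M) (hq : pot M q) (hp : pot M p).

Lemma mL_dsol z : 0 <= cIm z -> dsol q p z (mL0 q p z) (mL1 q p z).
Proof.
move=> z0 x; have js := jostP M0 hq hp z0; split.
- apply: cder_eq (cderM (cder_cexpN ('i * z) x) (jsol_du hq js x)) _.
  by rewrite /mL0 /mL1; ring.
- apply: cder_eq (cderM (cder_cexpN ('i * z) x) (jsol_dv hp z0 js x)) _.
  by rewrite /mL0 /mL1; ring.
Qed.

Lemma mR_dsol z : 0 <= cIm z -> dsol q p z (mR0 q p z) (mR1 q p z).
Proof.
move=> z0 x; split.
- apply: cder_eq (cderM (cder_cexp ('i * z) x) (Vt_der M0 hq hp z0 x)) _.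
  by rewrite /mR0 /mR1; ring.
- apply: cder_eq (cderM (cder_cexp ('i * z) x) (Ut_der M0 hq hp z0 x)) _.
  by rewrite /mR0 /mR1; ring.
Qed.

Lemma mLR_det z x : 0 <= cIm z ->
  mL0 q p z x * mR1 q p z x - mL1 q p z x * mR0 q p z x = aco q p z.
Proof.
move=> z0; rewrite -(aco_cst M0 hq hp z0 x) /mL0 /mL1 /mR0 /mR1.
rewrite (_ : _ - _ = cexp (- ('i * z * x%:C)) * cexp ('i * z * x%:C) *
  (jU q p z x * Ut q p z (- x) - jV q p z x * Vt q p z (- x))); last by ring.
by rewrite cexpNK mul1r.
Qed.

Definition hL z f1 f2 s : C := - mL1 q p z s * f1 s + mL0 q p z s * f2 s.
Definition hR z f1 f2 s : C := mR1 q p z s * f1 s - mR0 q p z s * f2 s.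

Lemma cn_cexp_real z x : cIm z = 0 -> cn (cexp ('i * z * x%:C) : C) <= 1.
Proof.
by move=> z0; rewrite cn_cexp (ReM ('i * z)) (ReM 'i) !ReImE z0 !mul0r mulr0 !subr0 mul0r mulr0 subr0 expR0.
Qed.

Lemma hL_tame z f1 f2 : cIm z = 0 -> tame f1 -> tame f2 -> tame (hL z f1 f2).
Proof.
move=> z0 t1 t2; have z0' : 0 <= cIm z by rewrite z0.
have := Jin_tame M0 hq hp z0' t1 t2.
have h x : cn (cexp (- ('i * z) * x%:C) : C) <= 1.
  by rewrite -mulrN; apply: cn_cexp_real; rewrite ImN z0 oppr0.
move=> /(tameM (ccont_cexp (- ('i * z))) h).
rewrite (_ : (fun s => _) = hL z f1 f2)//; apply/funext => s.
by rewrite /hL /Jin /mL0 /mL1 mulNr; ring.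
Qed.

Lemma hR_eq z f1 f2 s : hR z f1 f2 (- s) = cexp (- ('i * z) * s%:C) *
  Jin (oppf p) (oppf q) z (opp1 f2) (opp1 f1) s.
Proof.
rewrite /hR /Jin /mR0 /mR1 /Vt /Ut opprK rmorphN /opp1.
by rewrite (_ : 'i * z * - s%:C = - ('i * z) * s%:C); ring.
Qed.

Lemma hR_tame z f1 f2 : cIm z = 0 -> tame f1 -> tame f2 -> tame (hR z f1 f2).
Proof.
move=> z0 t1 t2; have z0' : 0 <= cIm z by rewrite z0.
have := Jin_tame M0 (pot_oppf hp) (pot_oppf hq) z0' (tame_opp t2) (tame_opp t1).
have h x : cn (cexp (- ('i * z) * x%:C) : C) <= 1.
  by rewrite -mulrN; apply: cn_cexp_real; rewrite ImN z0 oppr0.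
move=> /(tameM (ccont_cexp (- ('i * z))) h) /tame_opp.
rewrite (_ : (fun s => _) = hR z f1 f2)//; apply/funext => s.
by rewrite -[RHS](congr1 (hR z f1 f2) (opprK s)) hR_eq.
Qed.

(** Completing the integral over $(-\infty, x]$ in the resolvent to the whole line
   isolates the coefficient of $\mathbf m_{2,+}$; what remains is an integral over
   the right half-line only. *)
Lemma S_half z f1 f2 x : cIm z = 0 -> tame f1 -> tame f2 ->
  S1 q p z f1 f2 x - coef q p z f1 f2 * mR0 q p z x =
    - (aco q p z)^-1 * (mR0 q p z x * cintegral `[x, +oo[ (hL z f1 f2) +
                        mL0 q p z x * cintegral `[x, +oo[ (hR z f1 f2)) /\
  S2 q p z f1 f2 x - coef q p z f1 f2 * mR1 q p z x =
    - (aco q p z)^-1 * (mR1 q p z x * cintegral `[x, +oo[ (hL z f1 f2) +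
                        mL1 q p z x * cintegral `[x, +oo[ (hR z f1 f2)).
Proof.
move=> z0 t1 t2; have tL := hL_tame z0 t1 t2; have tR := hR_tame z0 t1 t2.
have eJ : J q p z f1 f2 x = cexp ('i * z * x%:C) * prim (hL z f1 f2) x.
  rewrite /J /Kop mulNr opprK; congr (_ * prim _ x); apply/funext => s.
  by rewrite /hL /Jin /mL0 /mL1 mulNr; ring.
have eJ' : J (oppf p) (oppf q) z (opp1 f2) (opp1 f1) (- x) =
    cexp (- ('i * z * x%:C)) * cintegral `[x, +oo[ (hR z f1 f2).
  have [_ ->] := cintegral_rray (tame_int (mrray x) tR).
  rewrite /J /Kop (_ : - (- ('i * z) * (- x)%:C) = - ('i * z * x%:C)).
    by congr (_ * prim _ (- x)); apply/funext => s; rewrite hR_eq.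
  by rewrite rmorphN; ring.
have eT : coef q p z f1 f2 = (aco q p z)^-1 *
    (prim (hL z f1 f2) x + cintegral `[x, +oo[ (hL z f1 f2)).
  by rewrite -(cintegral_split x tL).
by rewrite /S1 /S2 eJ eJ' eT /mR0 /mR1 /mL0 /mL1; split; ring.
Qed.

End WithPotential.

(** The kernel of the propagator does not depend on the basis of solutions in which
   it is written: both sides are the product of the two fundamental matrices at
   $x$ and $s$, and a change of basis multiplies the determinant by
   $\beta\gamma - \alpha\delta$. *)
Lemma kernel_alg (a al be ga de nx rx n0 n1 r0 r1 f1 f2 : C) :
  a != 0 -> be * ga - al * de != 0 ->
  a^-1 * (rx * (- n1 * f1 + n0 * f2) + nx * (r1 * f1 - r0 * f2)) =
  ((be * ga - al * de) * a)^-1 *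
    ((ga * nx + de * rx) * (- (al * n0 + be * r0) * f2 + (al * n1 + be * r1) * f1) +
     (al * nx + be * rx) * ((ga * n0 + de * r0) * f2 - (ga * n1 + de * r1) * f1)).
Proof. by move=> a0 D0; field; rewrite a0 D0. Qed.

Section Swap.
Variables (M : R) (q p : R -> C).
Hypotheses (M0 : 0 < M) (hq : pot M q) (hp : pot M p).

(** On the real line the boundary values of the resolvent from the two half-planes
   are both bounded solutions of the same equation. After removal of the terms in
   $\mathbf m_{2,+}$ and $\mathbf m_{2,-}$ both are the solution given by the
   propagator on the right half-line, hence equal. *)
Lemma S_jump z f1 f2 x : cIm z = 0 -> tame f1 -> tame f2 ->
  aco q p z <> 0 -> aco p q (- z) <> 0 ->
  S1 q p z f1 f2 x - S2 p q (- z) f2 f1 x =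
    coef q p z f1 f2 * mR0 q p z x - coef p q (- z) f2 f1 * mR1 p q (- z) x /\
  S2 q p z f1 f2 x - S1 p q (- z) f2 f1 x =
    coef q p z f1 f2 * mR1 q p z x - coef p q (- z) f2 f1 * mR0 p q (- z) x.
Proof.
move=> z0 t1 t2 /eqP a0 /eqP a0'.
have zn : cIm (- z) = 0 by rewrite ImN z0 oppr0.
have zp : 0 <= cIm z by rewrite z0.
have znp : 0 <= cIm (- z) by rewrite zn.
have [A1 A2] := S_half M0 hq hp x z0 t1 t2.
have [B1 B2] := S_half M0 hp hq x zn t2 t1.
have tL := hL_tame M0 hq hp z0 t1 t2; have tR := hR_tame M0 hq hp z0 t1 t2.
have tL' := hL_tame M0 hp hq zn t2 t1; have tR' := hR_tame M0 hp hq zn t2 t1.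
have iL := tame_int (mrray x) tL; have iR := tame_int (mrray x) tR.
have iL' := tame_int (mrray x) tL'; have iR' := tame_int (mrray x) tR'.
have comb (c d e : C) (g h : R -> C) : cintegrable `[x, +oo[ g -> cintegrable `[x, +oo[ h ->
    c * (d * cintegral `[x, +oo[ g + e * cintegral `[x, +oo[ h) =
    cintegral `[x, +oo[ (fun s => c * (d * g s + e * h s)).
  move=> ig ih; have mx := mrray x.
  rewrite cintegralZ//; last by apply: cintegrableD => //; exact: cintegrableZ.
  by rewrite cintegralD//; [rewrite !cintegralZ|exact: cintegrableZ|exact: cintegrableZ].
have sn := mL_dsol M0 hq hp zp; have sr := mR_dsol M0 hq hp zp.
have sv := dsol_swap (mL_dsol M0 hp hq znp); have sw := dsol_swap (mR_dsol M0 hp hq znp).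
set n0 := mL0 q p z in sn *; set n1 := mL1 q p z in sn *.
set r0 := mR0 q p z in sr *; set r1 := mR1 q p z in sr *.
set v1 := mL0 p q (- z) in sv *; set v0 := mL1 p q (- z) in sv *.
set w1 := mR0 p q (- z) in sw *; set w0 := mR1 p q (- z) in sw *.
set a := aco q p z in a0 A1 A2 *; set a' := aco p q (- z) in a0' B1 B2 *.
have det t : n0 t * r1 t - n1 t * r0 t = a by exact: (mLR_det M0 hq hp).
have det' t : v1 t * w0 t - v0 t * w1 t = a' by exact: (mLR_det M0 hp hq).
clearbody a a'.
(* Coordinates of the second basis of solutions in the first; as quotients of
   Wronskians they do not depend on the point. *)
pose al := (v0 x * r1 x - v1 x * r0 x) / a; pose be := (n0 x * v1 x - n1 x * v0 x) / a.
pose ga := (w0 x * r1 x - w1 x * r0 x) / a; pose de := (n0 x * w1 x - n1 x * w0 x) / a.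
have ev t : v0 t = al * n0 t + be * r0 t /\ v1 t = al * n1 t + be * r1 t.
  rewrite /al /be (wronskian sv sr x t) (wronskian sn sv x t) -(det t).
  by split; field; rewrite det a0.
have ew t : w0 t = ga * n0 t + de * r0 t /\ w1 t = ga * n1 t + de * r1 t.
  rewrite /ga /de (wronskian sw sr x t) (wronskian sn sw x t) -(det t).
  by split; field; rewrite det a0.
have ea : a' = (be * ga - al * de) * a.
  rewrite -(det' x) -(det x); have [-> ->] := ev x; have [-> ->] := ew x.
  by ring.
have D0 : be * ga - al * de != 0.
  by apply: contra a0' => /eqP D0; rewrite ea D0 mul0r.
have key1 s : - a^-1 * (r0 x * hL q p z f1 f2 s + n0 x * hR q p z f1 f2 s) =
    - a'^-1 * (w0 x * hL p q (- z) f2 f1 s + v0 x * hR p q (- z) f2 f1 s).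
  rewrite [LHS]mulNr [RHS]mulNr ea; congr (- _).
  rewrite /hL /hR -/n0 -/n1 -/r0 -/r1 -/v0 -/v1 -/w0 -/w1.
  have [-> _] := ev x; have [-> _] := ew x; have [-> ->] := ev s; have [-> ->] := ew s.
  exact: kernel_alg.
have key2 s : - a^-1 * (r1 x * hL q p z f1 f2 s + n1 x * hR q p z f1 f2 s) =
    - a'^-1 * (w1 x * hL p q (- z) f2 f1 s + v1 x * hR p q (- z) f2 f1 s).
  rewrite [LHS]mulNr [RHS]mulNr ea; congr (- _).
  rewrite /hL /hR -/n0 -/n1 -/r0 -/r1 -/v0 -/v1 -/w0 -/w1.
  have [_ ->] := ev x; have [_ ->] := ew x; have [-> ->] := ev s; have [-> ->] := ew s.
  exact: kernel_alg.
have E1 : S1 q p z f1 f2 x - coef q p z f1 f2 * r0 x =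
    S2 p q (- z) f2 f1 x - coef p q (- z) f2 f1 * w0 x.
  apply: etrans A1 (etrans (comb _ _ _ _ _ iL iR) (esym (etrans B2 _))).
  apply: etrans (comb _ _ _ _ _ iL' iR') _.
  by apply: eq_cintegral => s _; exact: (esym (key1 s)).
have E2 : S2 q p z f1 f2 x - coef q p z f1 f2 * r1 x =
    S1 p q (- z) f2 f1 x - coef p q (- z) f2 f1 * w1 x.
  apply: etrans A2 (etrans (comb _ _ _ _ _ iL iR) (esym (etrans B1 _))).
  apply: etrans (comb _ _ _ _ _ iL' iR') _.
  by apply: eq_cintegral => s _; exact: (esym (key2 s)).
have mv (u1 u2 c1 c2 : C) : u1 - c1 = u2 - c2 -> u1 - u2 = c1 - c2.
  move=> h; rewrite (_ : u1 = (u1 - c1) + c1); last by ring.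
  by rewrite h; ring.
by split; exact: mv.
Qed.

(** Two integrations by parts. The remainders are bounded and holomorphic because
   they contain the resolvent itself. *)
Lemma S_expand f1 f2 x (d : R) : rapid 1 q -> rapid 1 p -> rapid 2 f1 -> rapid 2 f2 ->
  0 < d -> (forall z, 0 <= cIm z -> d <= cn (aco q p z)) ->
  exists g1 g2 : C -> C, [/\ hol g1, hol g2 & forall z, 0 <= cIm z ->
    S1 q p z f1 f2 x = - 'i * ck z * f1 x + ck z ^+ 2 * g1 z /\
    S2 q p z f1 f2 x = 'i * ck z * f2 x + ck z ^+ 2 * g2 z].
Proof.
move=> rq rp rf1 rf2 d0 hd.
have [r1 [e1 de1 re1]] := rf1; have [r2 [e2 de2 re2]] := rf2.
(* The sources after one integration by parts, and below after two. *)
pose n1 s := e1 s + f1 s + q s * f2 s.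
pose n2 s := - e2 s + f2 s - p s * f1 s.
have rn1 : rapid 1 n1.
  apply: rapidD; last by apply: rapidM => //; exact: rapidW.
  by apply: rapidD => //; exact: rapidW.
have rn2 : rapid 1 n2.
  apply: rapidD; last by apply: rapidN; apply: rapidM => //; exact: rapidW.
  by apply: rapidD; [exact: rapidN|exact: rapidW].
have [rn10 [k1 dk1 rk1]] := rn1; have [rn20 [k2 dk2 rk2]] := rn2.
pose m1 s := k1 s + n1 s + q s * n2 s.
pose m2 s := - k2 s + n2 s - p s * n1 s.
have rq0 := rapid_rapid0 rq; have rp0 := rapid_rapid0 rp.
have rm1 : rapid0 m1 by apply: rapid0D; [exact: rapid0D|exact: rapid0M].
have rm2 : rapid0 m2.
  apply: rapid0D; first by apply: rapid0D => //; exact: (@rapidN _ 0 _ rk2).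
  by apply: (@rapidN _ 0); exact: rapid0M.
have t0 (f : R -> C) : rapid0 f -> tame f by exact: (@rapid_tame _ 0).
have td1 := t0 _ (@rapid_rapid0 _ 1 _ re1); have td2 := t0 _ (@rapid_rapid0 _ 1 _ re2).
exists (fun z => n1 x - S1 q p z m1 m2 x), (fun z => - n2 x - S2 q p z m1 m2 x).
split.
- by apply: holB; [exact: hol_cst|exact: (S1_hol M0 hq hp x d0 hd)].
- by apply: holB; [exact: hol_cst|exact: (S2_hol M0 hq hp x d0 hd)].
move=> z z0.
have a0 : aco q p z <> 0.
  by move=> h; have := hd z z0; rewrite h cn0 leNgt d0.
have [s1 s2] := S_step M0 hq hp z0 a0 de1 de2 (t0 _ r1) (t0 _ r2) td1 td2
  (t0 _ rn10) (t0 _ rn20) x.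
have [s3 s4] := S_step M0 hq hp z0 a0 dk1 dk2 (t0 _ rn10) (t0 _ rn20) (t0 _ rk1) (t0 _ rk2)
  (t0 _ rm1) (t0 _ rm2) x.
rewrite -/n1 -/n2 in s1 s2 s3 s4; rewrite -/m1 -/m2 in s3 s4.
have zn := zi_neq0 z0.
have inv (u v y : C) : 'i * (z + 'i) * u + v = y -> u = - 'i * ck z * (y - v).
  move=> <-; rewrite addrK (_ : - 'i * ck z * _ = - ('i * 'i) * (ck z * (z + 'i)) * u).
    by rewrite ii /ck mulVf// opprK !mul1r.
  by ring.
have E1 := inv _ _ _ s1; have E2 := inv _ _ _ s2.
have E3 := inv _ _ _ s3; have E4 := inv _ _ _ s4.
rewrite E1 E2 E3 E4; split.
- rewrite (_ : _ * (f1 x - _) = - 'i * ck z * f1 x - - ('i * 'i) * - (ck z ^+ 2 * (n1 x - S1 q p z m1 m2 x)));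
    last by ring.
  by rewrite ii; ring.
- rewrite (_ : _ * (- f2 x - _) = 'i * ck z * f2 x - - ('i * 'i) * - (ck z ^+ 2 * (- n2 x - S2 q p z m1 m2 x)));
    last by ring.
  by rewrite ii; ring.
Qed.

End Swap.

(** The leading terms from the two half-planes combine into an integrable weight. *)
Lemma ck_sum (l : R) : ck l%:C + ck (- l%:C) = - (2 * 'i) * (om l)%:C.
Proof.
have h1 : (l%:C + 'i : C) != 0 by apply: zi_neq0.
have h2 : (- l%:C + 'i : C) != 0 by apply: zi_neq0; rewrite ImN /= oppr0.
have h3 : (l%:C + 'i) * (- l%:C + 'i) = - (oneDsqr l)%:C :> C.
  rewrite WE rmorphD rmorph1 rmorphXn/= (_ : _ * _ = - l%:C ^+ 2 + 'i * 'i); last by ring.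
  by rewrite ii; ring.
have W0 : (oneDsqr l)%:C != 0 :> C.
  by apply/eqP => /(congr1 (@complex.Re R)) /= /eqP; rewrite gt_eqF// W_gt0.
rewrite (_ : (om l)%:C = ((oneDsqr l)%:C)^-1); last by rewrite /om fmorphV.
rewrite /ck (_ : _ + _ = 2 * 'i * ((l%:C + 'i) * (- l%:C + 'i))^-1); last first.
  by field; rewrite h1 h2.
by rewrite h3 invrN; ring.
Qed.

Lemma om_tame : tame (fun l : R => (om l)%:C : C).
Proof.
split; first exact/ccontR/om_cont.
by exists 1 => l; rewrite cnR ger0_norm ?om_ge0// mul1r.
Qed.

Lemma cintegral_om : cintegral setT (fun l : R => (om l)%:C) = (pi : R)%:C :> C.
Proof.
rewrite cintegralT; last exact: om_tame.
have e : prim (fun l : R => (om l)%:C) 0 = (pi / 2)%:C :> C.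
  apply: complexP; rewrite /prim /cintegral /=.
    by rewrite om_prim /phi atan0 add0r.
  by rewrite Rintegral_cst ?mul0r//; exact: measurable_itv.
rewrite (_ : (fun s => _) = fun l : R => (om l)%:C); last first.
  by apply/funext => s; rewrite om_opp.
by rewrite e -rmorphD/= -splitr.
Qed.

End RealLine.

(** * The expansion formula *)

Section Expansion.
Context {R : realType}.
Local Notation C := R[i].
Local Notation C2 := 'cV[R[i]]_2.

Lemma entry_lincomb (a b : C) (u v : C2) i :
  (a *: u + b *: v) i 0 = a * u i 0 + b * v i 0.
Proof. by rewrite !mxE. Qed.

Lemma det2 (A : 'M[C]_2) : \det A = A 0 0 * A 1 1 - A 1 0 * A 0 1.
Proof.
have l0 : lift 0 0 = 1 :> 'I_2 by exact/val_inj.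
have l1 : lift 1 0 = 0 :> 'I_2 by exact/val_inj.
rewrite (expand_det_col A 0) sum2 /cofactor !det_mx11 !mxE l0 l1 expr0 expr1.
by ring.
Qed.

Lemma det_row2 (a b : C2) : \det (row_mx a b) = a 0 0 * b 1 0 - a 1 0 * b 0 0.
Proof.
have el i : row_mx a b i 0 = a i 0.
  by rewrite (_ : 0 = lshift 1 0 :> 'I_(1 + 1)) ?row_mxEl//; exact/val_inj.
have er i : row_mx a b i 1 = b i 0.
  by rewrite (_ : 1 = rshift 1 0 :> 'I_(1 + 1)) ?row_mxEr//; exact/val_inj.
by rewrite det2 !el !er.
Qed.

Variables (tau : C) (q : R -> C).
Local Notation p := (pQ tau q).

Section Entries.
Variable M : R.
Hypotheses (M0 : 0 < M) (hq : pot M q) (hp : pot M p).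

Lemma m1mE z x : 0 <= cIm z ->
  m1m tau q x z 0 0 = mL0 q p z x /\ m1m tau q x z 1 0 = mL1 q p z x.
Proof.
move=> z0; have [e0 e1] := r1mE M0 hq hp x z0.
by rewrite /mL0 /mL1 -e0 -e1 !mxE.
Qed.

Lemma m2pE z x : 0 <= cIm z ->
  m2p tau q x z 0 0 = mR0 q p z x /\ m2p tau q x z 1 0 = mR1 q p z x.
Proof.
move=> z0; have [e1 e0] := r2pE M0 hq hp x z0.
by rewrite /mR0 /mR1 /Vt /Ut -e1 -e0 !mxE.
Qed.

(** The exchange of components carries the lower half-plane to the upper one. *)
Lemma m1pE z x : cIm z <= 0 ->
  m1p tau q x z 0 0 = mL1 p q (- z) x /\ m1p tau q x z 1 0 = mL0 p q (- z) x.
Proof.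
move=> z0; have [e1 e0] := r1pE M0 hq hp x z0.
by rewrite /mL0 /mL1 -e1 -e0 !mxE !mulrN !mulNr !opprK.
Qed.

Lemma m2mE z x : cIm z <= 0 ->
  m2m tau q x z 0 0 = mR1 p q (- z) x /\ m2m tau q x z 1 0 = mR0 p q (- z) x.
Proof.
move=> z0; have [e0 e1] := r2mE M0 hq hp x z0.
by rewrite /mR0 /mR1 /Ut /Vt -e0 -e1 !mxE !mulrN !mulNr.
Qed.

Lemma scat_aE z : 0 <= cIm z -> scat_a tau q z = aco q p z.
Proof.
move=> z0; rewrite /scat_a det_row2.
have [a0 a1] := m1mE 0 z0; have [b0 b1] := m2pE 0 z0.
rewrite [X in X * _ - _]a0 [X in _ * X - _]b1 [X in _ - X * _]a1 [X in _ - _ * X]b0.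
exact: (mLR_det M0 hq hp).
Qed.

Lemma scat_AE z : cIm z <= 0 -> scat_A tau q z = aco p q (- z).
Proof.
move=> z0; rewrite /scat_A det_row2.
have [a0 a1] := m2mE 0 z0; have [b0 b1] := m1pE 0 z0.
rewrite [X in X * _ - _]a0 [X in _ * X - _]b1 [X in _ - X * _]a1 [X in _ - _ * X]b0.
have zn : 0 <= cIm (- z) by rewrite ImN oppr_ge0.
by rewrite -(mLR_det M0 hp hq 0 zn); ring.
Qed.

Lemma c_plusE (f : R -> C2) (l : R) :
  c_plus tau q f l = coef q p l%:C (fun s => f s 0 0) (fun s => f s 1 0).
Proof.
have l0 : 0 <= cIm (l%:C : C) by [].
rewrite /c_plus /coef (scat_aE l0); congr (_ * _).
apply: eq_cintegral => s _; have [a0 a1] := m1mE s l0.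
by rewrite [X in - X * _]a1 [X in _ + X * _]a0.
Qed.

Lemma c_minusE (f : R -> C2) (l : R) :
  c_minus tau q f l = - coef p q (- l%:C) (fun s => f s 1 0) (fun s => f s 0 0).
Proof.
have l0 : cIm (l%:C : C) <= 0 by [].
rewrite /c_minus /coef (scat_AE l0) mulNr; congr (- (_ * _)).
apply: eq_cintegral => s _; have [a0 a1] := m1pE s l0.
by rewrite [X in X * _ - _]a1 [X in _ - X * _]a0 mulNr addrC.
Qed.

Hypothesis hspec : spectrum (calT tau q) `<=` [set z : C | complex.Im z = 0].

Lemma aco_neq0 z : (forall l : R, aco q p l%:C <> 0) -> 0 <= cIm z -> aco q p z <> 0.
Proof.
move=> hr; rewrite le_eqVlt => /orP[/eqP zr|zi].
  rewrite (_ : z = (cRe z)%:C); first exact: hr.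
  by case: z zr => x y /= <-.
move=> /(eigen_exists M0 hq hp zi)[m0 [m1 [d0 d1 t0 t1 [x m1x]]]].
have : spectrum (calT tau q) z.
  by apply: (spectrum_eigen hq hp d0 d1 t0 t1); exists x; right.
by move/hspec => /= h; move: zi; rewrite h ltxx.
Qed.

(** Exchanging the components of an eigenfunction for $(p, q)$ at $z$ gives one for
   $(q, p)$ at $-z$. *)
Lemma aco_swap_neq0 z : (forall l : R, aco p q l%:C <> 0) -> 0 <= cIm z ->
  aco p q z <> 0.
Proof.
move=> hr; rewrite le_eqVlt => /orP[/eqP zr|zi].
  rewrite (_ : z = (cRe z)%:C); first exact: hr.
  by case: z zr => x y /= <-.
move=> /(eigen_exists M0 hp hq zi)[m0 [m1 [d0 d1 t0 t1 [x m1x]]]].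
have : spectrum (calT tau q) (- z).
  apply: (spectrum_eigen hq hp (m0 := m1) (m1 := m0) _ _ t1 t0); last by exists x; left.
  - by move=> y; apply: cder_eq (d1 y) _; ring.
  - by move=> y; apply: cder_eq (d0 y) _; ring.
by move/hspec; rewrite /= ImN => /eqP; rewrite oppr_eq0 => /eqP h; move: zi; rewrite h ltxx.
Qed.

End Entries.

(** Both remainders integrate to zero, the second after the reflection
   $\lambda \mapsto -\lambda$. *)
Lemma contour_expand (c : C) (g h : C -> C) (Phi : R -> C) : hol g -> hol h ->
  (forall l : R, Phi l =
     c * (om l)%:C + ck l%:C ^+ 2 * g l%:C - ck (- l%:C) ^+ 2 * h (- l%:C)) ->
  cintegrable setT Phi /\ cintegral setT Phi = c * (pi : R)%:C.
Proof.
move=> /contour[tg ig] /contour[th ih] e.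
have th' : tame (fun l : R => ck (- l%:C) ^+ 2 * h (- l%:C)).
  have := tame_opp th.
  by rewrite (_ : (fun s => _) = fun l : R => ck (- l%:C) ^+ 2 * h (- l%:C))//;
    apply/funext => l; rewrite rmorphN.
have ih' : cintegral setT (fun l : R => ck (- l%:C) ^+ 2 * h (- l%:C)) = 0.
  rewrite -ih -(cintegralT_opp th); apply: eq_cintegral => l _.
  by rewrite rmorphN.
have to : tame (fun l : R => c * (om l)%:C) by apply: tameZ; exact: om_tame.
have mT : measurable (setT : set (measurableTypeR R)) by exact: measurableT.
rewrite (funext e); split; first by apply/(tame_int mT)/tameB => //; exact: tameD.
rewrite cintegralB//; [|exact/(tame_int mT)/tameD|exact: tame_int].
rewrite cintegralD//; [|exact: tame_int|exact: tame_int].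
rewrite cintegralZ//; last by apply: tame_int => //; exact: om_tame.
by rewrite cintegral_om ig ih' subr0 addr0.
Qed.

(** The jump relation and the expansion in the two half-planes identify the
   integrand as $\mp 2 f / (1+\lambda^2)$ plus remainders of vanishing integral. *)
Lemma jost_expansion (f : R -> C2) (x : R) : cschwartz q -> vschwartz f ->
  spectrum (calT tau q) `<=` [set z : C | complex.Im z = 0] ->
  (forall l : R, scat_a tau q l%:C <> 0) ->
  (forall l : R, scat_A tau q l%:C <> 0) ->
  let Phi l := c_plus tau q f l *: m2p tau q x l%:C + c_minus tau q f l *: m2m tau q x l%:C in
  [/\ vintegrable setT Phi,
    cintegral setT (fun l => Phi l 0 0) = - 2 * f x 0 0 * (pi : R)%:C &
    cintegral setT (fun l => Phi l 1 0) = 2 * f x 1 0 * (pi : R)%:C].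
Proof.
move=> sq sf hspec ha hA Phi.
have rq := cschwartz_rapid 1 sq; have rp := conj_rapid tau rq.
have rf0 := cschwartz_rapid 2 (sf 0); have rf1 := cschwartz_rapid 2 (sf 1).
pose f0 s := f s 0 0; pose f1 s := f s 1 0.
have [_ [dq dq1 [Md pdq]]] := rq; have [_ [dp dp1 [Md' pdp]]] := rp.
have [Mq Mq0 pq] := rapid_pot rq; have [Mp Mp0 pp] := rapid_pot rp.
have [M [M0 hq hp hdq hdp]] : exists M, [/\ 0 < M, pot M q, pot M p, pot M dq & pot M dp].
  have Ma := normr_ge0 Md; have Mb := normr_ge0 Md'.
  exists (Mq + Mp + `|Md| + `|Md'|).
  have Mc := ler_norm Md; have Me := ler_norm Md'.
  split; first lra.
  - by apply: pot_mono pq; lra.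
  - by apply: pot_mono pp; lra.
  - by apply: pot_mono pdq; lra.
  - by apply: pot_mono pdp; lra.
have ra (l : R) : aco q p l%:C <> 0 by rewrite -(scat_aE M0 hq hp)//; exact: ha.
have rA (l : R) : aco p q l%:C <> 0.
  have e : - (- l)%:C = l%:C :> C by rewrite rmorphN opprK.
  have lm : cIm ((- l)%:C : C) <= 0 by [].
  by have := scat_AE M0 hq hp lm; rewrite e => <-; exact: hA.
have na z : 0 <= cIm z -> aco q p z <> 0 by exact: (aco_neq0 M0 hq hp hspec ra).
have nA z : 0 <= cIm z -> aco p q z <> 0 by exact: (aco_swap_neq0 M0 hq hp hspec rA).
have [d d0 hd] := aco_lower M0 hq hp hdq hdp dq1 dp1 na.
have [d' d'0 hd'] := aco_lower M0 hp hq hdp hdq dp1 dq1 nA.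
have [g1 [g2 [hg1 hg2 eg]]] := S_expand M0 hq hp x rq rp rf0 rf1 d0 hd.
have [k1 [k2 [hk1 hk2 ek]]] := S_expand M0 hp hq x rp rq rf1 rf0 d'0 hd'.
have t0 := rapid_tame rf0; have t1 := rapid_tame rf1.
have ii1 : 'i * 'i = -1 :> C by exact: ii.
have E (l : R) : Phi l 0 0 = - 2 * f x 0 0 * (om l)%:C + ck l%:C ^+ 2 * g1 l%:C
      - ck (- l%:C) ^+ 2 * k2 (- l%:C) /\
    Phi l 1 0 = 2 * f x 1 0 * (om l)%:C + ck l%:C ^+ 2 * g2 l%:C
      - ck (- l%:C) ^+ 2 * k1 (- l%:C).
  have l0 : cIm (l%:C : C) = 0 by [].
  have lp : 0 <= cIm (l%:C : C) by rewrite l0.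
  have lm : cIm (l%:C : C) <= 0 by rewrite l0.
  have ln : 0 <= cIm (- l%:C : C) by rewrite ImN l0 oppr0.
  have [j0 j1] := S_jump M0 hq hp x l0 t0 t1 (na _ lp) (nA _ ln).
  have [a0 a1] := m2pE M0 hq hp x lp; have [b0 b1] := m2mE M0 hq hp x lm.
  have [u1 u2] := eg _ lp; have [v1 v2] := ek _ ln.
  have cs := ck_sum l.
  have cp := c_plusE M0 hq hp f l; have cm := c_minusE M0 hq hp f l.
  have ent i : Phi l i 0 = c_plus tau q f l * m2p tau q x l%:C i 0 +
      c_minus tau q f l * m2m tau q x l%:C i 0.
    exact: entry_lincomb.
  have P0 : Phi l 0 0 = S1 q p l%:C f0 f1 x - S2 p q (- l%:C) f1 f0 x.
    apply: etrans (ent 0) _; apply: etrans _ (esym j0).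
    rewrite [X in X * _ + _]cp [X in _ + X * _]cm.
    by rewrite [X in _ * X + _]a0 [X in _ + _ * X]b0 mulNr.
  have P1 : Phi l 1 0 = S2 q p l%:C f0 f1 x - S1 p q (- l%:C) f1 f0 x.
    apply: etrans (ent 1) _; apply: etrans _ (esym j1).
    rewrite [X in X * _ + _]cp [X in _ + X * _]cm.
    by rewrite [X in _ * X + _]a1 [X in _ + _ * X]b1 mulNr.
  rewrite P0 P1 [X in X - _ = _ /\ _]u1 [X in _ - X = _ /\ _]v2.
  rewrite [X in _ /\ X - _ = _]u2 [X in _ /\ _ - X = _]v1; split.
  - rewrite (_ : _ - _ = - 'i * (ck l%:C + ck (- l%:C)) * f x 0 0 +
      ck l%:C ^+ 2 * g1 l%:C - ck (- l%:C) ^+ 2 * k2 (- l%:C)); last by ring.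
    rewrite cs (_ : - 'i * _ * _ = 2 * ('i * 'i) * f x 0 0 * (om l)%:C); last by ring.
    by rewrite ii1; ring.
  - rewrite (_ : _ - _ = 'i * (ck l%:C + ck (- l%:C)) * f x 1 0 +
      ck l%:C ^+ 2 * g2 l%:C - ck (- l%:C) ^+ 2 * k1 (- l%:C)); last by ring.
    rewrite cs (_ : 'i * _ * _ = - 2 * ('i * 'i) * f x 1 0 * (om l)%:C); last by ring.
    by rewrite ii1; ring.
have [i0 e0] := contour_expand hg1 hk2 (fun l => (E l).1).
have [i1 e1] := contour_expand hg2 hk1 (fun l => (E l).2).
by split => //; exact: ord2P.
Qed.

End Expansion.

Unset Implicit Arguments.
Set Strict Implicit.

Theorem mainTheorem1 (R : realType) (tau : R[i]) (q : R -> R[i])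
    (f : R -> 'cV[R[i]]_2)
    (htau : tau = 1 \/ tau = -1)
    (hq : cschwartz q)
    (hf : vschwartz f)
    (hspec : spectrum (calT tau q) `<=` [set lam : R[i] | complex.Im lam = 0])
    (ha : forall lam : R, scat_a tau q lam%:C <> 0)
    (hA : forall lam : R, scat_A tau q lam%:C <> 0) :
  forall x : R,
    vintegrable setT (fun lam : R =>
      c_plus tau q f lam *: m2p tau q x lam%:C
      + c_minus tau q f lam *: m2m tau q x lam%:C) /\
    f x = - ((2 * pi : R)%:C^-1 *: sigma3) *m
      vintegral setT (fun lam : R =>
        c_plus tau q f lam *: m2p tau q x lam%:C
        + c_minus tau q f lam *: m2m tau q x lam%:C).
Proof.
move=> x; have [iPhi e0 e1] := jost_expansion x hq hf hspec ha hA.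
split => //.
have pi0 : (pi : R)%:C != 0 :> R[i].
  by apply/eqP => /(congr1 (@complex.Re R)) /= /eqP; rewrite gt_eqF// pi_gt0.
rewrite mulNmx -scalemxAl; set v := vintegral _ _.
have [s0 s1] := diagv 1 (-1) v.
have v0 : v 0 0 = - 2 * f x 0 0 * (pi : R)%:C by rewrite -e0 mxE.
have v1 : v 1 0 = 2 * f x 1 0 * (pi : R)%:C by rewrite -e1 mxE.
clearbody v; have e2 : (2 * pi : R)%:C = 2 * (pi : R)%:C :> R[i] by rewrite rmorphM rmorph_nat.
have cancel (a P : R[i]) : P != 0 -> a = (2 * P)^-1 * (2 * a * P).
  by move=> P0; field; rewrite P0.
apply: col2P.
- rewrite [RHS]mxE [X in - X]mxE [X in _ * X]s0 v0 e2 mul1r !mulNr mulrN opprK.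
  exact: cancel.
- rewrite [RHS]mxE [X in - X]mxE [X in _ * X]s1 v1 e2 mulN1r mulrN opprK.
  exact: cancel.
Qed.
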